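(* Let $w\in S_n$ be a cograssmannian permutation with unique right ascent $s_z$, and let $A_w$, $|t|$ and $x(t)$ (for $t\in A_w$) be as defined in the context. Then, in the Hecke algebra of $S_n$, \[ C'_w = q^{-\frac{1}{2}\ell(w)} \sum_{t\in A_w} q^{\,|t|+\frac{1}{2}\ell(x(t))}\, B'_{x(t)}. \]
   Context: $S_n$ is the Coxeter group generated by adjacent transpositions $s_1,\ldots,s_{n-1}$; $s_i$ is a right ascent of $w$ if $\ell(ws_i)>\ell(w)$ and a right descent otherwise. $w$ is cograssmannian if it has at most one right ascent; here we assume it has exactly one, $s_z$. Hecke algebra $\mathcal{H}$: the $\mathbb{Z}[q^{1/2},q^{-1/2}]$-algebra with basis $\{T_x\}$, relations $T_sT_x=T_{sx}$ if $\ell(sx)>\ell(x)$, $T_sT_x=(q-1)T_x+qT_{sx}$ otherwise. The Kazhdan–Lusztig basis element is $C'_w=q^{-\frac12\ell(w)}\sum_{x\le w}P_{x,w}(q)T_x$ (the unique bar-invariant element of this form with $P_{w,w}=1$ and $\deg P_{x,w}\le (\ell(w)-\ell(x)-1)/2$ for $x<w$, bar involution $\overline{q^{1/2}}=q^{-1/2}$, $\overline{T_x}=T_{x^{-1}}^{-1}$), and $B'_x=q^{-\frac12\ell(x)}\sum_{y\le x}T_y$ (Bruhat order). Construction. Let $J=\{s_1,\ldots,s_{n-1}\}\setminus\{s_z\}$, $w_0^J$ the longest element of the parabolic subgroup $W_J$, and write $w=vw_0^J$ with $v$ the minimal-length representative of $wW_J$ ($v$ has unique right descent $s_z$ and is fully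 commutative). Fix the reduced word $\mathsf{w}=\mathsf{w}_1\cdots\mathsf{w}_\ell$ consisting of a reduced word for $v$ followed by $(s_1s_2\cdots s_{z-1})(s_1\cdots s_{z-2})\cdots(s_1)$ and $(s_{n-1}s_{n-2}\cdots s_{z+1})(s_{n-1}\cdots s_{z+2})\cdots(s_{n-1})$. The heap of $\mathsf{w}$ is the poset on positions $\{1,\ldots,\ell\}$ given by the transitive closure of $i\prec j$ whenever $i>j$ and $\mathsf{w}_i,\mathsf{w}_j$ do not commute; position $i$ lies in column $k$ if $\mathsf{w}_i=s_k$, and ''above'' means greater in this poset. The columns containing entries of (the positions of) $v$ form an interval; in each such column take the maximal $v$-entry. For each pair of consecutive such columns $k,k+1$ the two maximal entries are comparable; record ''('' if the one in column $k$ is above the one in column $k+1$ and '')'' otherwise, reading $k$ from left to right. Build a rooted tree $T(w)$: its non-root vertices are the matched pairs ''$(\cdots)$'' of this parenthesis string, one vertex a descendant of another iff its pair is enclosed by the other's, plus a root adjacent to all maximal such vertices. The leaves are the pairs of consecutive symbols ''()'', called valleys; the valley column is the column $k$ such that ''('' is recorded between columns $k-1,k$ and '')'' between $k,k+1$. The capacity of a valley is the number of entries of $v$ in its column. $A_w$ is the set of labelings of the edges of $T(w)$ by nonnegative integers that weakly increase along every path from the root to a leaf and such that the label of each edge incident to a leaf does not exceed that leaf's capacity; $|t|$ is the sum of the labels of $t$. For $t\in A_w$, start with the all-ones mask on $\mathsf{w}$; for each valley column with leaf-edge label $m$, set to $0$ the top $m$ entries of that column together with all heap entries above them; $x(t)$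 is the product, in order, of the $\mathsf{w}_i$ whose mask value is $1$. *)

(* Defs.v *)
From HB Require Import structures.
From mathcomp Require Import all_boot all_order all_algebra all_fingroup.
From mathcomp Require Import fraction.
From mathcomp Require Import boolp classical_sets fsbigop.
From mathcomp Require Import zify.

Set Implicit Arguments.
Unset Strict Implicit.
Unset Printing Implicit Defensive.

Import GRing.Theory.
Local Open Scope ring_scope.

(* The ring Z[q^(1/2), q^(-1/2)] is realised inside the field of fractions of
   Z[X], with X in the role of q^(1/2): a fraction belongs to it when some
   X^n clears its denominator. *)
Local Notation tofrac := (@FracField.tofrac {poly int}).

Definition is_laurent (f : {fraction {poly int}}) : bool :=
  `[< exists (m : nat) (p : {poly int}), f * tofrac 'X ^+ m = tofrac p >].

Lemma tofracX_neq0 : tofrac 'X != 0.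
Proof. by rewrite tofrac_eq0 polyX_eq0. Qed.

Lemma is_laurentP f :
  reflect (exists (m : nat) (p : {poly int}), f * tofrac 'X ^+ m = tofrac p)
          (is_laurent f).
Proof. exact: asboolP. Qed.

Fact is_laurent_subring : subring_closed is_laurent.
Proof.
split=> [|f g|f g].
- by apply/is_laurentP; exists 0, 1; rewrite expr0 mulr1 rmorph1.
- move=> /is_laurentP[a [p fE]] /is_laurentP[b [r gE]].
  apply/is_laurentP; exists (a + b)%N, (p * 'X^b - r * 'X^a).
  rewrite rmorphB !rmorphM !rmorphXn /= -fE -gE exprD mulrBl.
  by congr (_ - _); [rewrite mulrA | rewrite [_ ^+ a * _]mulrC mulrA].
- move=> /is_laurentP[a [p fE]] /is_laurentP[b [r gE]].
  apply/is_laurentP; exists (a + b)%N, (p * r).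
  by rewrite rmorphM /= -fE -gE exprD mulrACA.
Qed.
HB.instance Definition _ := GRing.isSubringClosed.Build
  {fraction {poly int}} is_laurent is_laurent_subring.

Record laurent := Laurent
  { laurent_val :> {fraction {poly int}}; _ : is_laurent laurent_val }.
HB.instance Definition _ := [isSub for laurent_val].
HB.instance Definition _ := [Choice of laurent by <:].
HB.instance Definition _ := [SubChoice_isSubComNzRing of laurent by <:].

Lemma laurent_val_inj : injective laurent_val.
Proof. exact: val_inj. Qed.
Fact laurent_val_is_zmod : zmod_morphism laurent_val.
Proof. exact: (rmorphB (\val : {rmorphism laurent -> _})). Qed.
Fact laurent_val_is_monoid : monoid_morphism laurent_val.
Proof.
split; first exact: (rmorph1 (\val : {rmorphism laurent -> _})).
exact: (rmorphM (\val : {rmorphism laurent -> _})).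
Qed.
HB.instance Definition _ := GRing.isZmodMorphism.Build laurent
  {fraction {poly int}} laurent_val laurent_val_is_zmod.
HB.instance Definition _ := GRing.isMonoidMorphism.Build laurent
  {fraction {poly int}} laurent_val laurent_val_is_monoid.

Lemma laurent_val_eq0 (f : laurent) : (laurent_val f == 0) = (f == 0).
Proof. by rewrite -(inj_eq laurent_val_inj) rmorph0. Qed.

Definition laurent_unit : pred laurent :=
  fun f => (f != 0) && is_laurent (laurent_val f)^-1.
Definition laurent_inv (f : laurent) : laurent :=
  insubd f (laurent_val f)^-1.

Fact laurent_mulVx : {in laurent_unit, left_inverse 1 laurent_inv *%R}.
Proof.
move=> f /andP[f0 fV]; apply: laurent_val_inj; rewrite rmorphM rmorph1 /=.
have -> : laurent_val (laurent_inv f) = (laurent_val f)^-1 by exact: insubdK.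
by apply: mulVf; rewrite laurent_val_eq0.
Qed.
Fact laurent_unitPl (f g : laurent) : g * f = 1 -> laurent_unit f.
Proof.
move=> gf1; have f0 : f != 0.
  by apply/eqP=> f0; move/eqP: gf1; rewrite f0 mulr0 eq_sym oner_eq0.
have /= gfv : laurent_val g * laurent_val f = 1.
  by rewrite -rmorphM gf1 rmorph1.
have vf0 : laurent_val f != 0 by rewrite laurent_val_eq0.
rewrite /laurent_unit f0 -[_^-1]mul1r -gfv mulfK; last exact: vf0.
by case: (g).
Qed.
Fact laurent_inv_out : {in [predC laurent_unit], laurent_inv =1 id}.
Proof.
move=> f; rewrite inE unfold_in /laurent_unit /laurent_inv negb_and negbK.
case/orP=> [/eqP-> | fV]; last by rewrite /insubd insubN.
apply: laurent_val_inj; rewrite [LHS]val_insubd.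
by rewrite rmorph0 invr0; case: ifP.
Qed.
HB.instance Definition _ := GRing.ComNzRing_hasMulInverse.Build laurent
  laurent_mulVx laurent_unitPl laurent_inv_out.

Fact is_laurent_polyX : is_laurent (tofrac 'X).
Proof. by apply/is_laurentP; exists 0%N, 'X; rewrite expr0 mulr1. Qed.

Definition qh : laurent := Laurent is_laurent_polyX.
Definition q : laurent := qh ^+ 2.

Lemma qh_unit : qh \is a GRing.unit.
Proof.
have X0 : qh != 0 by rewrite -(inj_eq laurent_val_inj) rmorph0 tofracX_neq0.
rewrite unfold_in /= /laurent_unit X0; apply/is_laurentP; exists 1%N, 1.
by rewrite mulVf ?tofracX_neq0 ?rmorph1.
Qed.

Lemma q_unit : q \is a GRing.unit.
Proof. by rewrite unitrX ?qh_unit. Qed.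

Lemma qhVX m : qh^-1 ^+ m * qh ^+ m = 1.
Proof. by rewrite -exprMn mulVr ?qh_unit // expr1n. Qed.

Definition eval_at (a : laurent) (p : {poly int}) : laurent :=
  (map_poly intr p).[a].

Fact eval_at_is_zmod a : zmod_morphism (eval_at a).
Proof. by move=> p r; rewrite /eval_at rmorphB hornerD hornerN. Qed.
Fact eval_at_is_monoid a : monoid_morphism (eval_at a).
Proof.
by split=> [|p r]; rewrite /eval_at ?rmorph1 ?hornerC // rmorphM hornerM.
Qed.
HB.instance Definition _ a := GRing.isZmodMorphism.Build _ _ (eval_at a)
  (eval_at_is_zmod a).
HB.instance Definition _ a := GRing.isMonoidMorphism.Build _ _ (eval_at a)
  (eval_at_is_monoid a).

Lemma eval_atX a : eval_at a 'X = a.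
Proof. by rewrite /eval_at map_polyX hornerX. Qed.

Lemma val_eval_qh p : laurent_val (eval_at qh p) = tofrac p.
Proof.
elim/poly_ind: p => [|p c IHp]; first by rewrite !rmorph0.
rewrite !rmorphD !rmorphM /= IHp eval_atX; congr (_ + _).
have -> : c%:P = c%:~R by rewrite -[c in LHS]intz rmorph_int.
by rewrite !rmorph_int.
Qed.

Lemma eval_qh_inj : injective (eval_at qh).
Proof.
by move=> p r /(congr1 laurent_val); rewrite !val_eval_qh => /eqP; rewrite tofrac_eq => /eqP.
Qed.

(* Every Laurent polynomial is p(q^(1/2)) q^(-m/2) for some p in Z[X]; the bar
   involution sends it to p(q^(-1/2)) q^(m/2). *)
Fact laurent_fracP (f : laurent) :
  exists mp : nat * {poly int}, f * qh ^+ mp.1 = eval_at qh mp.2.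
Proof.
have /is_laurentP[m [p fE]] : is_laurent (laurent_val f) by case: f.
by exists (m, p); apply: laurent_val_inj; rewrite val_eval_qh rmorphM rmorphXn.
Qed.
Definition bar (f : laurent) : laurent :=
  let: (m, p) := sval (cid (laurent_fracP f)) in
  eval_at qh^-1 p * qh ^+ m.

Lemma barE (f : laurent) m p :
  f * qh ^+ m = eval_at qh p -> bar f = eval_at qh^-1 p * qh ^+ m.
Proof.
rewrite /bar; case: cid => -[a r] /= fE fE'.
have pr : p * 'X^a = r * 'X^m.
  by apply: eval_qh_inj; rewrite !rmorphM !rmorphXn /= !eval_atX -fE -fE' mulrAC.
move/(congr1 (eval_at qh^-1)): pr; rewrite !rmorphM !rmorphXn /= !eval_atX => pr.
by rewrite -[LHS]mulr1 -(qhVX m) mulrACA -pr -mulrA [_ * (qh ^+ a * _)]mulrA qhVX mul1r.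
Qed.

Fact bar_is_zmod : zmod_morphism bar.
Proof.
move=> f g; have [[a p] /= fE] := laurent_fracP f.
have [[b r] /= gE] := laurent_fracP g.
rewrite (barE fE) (barE gE) (@barE _ (a + b)%N (p * 'X^b - r * 'X^a)).
  rewrite rmorphB !rmorphM !rmorphXn /= !eval_atX exprD mulrBl.
  by congr (_ - _); [|rewrite [qh ^+ a * _]mulrC]; rewrite mulrACA qhVX mulr1.
rewrite rmorphB !rmorphM !rmorphXn /= !eval_atX -fE -gE exprD mulrBl.
by congr (_ - _); [rewrite mulrA | rewrite [_ ^+ a * _]mulrC mulrA].
Qed.
Fact bar_is_monoid : monoid_morphism bar.
Proof.
split; first by rewrite (@barE _ 0%N 1) ?expr0 ?mulr1 ?rmorph1.
move=> f g; have [[a p] /= fE] := laurent_fracP f.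
have [[b r] /= gE] := laurent_fracP g.
rewrite (barE fE) (barE gE) (@barE _ (a + b)%N (p * r)).
  by rewrite rmorphM exprD mulrACA.
by rewrite rmorphM /= -fE -gE exprD mulrACA.
Qed.
HB.instance Definition _ := GRing.isZmodMorphism.Build _ _ bar bar_is_zmod.
HB.instance Definition _ := GRing.isMonoidMorphism.Build _ _ bar bar_is_monoid.

Lemma bar_qh : bar qh = qh^-1.
Proof. by rewrite (@barE _ 0%N 'X) ?expr0 ?mulr1 ?eval_atX. Qed.

(* The generator s_k exchanges the k-th and (k+1)-st points, which in 'I_n are
   the ordinals k-1 and k.  It is only meaningful for 0 < k < n (other values of
   k give the identity). *)
Definition simple (n k : nat) : 'S_n :=
  if (insub k.-1, insub k) is (Some i, Some j) then tperm i j else 1%g.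

Definition is_word (n : nat) (u : seq nat) : bool :=
  all (fun k => 0 < k < n)%N u.

Definition wprod (n : nat) (u : seq nat) : 'S_n :=
  (\prod_(k <- u) simple n k)%g.

Lemma simpleE n (i j : 'I_n) : j = i.+1 :> nat -> simple n j = tperm i j.
Proof.
move=> ij; rewrite /simple valK ij /=; case: insubP => [i' _ ii'|].
  by congr tperm; apply: val_inj.
by rewrite ltn_ord.
Qed.

Lemma simpleP n k : (0 < k < n)%N ->
  exists i j : 'I_n, [/\ i = k.-1 :> nat, j = k :> nat & simple n k = tperm i j].
Proof.
move=> /andP[k0 kn]; have k1n : (k.-1 < n)%N by lia.
exists (Ordinal k1n), (Ordinal kn); split=> //.
by rewrite -(@simpleE _ (Ordinal k1n) (Ordinal kn)) //=; lia.
Qed.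

Lemma simpleK n k : (simple n k * simple n k = 1)%g.
Proof.
rewrite /simple; case: insub => [i|]; last by rewrite mulg1.
by case: insub => [j|]; rewrite ?tperm2 ?mulg1.
Qed.

Lemma simpleV n k : ((simple n k)^-1 = simple n k)%g.
Proof. by apply/eqP; rewrite eq_invg_mul simpleK. Qed.

Lemma wprod_cons n k u : wprod n (k :: u) = (simple n k * wprod n u)%g.
Proof. by rewrite /wprod big_cons. Qed.

Lemma wprod_cat n u v : wprod n (u ++ v) = (wprod n u * wprod n v)%g.
Proof. by rewrite /wprod big_cat. Qed.

Lemma wprod_rcons n k u : wprod n (rcons u k) = (wprod n u * simple n k)%g.
Proof. by rewrite -cats1 wprod_cat wprod_cons /wprod big_nil mulg1. Qed.

Lemma wprod_rev n u : wprod n (rev u) = ((wprod n u)^-1)%g.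
Proof.
elim: u => [|k u IHu]; first by rewrite /wprod !big_nil invg1.
by rewrite rev_cons wprod_rcons IHu wprod_cons invMg simpleV.
Qed.

Section Inversions.
Variable n : nat.
Implicit Types (w x y : 'S_n) (i j a b : 'I_n).

Definition inversions w : {set 'I_n * 'I_n} :=
  [set p : 'I_n * 'I_n | (p.1 < p.2)%N && (w p.2 < w p.1)%N].

Lemma tperm_adj_lt i j a b : j = i.+1 :> nat -> (a, b) != (i, j) ->
  (a < b)%N -> (tperm i j a < tperm i j b)%N.
Proof.
move=> ij; rewrite xpair_eqE -!val_eqE /= => /nandP ab ltab.
move: ab ltab; case: tpermP => [->|->|/eqP + /eqP];
  case: tpermP => [->|->|/eqP + /eqP]; rewrite -?val_eqE /=; lia.
Qed.

Lemma card_inversions_tperm w i j : j = i.+1 :> nat -> (w i < w j)%N ->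
  #|inversions (tperm i j * w)| = #|inversions w|.+1.
Proof.
move=> ij wij; have ltij : (i < j)%N by rewrite ij.
set t := tperm i j.
pose f (p : 'I_n * 'I_n) := (t p.1, t p.2).
have fK : involutive f by move=> [a b]; rewrite /f /= !tpermK.
rewrite (cardsD1 (i, j)) inE /= !permM tpermL tpermR ltij wij add1n; congr _.+1.
rewrite -(card_imset _ (inv_inj fK)); apply: eq_card => -[a b].
apply/imsetP/idP => [[[c d]]|].
  rewrite !inE /= !permM => /and3P[cd ltcd ltw] [-> ->].
  rewrite /= ltw andbT; exact: tperm_adj_lt.
rewrite inE /= => /andP[ltab ltw]; exists (f (a, b)); rewrite ?fK //.
have abij : (a, b) != (i, j).
  by apply: contraTneq ltw => -[-> ->]; rewrite -leqNgt ltnW.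
rewrite !inE /= !permM !tpermK ltw andbT tperm_adj_lt // andbT.
apply/eqP=> -[ta tb]; move: ltab.
by rewrite -(tpermK i j a) -(tpermK i j b) -/t ta tb tpermL tpermR ltnNge ltnW.
Qed.

Lemma inversionsV w : #|inversions w^-1| = #|inversions w|.
Proof.
pose f (p : 'I_n * 'I_n) := (w p.2, w p.1).
have f_inj : injective f by move=> [a b] [c d] [/perm_inj-> /perm_inj->].
rewrite -[RHS](card_imset _ f_inj); apply: eq_card => -[a b].
apply/idP/imsetP => [|[[c d]]].
  rewrite inE /= => /andP[ab ltw].
  by exists (w^-1 b, w^-1 a)%g; rewrite /f /= ?permKV // inE /= !permKV ltw.
by rewrite !inE /= => /andP[cd ltw] [-> ->]; rewrite !permK ltw.
Qed.

Lemma perm_adj_ltN w i j : j = i.+1 :> nat ->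
  (w j <= w i)%N -> (w j < w i)%N.
Proof.
move=> ij; rewrite leq_eqVlt => /orP[/eqP/val_inj/perm_inj ji|//].
by move: ij; rewrite ji; lia.
Qed.

Lemma no_descent w :
  (forall i j, j = i.+1 :> nat -> (w i < w j)%N) -> w = 1%g.
Proof.
move=> incr; have le_w : forall i, (i <= w i)%N.
  suff H m : forall i, i = m :> nat -> (m <= w i)%N by move=> i; apply: H.
  elim: m => [//|m IHm] i im; have mn : (m < n)%N by have := ltn_ord i; lia.
  exact: leq_ltn_trans (IHm (Ordinal mn) erefl) (incr (Ordinal mn) _ im).
have [_] := leqif_sum (fun i (_ : true) => leqif_eq (le_w i)).
have -> : (\sum_i w i = \sum_(i : 'I_n) i)%N.
  rewrite (reindex_inj (@perm_inj _ w^-1)) /=.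
  by apply: eq_bigr => i _; rewrite permKV.
rewrite eqxx => /esym/forallP weq.
by apply/permP=> i; rewrite perm1; apply/val_inj/esym; have /eqP := weq i.
Qed.

Lemma inversions1 : #|inversions 1| = 0%N.
Proof. by apply: eq_card0 => -[a b]; apply/negbTE; rewrite inE /= !perm1; lia. Qed.

Lemma word_of_perm w :
  exists u, [/\ is_word n u, size u = #|inversions w| & wprod n u = w].
Proof.
move: {2}#|inversions w| (leqnn #|inversions w|) => m.
elim: m w => [|m IHm] w.
all: have [/no_descent ->|/existsNP[i /existsNP[j /not_implyP[ij]]]] :=
  pselect (forall i j, j = i.+1 :> nat -> (w i < w j)%N).
all: try by exists [::]; rewrite inversions1 /wprod big_nil.
all: move=> /negP; rewrite -leqNgt => lew.
all: have ltw := perm_adj_ltN ij lew.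
all: have := @card_inversions_tperm (tperm i j * w) _ _ ij;
  rewrite !permM tpermL tpermR mulgA tperm2 mul1g => /(_ ltw) wE.
  by rewrite wE.
rewrite wE ltnS => /IHm[u [uw us uP]].
exists (nat_of_ord j :: u); split=> /=.
- by rewrite uw ltn_ord ij.
- by rewrite us.
- by rewrite wprod_cons uP (simpleE ij) mulgA tperm2 mul1g.
Qed.

End Inversions.

Fact length_subproof n (w : 'S_n) : exists m : nat,
  `[< exists u, [/\ is_word n u, size u = m & wprod n u = w] >].
Proof.
by have [u Hu] := word_of_perm w; exists #|inversions w|; apply/asboolP; exists u.
Qed.

Definition len n (w : 'S_n) : nat := ex_minn (length_subproof w).

Definition is_reduced_word n (w : 'S_n) (u : seq nat) : Prop :=
  [/\ is_word n u, size u = len w & wprod n u = w].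

Section LengthTheory.
Variable n : nat.
Implicit Types (w x y : 'S_n) (i j a b : 'I_n) (u : seq nat).

Lemma reduced_word_exists w : exists u, is_reduced_word w u.
Proof. by rewrite /is_reduced_word /len; case: ex_minnP => m /asboolP. Qed.

Lemma inversions_simple w k : (0 < k < n)%N ->
  (#|inversions (simple n k * w)| <= #|inversions w|.+1)%N.
Proof.
move=> kn; have [i [j [ik jk ->]]] := simpleP kn; have ij : j = i.+1 :> nat by lia.
have [lt|] := ltnP (w i) (w j); first by rewrite card_inversions_tperm.
move=> /(perm_adj_ltN ij) ltw.
have := @card_inversions_tperm _ (tperm i j * w) _ _ ij.
by rewrite !permM tpermL tpermR mulgA tperm2 mul1g => /(_ ltw) ->; do 2!apply: leqW.
Qed.

Lemma len_inversions w : len w = #|inversions w|.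
Proof.
rewrite /len; case: ex_minnP => m /asboolP[u [uw us uP]] mmin.
apply/eqP; rewrite eqn_leq; apply/andP; split.
  by apply: mmin; apply/asboolP; exact: word_of_perm.
move: uw; rewrite -us -uP; elim: u {us uP mmin} => [|k u IHu] /=.
  by rewrite /wprod big_nil inversions1.
move=> /andP[kn /IHu le]; rewrite wprod_cons.
exact: leq_trans (inversions_simple _ kn) _.
Qed.

Lemma len1 : len (1 : 'S_n)%g = 0%N.
Proof. by rewrite len_inversions inversions1. Qed.

Lemma lenV w : len w^-1%g = len w.
Proof. by rewrite !len_inversions inversionsV. Qed.

Lemma len_wprod u : is_word n u -> (len (wprod n u) <= size u)%N.
Proof.
move=> uw; rewrite /len; case: ex_minnP => m _; apply.
by apply/asboolP; exists u.
Qed.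

Lemma len_simpleM w k i j : (0 < k < n)%N -> i = k.-1 :> nat -> j = k :> nat ->
  len (simple n k * w) = (if (w i < w j)%N then (len w).+1 else (len w).-1) /\
  ((w i < w j)%N || (0 < len w)%N).
Proof.
move=> kn ik jk; have [i' [j' [ik' jk' ->]]] := simpleP kn.
have -> : i' = i by apply: val_inj; rewrite /= ik'.
have -> : j' = j by apply: val_inj; rewrite /= jk'.
have ij : j = i.+1 :> nat by lia.
rewrite !len_inversions; have [lt|le] := ltnP (w i) (w j).
  by rewrite card_inversions_tperm.
have ltw := perm_adj_ltN ij le.
have := @card_inversions_tperm _ (tperm i j * w) _ _ ij.
by rewrite !permM tpermL tpermR mulgA tperm2 mul1g => /(_ ltw) ->.
Qed.

Lemma ltn_len_simpleM w k i j :
  (0 < k < n)%N -> i = k.-1 :> nat -> j = k :> nat ->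
  (len w < len (simple n k * w))%N = (w i < w j)%N.
Proof.
move=> kn ik jk; have [-> ] := len_simpleM w kn ik jk.
by case: ifP => _ /=; lia.
Qed.

Lemma len_simple_lt w k : (0 < k < n)%N ->
  ~~ (len w < len (simple n k * w))%N -> (len (simple n k * w) < len w)%N.
Proof.
move=> kn; have [i [j [ik jk _]]] := simpleP kn.
rewrite (ltn_len_simpleM w kn ik jk) => nlt.
by have [->] := len_simpleM w kn ik jk; rewrite (negbTE nlt) /=; lia.
Qed.

Lemma len_mul_simple w k : len (w * simple n k) = len (simple n k * w^-1).
Proof. by rewrite -lenV invMg simpleV. Qed.

Lemma len_simple k : (0 < k < n)%N -> len (simple n k) = 1%N.
Proof.
move=> kn; have [i [j [ik jk _]]] := simpleP kn.
have [] := len_simpleM 1%g kn ik jk; rewrite mulg1 !perm1 ik jk len1.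
by rewrite orbF => -> ->.
Qed.

(* Left multiplication by s_k and right multiplication by s_l interact only
   when they agree. *)
Lemma left_ascent_mul x k l : (0 < k < n)%N -> (0 < l < n)%N ->
  (simple n k * x)%g != (x * simple n l)%g ->
  (len (x * simple n l) < len (simple n k * (x * simple n l)))%N
  = (len x < len (simple n k * x))%N.
Proof.
move=> kn ln; have [i [j [ik jk sk]]] := simpleP kn.
have [i' [j' [ik' jk' sl]]] := simpleP ln.
have ij' : j' = i'.+1 :> nat by lia.
rewrite !(ltn_len_simpleM _ kn ik jk) sk sl => neq; rewrite !permM.
have nij : i != j by rewrite -val_eqE /=; lia.
have neq1 : (x i, x j) != (i', j').
  apply: contraNneq neq => -[<- <-].
  by rewrite -tpermJ conjgE !mulgA mulgV mul1g.
have neq2 : (x j, x i) != (i', j').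
  apply: contraNneq neq => -[<- <-].
  by rewrite tpermC -tpermJ conjgE !mulgA mulgV mul1g.
have [lt|] := ltnP (x i) (x j); first by rewrite tperm_adj_lt.
rewrite leq_eqVlt => /orP[/eqP/val_inj/perm_inj ji|lt].
  by rewrite ji eqxx in nij.
by apply/negbTE; rewrite -leqNgt ltnW // tperm_adj_lt.
Qed.

Lemma right_ascent_mul x k l : (0 < k < n)%N -> (0 < l < n)%N ->
  (simple n k * x)%g != (x * simple n l)%g ->
  (len (simple n k * x) < len (simple n k * x * simple n l))%N
  = (len x < len (x * simple n l))%N.
Proof.
move=> kn ln neq; rewrite !len_mul_simple -(lenV x) -(lenV (_ * x)) invMg simpleV.
apply: left_ascent_mul => //.
by rewrite -[X in X != _]invgK -[X in _ != X]invgK inj_eq ?invMg ?invgK ?simpleV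
  1?eq_sym //; exact: invg_inj.
Qed.

End LengthTheory.

(* The free R-module with basis (T_x), an element being given by its
   coordinates. *)
Definition hecke (R : comNzRingType) (q : R) (n : nat) : Type :=
  {ffun 'S_n -> R^o}.

HB.instance Definition _ (R : comNzRingType) (q : R) n :=
  GRing.Lmodule.copy (hecke q n) {ffun 'S_n -> R^o}.

Section HeckeAlgebra.
Variables (R : comNzRingType) (q : R) (n : nat).
Local Notation H := (hecke q n).
Local Notation s := (simple n).
Implicit Types (x y : 'S_n) (h a b c : H) (k l : nat) (u : seq nat).

Definition coefT h x : R := (h : {ffun 'S_n -> R^o}) x.
Definition T x : H := [ffun y => (y == x)%:R].

(* The linear map sending T_x to f x. *)
Definition linext (f : 'S_n -> H) h : H := \sum_x coefT h x *: f x.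

Definition actl k : H -> H := linext (fun x =>
  if (len x < len (s k * x))%N then T (s k * x)
  else (q - 1) *: T x + q *: T (s k * x)).
Definition actr k : H -> H := linext (fun x =>
  if (len x < len (x * s k))%N then T (x * s k)
  else (q - 1) *: T x + q *: T (x * s k)).

(* T_x h is computed by letting the letters of a reduced word of x act on h. *)
Definition rword x : seq nat := sval (cid (reduced_word_exists x)).
Definition hecke_mul a b : H :=
  \sum_x coefT a x *: foldr actl b (rword x).
Definition hecke_one : H := T 1%g.

Lemma coefT_T x y : coefT (T x) y = (y == x)%:R.
Proof. by rewrite /coefT ffunE. Qed.

Lemma coefTD a b x : coefT (a + b) x = coefT a x + coefT b x.
Proof. by rewrite /coefT ffunE. Qed.

Lemma coefTZ r a x : coefT (r *: a) x = r * coefT a x.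
Proof. by rewrite /coefT ffunE. Qed.

Lemma coefT_sum h : \sum_x coefT h x *: T x = h.
Proof.
apply/ffunP=> y; rewrite sum_ffunE (bigD1 y) //= big1 => [|x xy].
  by rewrite !ffunE eqxx addr0 [_ *: _]mulr1.
by rewrite !ffunE eq_sym (negbTE xy) [_ *: _]mulr0.
Qed.

Lemma linext_T f x : linext f (T x) = f x.
Proof.
rewrite /linext (bigD1 x) //= big1 => [|y yx].
  by rewrite coefT_T eqxx scale1r addr0.
by rewrite coefT_T (negbTE yx) scale0r.
Qed.

Fact linext_is_linear f : linear (linext f).
Proof.
move=> r a b; rewrite /linext scaler_sumr -big_split; apply: eq_bigr => x _ /=.
by rewrite coefTD coefTZ scalerDl scalerA.
Qed.
HB.instance Definition _ f :=
  GRing.isLinear.Build R H H _ (linext f) (linext_is_linear f).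
HB.instance Definition _ k := GRing.Linear.on (actl k).
HB.instance Definition _ k := GRing.Linear.on (actr k).

Lemma actlT k x : actl k (T x) =
  if (len x < len (s k * x))%N then T (s k * x)
  else (q - 1) *: T x + q *: T (s k * x).
Proof. exact: linext_T. Qed.

Lemma actrT k x : actr k (T x) =
  if (len x < len (x * s k))%N then T (x * s k)
  else (q - 1) *: T x + q *: T (x * s k).
Proof. exact: linext_T. Qed.

Lemma linear_eqT (f g : {linear H -> H}) : (forall x, f (T x) = g (T x)) -> f =1 g.
Proof.
move=> fg h; rewrite -(coefT_sum h) !linear_sum; apply: eq_bigr => x _.
by rewrite !linearZ_LR /= fg.
Qed.

Lemma actl_lin k r r' a b :
  actl k (r *: a + r' *: b) = r *: actl k a + r' *: actl k b.
Proof. by rewrite linearP linearZ. Qed.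

Lemma actr_lin k r r' a b :
  actr k (r *: a + r' *: b) = r *: actr k a + r' *: actr k b.
Proof. by rewrite linearP linearZ. Qed.

Lemma actlr_comm k l : (0 < k < n)%N -> (0 < l < n)%N ->
  forall h, actl k (actr l h) = actr l (actl k h).
Proof.
move=> kn ln; apply: (@linear_eqT (actl k \o actr l) (actr l \o actl k)) => x /=.
rewrite actlT actrT.
have [eq|neq] := eqVneq (s k * x)%g (x * s l)%g.
  have sxs : (s k * (x * s l) = x)%g by rewrite -eq mulgA simpleK mul1g.
  have xss : (x * s l * s l = x)%g by rewrite -mulgA simpleK mulg1.
  rewrite eq; case: ifP => lt; first by rewrite actlT actrT sxs xss.
  by rewrite actl_lin actr_lin !actlT !actrT eq sxs xss lt.
have lasc := left_ascent_mul kn ln neq; have rasc := right_ascent_mul kn ln neq.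
case: ifP => lt; case: ifP => lt'; rewrite ?actl_lin ?actr_lin !actlT ?actrT;
  rewrite ?actrT ?lasc ?rasc ?lt ?lt' ?mulgA //.
by rewrite !scalerDr !scalerA [RHS]addrACA (mulrC q).
Qed.

Lemma rwordP x : is_reduced_word x (rword x).
Proof. by rewrite /rword; case: cid. Qed.

Lemma len_le_simpleM x k : (0 < k < n)%N -> (len x <= (len (s k * x)).+1)%N.
Proof.
move=> kn; have [vw vs vP] := rwordP (s k * x)%g.
have -> : x = wprod n (k :: rword (s k * x)%g).
  by rewrite wprod_cons vP mulgA simpleK mul1g.
by apply: leq_trans (len_wprod _) _; rewrite /= ?kn // wprod_cons vP vs
  !mulgA simpleK mul1g.
Qed.

Lemma reduced_word_behead x k u : is_reduced_word x (k :: u) ->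
  [/\ (0 < k < n)%N, is_reduced_word (s k * x)%g u
    & (len (s k * x) < len x)%N].
Proof.
move=> [/= /andP[kn uw] us]; rewrite wprod_cons => uP.
have xE : (s k * x)%g = wprod n u by rewrite -uP mulgA simpleK mul1g.
have le := len_wprod uw; have := len_le_simpleM x kn; rewrite xE => le'.
by split=> //; [split|]; rewrite ?xE //; lia.
Qed.

Lemma actl_word x u : is_reduced_word x u -> foldr actl (T 1%g) u = T x.
Proof.
elim: u x => [|k u IHu] x; first by case=> _ _ <-; rewrite /wprod big_nil.
move=> /reduced_word_behead[kn ured lt] /=; rewrite (IHu _ ured) actlT.
by rewrite mulgA simpleK mul1g lt.
Qed.

Lemma actr_word x u : is_reduced_word x u -> foldr actr (T 1%g) (rev u) = T x.
Proof.
move=> [uw us uP]; have {uw us uP} : is_reduced_word x^-1%g (rev u).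
  by split; [rewrite /is_word all_rev | rewrite size_rev lenV
            | rewrite wprod_rev uP].
rewrite -[x in RHS]invgK; elim: (rev u) (x^-1)%g => {u x} [|k u IHu] x.
  by case=> _ _ <-; rewrite /wprod big_nil invg1.
move=> /reduced_word_behead[kn ured lt] /=; rewrite (IHu _ ured) actrT.
by rewrite len_mul_simple invgK invMg simpleV -mulgA simpleK mulg1 mulgA
  simpleK mul1g -(lenV (x^-1 * s k)) invMg simpleV invgK lt.
Qed.

(* A linear map commuting with the right actions is determined by its value at
   T_1. *)
Lemma eq_commutant (f g : {linear H -> H}) :
  (forall k h, (0 < k < n)%N -> f (actr k h) = actr k (f h)) ->
  (forall k h, (0 < k < n)%N -> g (actr k h) = actr k (g h)) ->
  f (T 1%g) = g (T 1%g) -> f =1 g.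
Proof.
move=> fr gr fg1; apply: linear_eqT => x.
have := rwordP x; rewrite -[X in f X](actr_word (rwordP x)).
rewrite -[X in g X](actr_word (rwordP x)) => -[+ _ _].
rewrite /is_word -all_rev; elim: (rev _) => [//|k u IHu] /= /andP[kn uw].
by rewrite fr // gr // IHu.
Qed.

Lemma hecke_mulT x b : hecke_mul (T x) b = foldr actl b (rword x).
Proof. exact: (linext_T (fun y => foldr actl b (rword y))). Qed.

Fact foldr_actl_linear u : linear (fun b => foldr actl b u).
Proof. by move=> r a b; elim: u => //= k u ->; rewrite linearP. Qed.

Fact hecke_mul_linearl b : linear (hecke_mul^~ b).
Proof. exact: (linext_is_linear (fun y => foldr actl b (rword y))). Qed.
Fact hecke_mul_linearr a : linear (hecke_mul a).
Proof.
move=> r b c; rewrite /hecke_mul scaler_sumr -big_split.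
apply: eq_bigr => x _ /=; rewrite foldr_actl_linear scalerDr !scalerA.
by congr (_ *: _ + _); rewrite mulrC.
Qed.
HB.instance Definition _ a :=
  GRing.isLinear.Build R H H _ (hecke_mul a) (hecke_mul_linearr a).

Lemma hecke_mul_actr a b k : (0 < k < n)%N ->
  hecke_mul a (actr k b) = actr k (hecke_mul a b).
Proof.
move=> kn; rewrite /hecke_mul linear_sum; apply: eq_bigr => x _.
rewrite linearZ_LR /=; congr (_ *: _).
have [+ _ _] := rwordP x; rewrite /is_word.
elim: (rword x) => [//|l u IHu] /= /andP[ln /IHu ->].
exact: actlr_comm.
Qed.

Fact hecke_mulr1 : right_id hecke_one hecke_mul.
Proof.
move=> a; rewrite -[RHS]coefT_sum; apply: eq_bigr => x _.
by rewrite (actl_word (rwordP x)).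
Qed.
Fact hecke_mulA : associative hecke_mul.
Proof.
move=> a b c; apply: (@eq_commutant (hecke_mul a \o hecke_mul b)
  (hecke_mul (hecke_mul a b)) _ _ _ c) => [k h kn|k h kn|] /=.
- by rewrite !hecke_mul_actr.
- by rewrite hecke_mul_actr.
- by rewrite !hecke_mulr1.
Qed.
Fact hecke_mul1r : left_id hecke_one hecke_mul.
Proof.
apply: (@eq_commutant (hecke_mul hecke_one) idfun) => [k h kn|//|].
  exact: hecke_mul_actr.
exact: hecke_mulr1.
Qed.
Fact hecke_mulDl : left_distributive hecke_mul +%R.
Proof.
by move=> a b c; have := hecke_mul_linearl c 1 a b; rewrite /= !scale1r.
Qed.
Fact hecke_mulDr : right_distributive hecke_mul +%R.
Proof. by move=> a b c; rewrite linearD. Qed.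
Fact hecke_one_neq0 : hecke_one != 0.
Proof.
apply/eqP=> /(congr1 (coefT^~ 1%g)); rewrite coefT_T eqxx /coefT ffunE.
by apply/eqP; exact: oner_neq0.
Qed.
HB.instance Definition _ := GRing.Zmodule_isNzRing.Build (hecke q n)
  hecke_mulA hecke_mul1r hecke_mulr1 hecke_mulDl hecke_mulDr hecke_one_neq0.

Fact hecke_scalerAl r a b : r *: (a * b) = (r *: a) * b.
Proof.
rewrite [LHS]scaler_sumr; apply: eq_bigr => x _.
by rewrite scalerA coefTZ.
Qed.
HB.instance Definition _ :=
  GRing.Lmodule_isLalgebra.Build R (hecke q n) hecke_scalerAl.

Fact hecke_scalerAr r a b : r *: (a * b) = a * (r *: b).
Proof. by rewrite [RHS](linearZ_LR (hecke_mul a)). Qed.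
HB.instance Definition _ :=
  GRing.Lalgebra_isAlgebra.Build R (hecke q n) hecke_scalerAr.

Definition hecke_unit : pred H :=
  fun a => `[< exists b, b * a = 1 /\ a * b = 1 >].
Definition hecke_inv a : H :=
  if pselect (exists b, b * a = 1 /\ a * b = 1) is left ab then sval (cid ab)
  else a.

Fact hecke_mulVr : {in hecke_unit, left_inverse 1 hecke_inv *%R}.
Proof.
move=> a /asboolP ua; rewrite /hecke_inv; case: pselect => // ab.
by case: cid => b [].
Qed.
Fact hecke_mulrV : {in hecke_unit, right_inverse 1 hecke_inv *%R}.
Proof.
move=> a /asboolP ua; rewrite /hecke_inv; case: pselect => // ab.
by case: cid => b [].
Qed.
Fact hecke_unitP a b : b * a = 1 /\ a * b = 1 -> hecke_unit a.
Proof. by move=> ab; apply/asboolP; exists b. Qed.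
Fact hecke_inv_out : {in [predC hecke_unit], hecke_inv =1 id}.
Proof.
move=> a; rewrite inE unfold_in => /asboolPn ua.
by rewrite /hecke_inv; case: pselect.
Qed.
HB.instance Definition _ := GRing.NzRing_hasMulInverse.Build (hecke q n)
  hecke_mulVr hecke_mulrV hecke_unitP hecke_inv_out.

Lemma T1 : T 1%g = 1.
Proof. by []. Qed.

Lemma mul_simple_T k x : (0 < k < n)%N ->
  T (s k) * T x = if (len x < len (s k * x))%N then T (s k * x)%g
                  else (q - 1) *: T x + q *: T (s k * x)%g.
Proof.
move=> kn; rewrite -actlT.
apply: (@eq_commutant (hecke_mul (T (s k))) (actl k)) => [l h ln|l h ln|].
- exact: hecke_mul_actr.
- exact: actlr_comm.
- by rewrite [LHS]hecke_mulr1 [RHS]actlT mulg1 len1 len_simple.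
Qed.

Lemma T_reduced_behead x k u : is_reduced_word x (k :: u) ->
  T x = T (s k) * T (s k * x)%g.
Proof.
move=> /reduced_word_behead[kn _ lt].
by rewrite mul_simple_T // mulgA simpleK mul1g lt.
Qed.

Lemma T_unit r x : r * q = 1 -> (T x : H) \is a GRing.unit.
Proof.
move=> rq; have Ts k : (0 < k < n)%N -> (T (s k) : H) \is a GRing.unit.
  move=> kn; apply/unitrP; exists (r *: (T (s k) - (q - 1)%:A)).
  have sq : T (s k) * T (s k) = (q - 1) *: T (s k) + q *: 1.
    by rewrite mul_simple_T // simpleK len1 len_simple.
  rewrite -scalerAl -scalerAr mulrBl mulrBr sq -!scalerAl -!scalerAr mul1r mulr1.
  by rewrite addrAC subrr add0r scalerA rq scale1r.
move: (rwordP x); move: (rword x) => v; elim: v x => [|k u IHu] y yu.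
  by case: yu => _ _ <-; rewrite /wprod big_nil T1 unitr1.
rewrite (T_reduced_behead yu); have [kn /IHu yku _] := reduced_word_behead yu.
by rewrite unitrMr ?Ts.
Qed.

End HeckeAlgebra.

(* The reflections of S_n are the transpositions. *)
Definition bruhat_step n : rel 'S_n := fun x y =>
  (len x < len y)%N && [exists i, exists j, y == (x * tperm i j)%g].
Definition bruhat_le n : rel 'S_n := connect (@bruhat_step n).

(* Semilinear extension of T_x |-> (T_{x^-1})^-1; the elements T_x are units
   by T_unit. *)
Definition hecke_bar n (h : hecke q n) : hecke q n :=
  \sum_x bar (coefT h x) *: (T q x^-1%g)^-1.

(* As size p = deg p + 1, the bound on size (P x) reads
   deg P_x <= (l(w) - l(x) - 1) / 2, and allows P_x = 0. *)
Definition is_KL_element n (w : 'S_n) (C : hecke q n) : Prop :=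
  exists P : 'S_n -> {poly int},
    [/\ C = qh ^- len w *: \sum_(x | bruhat_le x w) eval_at q (P x) *: T q x,
        P w = 1,
        forall x, bruhat_le x w -> x != w ->
          ((size (P x)).*2 <= (len w - len x).+1)%N
      & hecke_bar C = C].

(* C'_w, the unique element satisfying is_KL_element. *)
Definition KL_basis n (w : 'S_n) : hecke q n :=
  xget 0 [set C | is_KL_element w C]%classic.

(* B'_x in the literature. *)
Definition B_basis n (x : 'S_n) : hecke q n :=
  qh ^- len x *: \sum_(y | bruhat_le y x) T q y.

Definition right_ascent n (w : 'S_n) (k : nat) : bool :=
  (0 < k < n)%N && (len w < len (w * simple n k))%N.

Definition cograssmannian n (w : 'S_n) : Prop :=
  forall k l, right_ascent w k -> right_ascent w l -> k = l.

(* W_J for J the set of all generators except s_z. *)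
Definition parabolic n z : {group 'S_n} :=
  <<[set x | [exists k : 'I_n, [&& (0 < k)%N, k != z :> nat & x == simple n k]]]>>%G.

Definition min_coset_rep n z (w v : 'S_n) : Prop :=
  v \in (w *: parabolic n z)%g /\
  forall y, y \in (w *: parabolic n z)%g -> (len v <= len y)%N.

(* (s_1 ... s_{z-1})(s_1 ... s_{z-2}) ... (s_1), followed by
   (s_{n-1} ... s_{z+1})(s_{n-1} ... s_{z+2}) ... (s_{n-1}). *)
Definition w0J_word n z : seq nat :=
  flatten [seq iota 1 m | m <- rev (iota 1 z.-1)] ++
  flatten [seq rev (iota m (n - m)) | m <- iota z.+1 (n.-1 - z)].

Section Heap.
(* u is a reduced word of v. *)
Variables (n z : nat) (u : seq nat).
Local Notation s := (simple n).

Definition full_word : seq nat := u ++ w0J_word n z.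
Local Notation pos := 'I_(size full_word).

Definition letter (i : pos) : nat := nth 0%N full_word i.

(* heap_step i j and heap_lt i j mean that j is above i: letters further to the
   left in the word are higher. *)
Definition heap_step : rel pos := fun i j =>
  (j < i)%N && (s (letter i) * s (letter j) != s (letter j) * s (letter i))%g.
Definition heap_lt : rel pos := fun i j =>
  [exists k, heap_step i k && connect heap_step k j].
Definition heap_le : rel pos := fun i j => (i == j) || heap_lt i j.

Definition in_v (i : pos) : bool := (i < size u)%N.

Definition top_v_entry (k : nat) (i : pos) : bool :=
  [&& in_v i, letter i == k
    & [forall j, in_v j && (letter j == k) ==> heap_le j i]].

(* The symbol recorded between columns k and k + 1, if both meet v. *)
Definition lparen (k : nat) : bool :=
  [exists i, exists j,
    [&& top_v_entry k i, top_v_entry k.+1 j & heap_lt j i]].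
Definition rparen (k : nat) : bool :=
  [exists i, exists j,
    [&& top_v_entry k i, top_v_entry k.+1 j & ~~ heap_lt j i]].

(* Both bounds are included. *)
Definition count_in (p : pred nat) (a b : nat) : nat :=
  count p (iota a (b.+1 - a)).

(* The symbols a and b form a matched pair: "(" at a, ")" at b, and every
   proper prefix of the string read from a to b has an excess of "(". *)
Definition matched (a b : nat) : bool :=
  [&& (a < b)%N, lparen a, rparen b,
      count_in lparen a b == count_in rparen a b
    & all (fun c => count_in rparen a c < count_in lparen a c)%N
          (iota a (b - a))].

(* The non-root vertices of the tree T(w).  Each of them also stands for the
   edge that joins it to its parent (possibly the root). *)
Definition vertex : Type := {p : 'I_n * 'I_n | matched p.1 p.2}.
HB.instance Definition _ := Finite.on vertex.

Definition opening (p : vertex) : nat := (val p).1.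
Definition closing (p : vertex) : nat := (val p).2.

Definition descendant (p r : vertex) : bool :=
  (opening r < opening p)%N && (closing p < closing r)%N.

Definition is_valley (p : vertex) : bool := closing p == (opening p).+1.
Definition valley_column (p : vertex) : nat := closing p.
Definition capacity (p : vertex) : nat := count_mem (valley_column p) u.

(* A_w: monotonicity along all root-to-leaf paths is monotonicity for the
   ancestor relation between edges. *)
Definition labelings : set {ffun vertex -> nat} :=
  [set t | (forall p r, descendant p r -> (t r <= t p)%N) /\
           (forall p, is_valley p -> (t p <= capacity p)%N)]%classic.

Definition label_sum (t : {ffun vertex -> nat}) : nat := (\sum_p t p)%N.

(* i has fewer than m entries of its column above it. *)
Definition top_entry (k m : nat) (i : pos) : bool :=
  (letter i == k) && (#|[pred j | (letter j == k) && heap_lt i j]| < m)%N.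

Definition mask_at (t : {ffun vertex -> nat}) (i : pos) : bool :=
  ~~ [exists p, exists j,
       [&& is_valley p, top_entry (valley_column p) (t p) j & heap_le j i]].

(* x(t); the product runs over positions in increasing order. *)
Definition mask_perm (t : {ffun vertex -> nat}) : 'S_n :=
  (\prod_(i : pos | mask_at t i) s (letter i))%g.

End Heap.

Arguments labelings : clear implicits.

(* Main.v *)
Require Import Defs.
From mathcomp Require Import all_boot all_order all_algebra all_fingroup.
From mathcomp Require Import boolp classical_sets functions cardinality fsbigop.
From mathcomp Require Import zify ring.
Set Implicit Arguments.
Unset Strict Implicit.
Unset Printing Implicit Defensive.
Import GRing.Theory.
Local Open Scope ring_scope.

(** A coset of W_J is encoded by a word in two symbols, read as a lattice path
    or as a string of parentheses.  Since B'_x(t) is a sum over the cosets whose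
    path lies below that of x(t), the theorem says that P_{y,w} is the generating
    function of the labelings of T(w) whose leaf labels are bounded by the
    distance between the paths of w and y (the Lascoux-Schützenberger rule).
    The degree bound follows by charging each label to two columns.  For bar
    invariance, identify the left ideal generated by the sum over W_J with
    functions on words; [2]_q - C'_s acts there as cup o cap, for
    Temperley-Lieb maps between words of length n and n - 2.  Splitting the
    labelings according to whether the label of a valley is maximal shows that
    a cap sends the candidate for a word to the candidate for the word with that
    valley deleted, or to 0 if there is no valley there.  A vector is determined
    by its caps and its coordinates at the maximal words, so the bar involution
    is characterised by recursion on n, and it fixes the candidates. *)

(** * Parenthesis words *)

(** A cap shortens words by two, so it does not act on a fixed Hecke algebra; only [cup] after [cap]
    does, as [TLop]. Conjugation is therefore set up as a relation between vectors, [compat],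
    meaningful for every length, and [compat_inj] shows that it determines the conjugate. The Hecke
    algebra enters at length [n] only: every basis vector arises from that of the base word through
    [TLop], which commutes with the bar involution, so that all rests on the bar invariance of the
    scaled sum over W_J. Lengths and the Bruhat order are read off the paths: going up in the order
    lowers the path, and on longest coset representatives the sum of the length and of [noninv] is
    constant. Existence of the Kazhdan-Lusztig element comes from the candidate itself, uniqueness
    from a degree argument. *)

(* In a word, [true] is an opening and [false] a closing parenthesis; column [c]
   lies between the symbols [c - 1] and [c]. *)
Definition opens (s : seq bool) (c : nat) : nat := count id (take c s).

Lemma opens0 s : opens s 0 = 0%N.
Proof. by rewrite /opens take0. Qed.

Lemma opensS s c : opens s c.+1 = (opens s c + nth false s c)%N.
Proof.
rewrite /opens; have [lt|le] := ltnP c (size s).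
  by rewrite (take_nth false lt) -cats1 count_cat /= addn0.
by rewrite !take_oversize ?(leq_trans le) // nth_default // addn0.
Qed.

Lemma opens_size s c : (size s <= c)%N -> opens s c = count id s.
Proof. by move=> le; rewrite /opens take_oversize. Qed.

Lemma opens_cat l r c : opens (l ++ r) c = (opens l c + opens r (c - size l))%N.
Proof.
rewrite /opens take_cat; case: ltnP => le; last first.
  by rewrite count_cat (take_oversize le).
by rewrite (_ : c - size l = 0)%N ?take0 ?addn0 //; lia.
Qed.

Lemma opens_cons x s c : opens (x :: s) c.+1 = (x + opens s c)%N.
Proof. by []. Qed.

Lemma opens_insert l (x y : bool) r c :
  opens (l ++ x :: y :: r) c =
  if (c <= size l)%N then opens (l ++ r) c
  else if c == (size l).+1 then (opens (l ++ r) (size l) + x)%N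
  else (opens (l ++ r) (c - 2) + x + y)%N.
Proof.
rewrite !opens_cat subnn opens0 addn0.
case: leqP => [le|lt].
  by rewrite (_ : c - size l = 0)%N ?opens0 //; lia.
have Hl i : (size l <= i)%N -> opens l i = opens l (size l).
  by move=> le; rewrite !opens_size.
case: eqP => [->|ne].
  by rewrite Hl // subSnn opens_cons opens0 addn0.
have -> : (c - size l = (c - 2 - size l).+2)%N by lia.
by rewrite !opens_cons (Hl c) 1?ltnW // (Hl (c - 2)%N); lia.
Qed.

Lemma opens_le s c : (opens s c <= c)%N.
Proof. by elim: c => [|c IH]; rewrite ?opens0 ?opensS //; case: nth; lia. Qed.

Lemma eq_opens s m : size s = size m -> opens s =1 opens m -> s = m.
Proof.
move=> sz e; apply: (eq_from_nth (x0 := false) sz) => i _.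
by have := e i.+1; rewrite !opensS e => /addnI; do 2!case: nth.
Qed.

(* The first column where [m] falls below [s] follows a "(" of [s], and [m] stays
   below until the next ")" of [s]. *)
Lemma opens_crossing s m c : size m = size s -> count id m = count id s ->
  (opens m c < opens s c)%N ->
  exists j, [/\ nth false s j, ~~ nth false s j.+1, (j.+1 < size s)%N
              & (opens m j.+1 < opens s j.+1)%N].
Proof.
move=> sz cnt lt0.
have exc : exists c, (opens m c < opens s c)%N by exists c.
case: (ex_minnP exc) => {c lt0 exc} -[|c]; first by rewrite !opens0.
move=> lt cmin; have sc : nth false s c.
  have := cmin c; move: lt; rewrite ltnn !opensS.
  by case: (nth false s c) => //; case: ltnP => //; case: nth; lia.
(* Beyond the end [nth false] reads as a closing symbol, so such an [i] always exists; equality of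
   the contents later places it inside the word. *)
have exi : exists i, (c < i)%N && ~~ nth false s i.
  by exists (maxn c.+1 (size s)); rewrite nth_default; lia.
case: (ex_minnP exi) => i /andP[ci si] imin.
have below k : (c.+1 <= k <= i)%N -> (opens m k < opens s k)%N.
  elim: k => // k IH /andP[ck ki].
  have [<-|ne] := eqVneq c k; first exact: lt.
  have := IH; have := imin k; rewrite !opensS.
  case: (nth false s k); first by case: (nth false m k); lia.
  by lia.
have := below i; rewrite ci leqnn => /(_ isT) lti.
have isz : (i < size s)%N.
  by rewrite ltnNge; apply/negP => le; move: lti; rewrite !opens_size -?sz ?cnt //; lia.
case: i ci si imin below lti isz => // i ci si imin below lti isz.
exists i; split=> //; have [<-//|ne] := eqVneq c i.
by have := imin i; case: nth => //; lia.
Qed.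

(* [matching s a b]: the parenthesis opened at [a] is closed at [b].  The
   condition compares the heights [2 * opens s c - c]. *)
Definition matching (s : seq bool) (a b : nat) : Prop :=
  [/\ (a < b)%N, (b < size s)%N,
      (2 * opens s b.+1 + a = 2 * opens s a + b.+1)%N
    & forall c, (a < c <= b)%N -> (2 * opens s a + c < 2 * opens s c + a)%N].

Lemma matching_open s a b : matching s a b -> nth false s a.
Proof.
move=> [ab _ _ /(_ a.+1)]; rewrite ltnSn ab opensS => /(_ isT).
by case: nth => //; lia.
Qed.

Lemma matching_close s a b : matching s a b -> ~~ nth false s b.
Proof.
move=> [ab _ + /(_ b)]; rewrite leqnn ab opensS => + /(_ isT).
by case: nth => //; lia.
Qed.

Lemma matching_inj s a b b' : matching s a b -> matching s a b' -> b = b'.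
Proof.
move=> [ab _ e h] [ab' _ e' h'].
have [lt|lt|//] := ltngtP b b'.
  by have := h' b.+1; lia.
by have := h b'.+1; lia.
Qed.

Lemma matching_inj_close s a a' b : matching s a b -> matching s a' b -> a = a'.
Proof.
move=> [ab _ e h] [ab' _ e' h'].
have [lt|lt|//] := ltngtP a a'.
  by have := h a'; lia.
by have := h' a; lia.
Qed.

(** Renumbers positions after two symbols have been inserted at position [j]. *)
Definition shift2 (j a : nat) : nat := if (a < j)%N then a else a.+2.

Section MatchingInsert.
Variables (l r : seq bool).
Let w := l ++ true :: false :: r.
Let j := size l.

Let opens_left c : (c <= j)%N -> opens w c = opens (l ++ r) c.
Proof. by rewrite opens_insert => ->. Qed.

Let opens_mid : opens w j.+1 = (opens (l ++ r) j).+1.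
Proof. by rewrite opens_insert ltnn eqxx addn1. Qed.

Let opens_right c : (j <= c)%N -> opens w c.+2 = (opens (l ++ r) c).+1.
Proof.
move=> jc; rewrite opens_insert ifN ?ifN ?subn2 /=; try by rewrite -/j; lia.
Qed.

Let height_shift a :
  (2 * opens w (shift2 j a) + a = 2 * opens (l ++ r) a + shift2 j a)%N.
Proof.
rewrite /shift2; case: ltnP => ja; first by rewrite opens_left // ltnW.
by rewrite opens_right //; lia.
Qed.

Let height_shiftS a :
  (2 * opens w (shift2 j a).+1 + a = 2 * opens (l ++ r) a.+1 + shift2 j a)%N.
Proof.
rewrite /shift2; case: ltnP => ja; first by rewrite opens_left.
by rewrite opens_right; lia.
Qed.

Let shift_lt a b : (shift2 j a < shift2 j b)%N = (a < b)%N.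
Proof. by rewrite /shift2; case: (ltnP a j); case: (ltnP b j); lia. Qed.

Let size_shift b : (shift2 j b < size w)%N = (b < size (l ++ r))%N.
Proof. by rewrite /shift2 !size_cat /= -/j; case: (ltnP b j); lia. Qed.

(** The inserted pair only adds a peak at column [j+1], between two columns that have the old height
    of [j], so no condition on heights is gained or lost. *)
Lemma matching_shift a b :
  matching w (shift2 j a) (shift2 j b) <-> matching (l ++ r) a b.
Proof.
have hb := height_shiftS b; have ha := height_shift a.
split=> -[ab bs e h]; split; rewrite ?size_shift ?shift_lt // in ab bs *; try lia.
  (* [c] is a column, not a position: column [j] lies before the inserted pair and keeps its number,
     hence [<=] here against [<] in [shift2]. *)
  move=> c acb; have := h (if c <= j then c else c.+2)%N.
  rewrite /shift2 in ha *; case: (leqP c j) => cj.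
    rewrite (opens_left cj); move: ha.
    by case: (ltnP a j); case: (ltnP b j); lia.
  rewrite (opens_right (ltnW cj)); move: ha.
  by case: (ltnP a j); case: (ltnP b j); lia.
move=> c; have := h c; have := h j; have := h c.-2; move: ha; rewrite /shift2.
case: (leqP c j) => cj.
  rewrite (opens_left cj).
  by case: (ltnP a j); case: (ltnP b j); lia.
have [->|nc] := eqVneq c j.+1.
  by rewrite opens_mid; case: (ltnP a j); case: (ltnP b j); lia.
case: c cj nc => [|[|c]] cj nc; try lia.
have jc : (j <= c)%N by lia.
rewrite (opens_right jc) /=.
have [<-|njc] := eqVneq j c; by case: (ltnP a j); case: (ltnP b j); lia.
Qed.

Lemma matching_new : matching w j j.+1.
Proof.
have oj := opens_right (leqnn j); have oj' := opens_left (leqnn j).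
split=> //; [by rewrite size_cat /=; lia|by lia|move=> c cj].
by have -> : c = j.+1 by [lia]; rewrite opens_mid; lia.
Qed.

Lemma matching_delete a b : matching w a b ->
  a = j /\ b = j.+1 \/
  exists a' b', [/\ matching (l ++ r) a' b', a = shift2 j a' & b = shift2 j b'].
Proof.
move=> mab; have [aE|na] := eqVneq a j.
  by left; split=> //; rewrite aE in mab; exact: matching_inj mab matching_new.
have [bE|nb] := eqVneq b j.+1.
  case/eqP: na; rewrite bE in mab.
  exact: matching_inj_close mab matching_new.
have na1 : a <> j.+1.
  by move=> aE; have := matching_open mab; rewrite aE nth_cat ifN ?subSnn -/j //; lia.
have nb1 : b <> j.
  by move=> bE; have := matching_close mab; rewrite bE nth_cat ltnn subnn.
right; pose un a := if (a < j)%N then a else (a - 2)%N.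
have shE x : x <> j -> x <> j.+1 -> x = shift2 j (un x).
  rewrite /shift2 /un; case: (ltnP x j) => [->//|le ne ne'].
  by rewrite ifN; lia.
have aE := shE a (elimN eqP na) na1; have bE := shE b nb1 (elimN eqP nb).
exists (un a), (un b); split=> //; apply/matching_shift.
by rewrite -aE -bE.
Qed.

End MatchingInsert.

(** * Bounded labelings and their generating function *)

(* Labelings [t] of the matched pairs of [s], indexed by the opening position,
   bounded in every enclosed column by the excess of [opens m] over [opens s]. *)
Definition bounded_labelings (m s : seq bool) : set (nat -> nat) :=
  [set t | [/\ forall a, t a != 0%N -> exists b, matching s a b,
      forall a b a' b', matching s a b -> matching s a' b' ->
        (a < a')%N -> (b' < b)%N -> (t a <= t a')%N
    & forall a b c, matching s a b -> (a < c <= b)%N ->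
        (t a + opens s c <= opens m c)%N]]%classic.

Lemma bounded_labelings_le m s t a : bounded_labelings m s t ->
  (t a <= size s)%N.
Proof.
move=> [supp _ cap]; have [-> //|/supp[b mab]] := eqVneq (t a) 0%N.
have [ab bs _ _] := mab; have := cap a b a.+1 mab; rewrite ltnSn ab => /(_ isT).
by have := opens_le m a.+1; lia.
Qed.

Lemma bounded_labelings_supp m s t a : bounded_labelings m s t ->
  (size s <= a)%N -> t a = 0%N.
Proof.
move=> [supp _ _] sa; apply/eqP; apply: contraLR sa => /supp[b [ab bs _ _]].
by rewrite -ltnNge (ltn_trans ab).
Qed.

Lemma bounded_labelings_finite m s : finite_set (bounded_labelings m s).
Proof.
pose F (g : {ffun 'I_(size s) -> 'I_(size s).+1}) (a : nat) : nat :=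
  if insub a is Some i then g i : nat else 0%N.
apply: (@sub_finite_set _ _ (F @` [set: _])%classic); last first.
  exact/finite_image/finite_finset.
move=> t At; exists [ffun i : 'I_(size s) => inord (t i)] => //.
apply/funext => a; rewrite /F; case: insubP => [i _ <-|].
  by rewrite ffunE inordK // ltnS (bounded_labelings_le _ At).
by rewrite -leqNgt => /(bounded_labelings_supp At).
Qed.

Definition label_poly (m s : seq bool) : {poly int} :=
  \sum_(t \in bounded_labelings m s) ('X^(\sum_(a < size s) t a)%N : {poly int}).

Lemma label_poly_eq0 m s : (forall t, ~ bounded_labelings m s t) ->
  label_poly m s = 0.
Proof.
by move=> h; rewrite /label_poly (_ : bounded_labelings m s = set0)%classic
  ?fsbig_set0 //; apply/seteqP; split=> t // /h.
Qed.

Lemma matching_valley s j : nth false s j -> ~~ nth false s j.+1 ->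
  (j.+1 < size s)%N -> matching s j j.+1.
Proof.
move=> sj sj' js; split=> //; first by rewrite !opensS sj (negbTE sj'); lia.
by move=> c cj; have -> : c = j.+1 by [lia]; rewrite opensS sj; lia.
Qed.

(** By [opens_crossing] the failure already occurs at a valley of [s], where the bound does not even
    admit the label 0. *)
Lemma label_poly_supp m s c : size m = size s -> count id m = count id s ->
  (opens m c < opens s c)%N -> label_poly m s = 0.
Proof.
move=> sz cnt lt; have [j [sj sj' js ltj]] := opens_crossing sz cnt lt.
apply: label_poly_eq0 => t [_ _ /(_ j j.+1 j.+1 (matching_valley sj sj' js))].
by rewrite ltnSn => /(_ isT); lia.
Qed.

Lemma label_poly_diag s : label_poly s s = 1.
Proof.
rewrite /label_poly (_ : bounded_labelings s s = [set (fun=> 0%N)])%classic.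
  by rewrite fsbig_set1 big1 // expr0.
apply/seteqP; split=> [t [supp _ cap]|t /= ->] /=; last first.
  by split=> // a b c _ _; rewrite add0n.
apply/funext => a; apply/eqP; apply: contraT => ta; have [b mab] := supp a ta.
have [ab _ _ _] := mab; have := cap a b a.+1 mab; rewrite ltnSn ab => /(_ isT).
by lia.
Qed.

Section NotValley.
Variables (lm rm s : seq bool).
Let j := size lm.

(* At a column which is not a valley of [s], the bound follows from the one at
   a neighbouring column. *)
Lemma label_poly_notvalley : ~~ (nth false s j && ~~ nth false s j.+1) ->
  label_poly (lm ++ true :: false :: rm) s =
  label_poly (lm ++ false :: true :: rm) s.
Proof.
move=> nv; rewrite /label_poly.
suff -> : bounded_labelings (lm ++ true :: false :: rm) s =
          bounded_labelings (lm ++ false :: true :: rm) s by [].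
have oE c : c != j.+1 -> opens (lm ++ true :: false :: rm) c =
    opens (lm ++ false :: true :: rm) c.
  by move=> /negPf ne; rewrite !opens_insert ne; case: ifP => // _; lia.
have oj : opens (lm ++ true :: false :: rm) j.+1 =
    (opens (lm ++ false :: true :: rm) j.+1).+1.
  by rewrite !opens_insert ltnn eqxx; lia.
have ojS : opens (lm ++ false :: true :: rm) j.+2 =
    (opens (lm ++ false :: true :: rm) j.+1).+1.
  by rewrite opensS nth_cat ifN -/j; [rewrite subSnn addn1|lia].
have ojP : opens (lm ++ false :: true :: rm) j.+1 =
    opens (lm ++ false :: true :: rm) j.
  by rewrite opensS nth_cat ltnn subnn addn0.
apply/seteqP; split=> t [supp mon cap]; split=> // a b c mab acb; last first.
  have := cap a b c mab acb; have [->|/oE->//] := eqVneq c j.+1.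
  by rewrite oj; lia.
have [cE|/oE<-] := eqVneq c j.+1; last exact: cap mab acb.
rewrite {c}cE in acb *; move: nv; rewrite negb_and negbK => /orP[sj|sj].
  (* At position [j] both [s] and the lower word close, so the bounds at columns [j] and [j+1]
     agree, and [j] is still enclosed because [a] is not [j]. *)
  have aj : a <> j by move=> aj; rewrite -aj (matching_open mab) in sj.
  have := cap a b j mab; rewrite oE; last by lia.
  by rewrite ojP (opensS s j) (negbTE sj); lia.
(* Here both words open at position [j+1], and the bound at column [j+2] is used instead. *)
have bj : b <> j.+1.
  by move=> bj; have := matching_close mab; rewrite bj sj.
have := cap a b j.+2 mab; rewrite oE; last by lia.
by rewrite ojS (opensS s j.+1) sj; lia.
Qed.

End NotValley.

Section Valley.
Variables (lm rm l r : seq bool).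
Hypothesis sizel : size lm = size l.
Let j := size l.
Let s := l ++ true :: false :: r.
Let mv := lm ++ true :: false :: rm.
Let mp := lm ++ false :: true :: rm.
Let D := (opens lm j - opens l j)%N.

(** The new leaf receives the largest label [D] that [mv] allows; its closing position [j+1] carries
    0, since labels are indexed by opening positions. *)
Definition insert_label (t : nat -> nat) (a : nat) : nat :=
  if (a < j)%N then t a else if a == j then D else if a == j.+1 then 0%N
  else t (a - 2)%N.

Lemma insert_label_shift t a : insert_label t (shift2 j a) = t a.
Proof.
rewrite /insert_label /shift2; case: (ltnP a j) => [->//|le].
by rewrite ifN ?gtn_eqF ?subn2 //=; lia.
Qed.

Let insert_label_new t : insert_label t j = D.
Proof. by rewrite /insert_label ltnn eqxx. Qed.

Let openss c : opens s c = if (c <= j)%N then opens (l ++ r) c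
  else if c == j.+1 then (opens l j).+1 else (opens (l ++ r) (c - 2)).+1.
Proof.
rewrite /s opens_insert -/j; case: ifP => // _; case: ifP => _; last by lia.
by rewrite opens_cat subnn opens0; lia.
Qed.

Let opensmv c : opens mv c = if (c <= j)%N then opens (lm ++ rm) c
  else if c == j.+1 then (opens lm j).+1 else (opens (lm ++ rm) (c - 2)).+1.
Proof.
rewrite /mv opens_insert sizel -/j; case: ifP => // _; case: ifP => _; last by lia.
by rewrite opens_cat sizel subnn opens0; lia.
Qed.

Let opensmp c : opens mp c = if (c <= j)%N then opens (lm ++ rm) c
  else if c == j.+1 then opens lm j else (opens (lm ++ rm) (c - 2)).+1.
Proof.
rewrite /mp opens_insert sizel -/j; case: ifP => // _; case: ifP => _; last by lia.
by rewrite opens_cat sizel subnn opens0; lia.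
Qed.

Let opensj : opens (l ++ r) j = opens l j.
Proof. by rewrite opens_cat subnn opens0 addn0. Qed.

Let opensmj : opens (lm ++ rm) j = opens lm j.
Proof. by rewrite opens_cat sizel subnn opens0 addn0. Qed.

Let leaf : matching s j j.+1 := matching_new l r.

Let leaf_cap m t : bounded_labelings m s t ->
  (t j + (opens l j).+1 <= opens m j.+1)%N.
Proof.
move=> [_ _ /(_ j j.+1 j.+1 leaf)]; rewrite openss ltnn eqxx ltnSn.
by apply.
Qed.

Let mv_leaf t : bounded_labelings mv s t -> (t j <= D)%N /\ (opens l j <= opens lm j)%N.
Proof. by move=> /leaf_cap; rewrite opensmv ltnn eqxx; lia. Qed.

Let mp_sub t : bounded_labelings mp s t -> bounded_labelings mv s t /\ (t j < D)%N.
Proof.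
move=> At; split; last by have := leaf_cap At; rewrite opensmp ltnn eqxx; lia.
case: At => supp mon cap; split=> // a b c mab /(cap a b c mab).
by rewrite opensmp opensmv; case: ifP => // _; case: ifP => // _; lia.
Qed.

(** The bounds of [mv] and [mp] differ only at column [j+1], by one. A pair other than the leaf that
    encloses this column encloses the leaf, and by monotonicity its label is also less than [D]. *)
Let mv_sub t : bounded_labelings mv s t -> (t j < D)%N -> bounded_labelings mp s t.
Proof.
move=> At tj; case: (At) => supp mon cap; split=> // a b c mab acb.
have [cE|ne] := eqVneq c j.+1; last first.
  by have := cap a b c mab acb; rewrite opensmp opensmv (negbTE ne).
have [] := mv_leaf At; rewrite cE opensmp openss ltnn eqxx => _ le.
have [aE|na] := eqVneq a j; first by rewrite aE; lia.
have [bE|nb] := eqVneq b j.+1.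
  by rewrite bE in mab; rewrite (matching_inj_close mab leaf) eqxx in na.
by have := mon a b j j.+1 mab leaf; lia.
Qed.

(** A pair around the new leaf encloses column [j] of the shorter word, where its label is bounded
    by [D]; this gives monotonicity, and the bounds at the new columns reduce to the one at [j]. *)
Let insert_in t : (opens l j <= opens lm j)%N ->
  bounded_labelings (lm ++ rm) (l ++ r) t -> bounded_labelings mv s (insert_label t).
Proof.
move=> leD [supp mon cap]; split.
- move=> a ta; have [->|na] := eqVneq a j; first by exists j.+1.
  have aE : a = shift2 j (if (a < j)%N then a else (a - 2)%N).
    move: ta; rewrite /insert_label /shift2.
    case: (ltnP a j) => [->//|le]; rewrite (negbTE na).
    by case: (a =P j.+1) => // ne _; rewrite ifN; lia.
  move: ta; rewrite aE insert_label_shift => /supp[b mab].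
  by exists (shift2 j b); apply/matching_shift.
- move=> a b a' b' mab mab' aa' bb'.
  have [[aE bE]|[a1 [b1 [m1 aE bE]]]] := matching_delete mab.
    by have [] := mab'; lia.
  have [[aE' bE']|[a2 [b2 [m2 aE' bE']]]] := matching_delete mab'.
    rewrite aE' aE insert_label_new insert_label_shift.
    have := cap a1 b1 j m1; rewrite opensj opensmj.
    move: aa' bb'; rewrite aE bE aE' bE' /shift2 /D -/j.
    by case: (ltnP a1 j); case: (ltnP b1 j); lia.
  rewrite aE aE' !insert_label_shift; apply: mon m1 m2 _ _.
    by move: aa'; rewrite aE aE' /shift2 -/j; case: (ltnP a1 j); case: (ltnP a2 j); lia.
  by move: bb'; rewrite bE bE' /shift2 -/j; case: (ltnP b1 j); case: (ltnP b2 j); lia.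
- move=> a b c mab acb; rewrite openss opensmv.
  have [[aE bE]|[a1 [b1 [m1 aE bE]]]] := matching_delete mab.
    have -> : c = j.+1 by move: acb; rewrite aE bE -/j; lia.
    by rewrite ltnn eqxx aE insert_label_new /D; lia.
  move: acb; rewrite aE bE insert_label_shift /shift2 -/j => acb.
  have capj := cap a1 b1 j m1; rewrite opensj opensmj in capj.
  case: (leqP c j) => cj.
    by apply: cap m1 _; move: acb; case: (ltnP a1 j); case: (ltnP b1 j); lia.
  have {}capj : (a1 < j)%N -> (j <= b1)%N -> (t a1 + opens l j <= opens lm j)%N.
    by move=> aj jb; apply: capj; rewrite aj.
  case: eqP => [cE|ne].
    suff : (a1 < j)%N && (j <= b1)%N by case/andP => /capj/[apply]; lia.
    by move: acb; case: (ltnP a1 j); case: (ltnP b1 j); lia.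
  have [cE|nc] := eqVneq c j.+2.
    suff : (a1 < j)%N && (j <= b1)%N.
      by case/andP => /capj/[apply]; rewrite cE (_ : j.+2 - 2 = j)%N ?opensj ?opensmj; lia.
    by move: acb; case: (ltnP a1 j); case: (ltnP b1 j); lia.
  rewrite !addnS ltnS; apply: cap m1 _.
  by move: acb; case: (ltnP a1 j); case: (ltnP b1 j); lia.
Qed.

Let delete_in t : bounded_labelings mv s t -> t j = D ->
  bounded_labelings (lm ++ rm) (l ++ r) (fun a => t (shift2 j a)).
Proof.
move=> At tj; case: (At) => supp mon cap; split.
- move=> a /supp[b mab].
  have [[aE bE]|[a1 [b1 [m1 aE bE]]]] := matching_delete mab.
    by move: aE; rewrite /shift2 -/j; case: ltnP; lia.
  exists b1; suff -> : a = a1 by [].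
  by move: aE; rewrite /shift2 -/j; case: (ltnP a j); case: (ltnP a1 j); lia.
- move=> a b a' b' /matching_shift mab /matching_shift mab' aa' bb'.
  apply: mon mab mab' _ _; rewrite /shift2 -/j.
    by case: (ltnP a j); case: (ltnP a' j); lia.
  by case: (ltnP b j); case: (ltnP b' j); lia.
- move=> a b c /matching_shift mab acb.
  have := cap _ _ (if c <= j then c else c.+2)%N mab.
  rewrite openss opensmv /shift2 -/j; case: (leqP c j) => cj.
    rewrite cj => h; apply: h.
    by case: (ltnP a j); case: (ltnP b j); lia.
  have c1 : (c.+2 <= j)%N = false by lia.
  have c2 : (c.+2 == j.+1) = false by lia.
  rewrite c1 c2 subn2 /=.
  by case: (ltnP a j); case: (ltnP b j); lia.
Qed.

Lemma insert_delete t : bounded_labelings mv s t -> t j = D ->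
  insert_label (fun a => t (shift2 j a)) = t.
Proof.
move=> [supp _ _] tj; apply/funext => a; rewrite /insert_label.
case: ltnP => aj; first by rewrite /shift2 aj.
case: eqP => [->//|ne]; case: eqP => [->|ne'].
  apply/eqP; rewrite eq_sym; apply: contraT => /supp[b /matching_open].
  by rewrite nth_cat ifN ?subSnn // -/j; lia.
by rewrite /shift2 ifN; [congr t|]; lia.
Qed.

Lemma insert_label_inj : injective insert_label.
Proof.
move=> t1 t2 e; apply/funext => a.
by rewrite -(insert_label_shift t1) e insert_label_shift.
Qed.

Lemma sum_insert_label t :
  (\sum_(a < size s) insert_label t a = D + \sum_(a < size (l ++ r)) t a)%N.
Proof.
rewrite -(big_mkord xpredT (insert_label t)) -(big_mkord xpredT t) !size_cat /= -/j.
rewrite (big_cat_nat (n := j)) //=; last by lia.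
rewrite (big_ltn (m := j)); last by lia.
rewrite (big_ltn (m := j.+1)); last by lia.
rewrite [in RHS](big_cat_nat (n := j)) //=; last by lia.
rewrite insert_label_new {2}/insert_label ltnNge leqnSn eqn_leq ltnn /= eqxx add0n.
have -> : (\sum_(j.+2 <= i < j + (size r).+2) insert_label t i =
           \sum_(j <= i < j + size r) t i)%N.
  have -> : (j + (size r).+2 = j + size r + 2)%N by lia.
  rewrite -[in LHS](addn2 j) big_addn addnK; apply: eq_big_nat => i /andP[ji _].
  by rewrite -[RHS]insert_label_shift /shift2 ifN ?addn2 //; lia.
rewrite addnCA; congr (_ + (_ + _))%N.
by apply: eq_big_nat => i /andP[_ ij]; rewrite /insert_label ij.
Qed.

Lemma label_poly_valley : (opens l j <= opens lm j)%N ->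
  label_poly mv s = label_poly mp s + 'X^D * label_poly (lm ++ rm) (l ++ r).
Proof.
move=> leD; rewrite /label_poly.
pose B := [set t | bounded_labelings mv s t /\ t j = D]%classic.
have -> : bounded_labelings mv s = (bounded_labelings mp s `|` B)%classic.
  apply/seteqP; split=> [t At|t [/mp_sub[]//|[]//]].
  have [tj _] := mv_leaf At; have [tE|ne] := eqVneq (t j) D; [by right|left].
  by apply: mv_sub; rewrite // ltn_neqAle ne.
rewrite fsbigU0 /=; first last.
- by move=> t [/mp_sub[_ +] [_ tj]]; rewrite tj ltnn.
- apply: sub_finite_set (bounded_labelings_finite mv s) => t [].
  by [].
- exact: bounded_labelings_finite.
congr (_ + _); rewrite mulr_fsumr.
rewrite (reindex_fsbig insert_label (bounded_labelings (lm ++ rm) (l ++ r)) B).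
  by apply: eq_fsbigr => t _; rewrite sum_insert_label exprD.
split; [|by move=> t1 t2 _ _; exact: insert_label_inj|].
  by move=> t At /=; split; [exact: insert_in|rewrite insert_label_new].
move=> t [At tj]; exists (fun a => t (shift2 j a)); first exact: delete_in.
exact: insert_delete.
Qed.

(** The case left out by [label_poly_valley]: the path of [m] is below that of [s] at the leaf, and
    everything vanishes. *)
Lemma label_poly_valley0 : (opens lm j < opens l j)%N ->
  size rm = size r -> count id (lm ++ rm) = count id (l ++ r) ->
  [/\ label_poly mv s = 0, label_poly mp s = 0
    & label_poly (lm ++ rm) (l ++ r) = 0].
Proof.
move=> lt sizer cnt; split; last first.
- apply: (@label_poly_supp _ _ j); rewrite ?opensj ?opensmj //.
  by rewrite !size_cat sizel sizer.
- by apply: label_poly_eq0 => t /mp_sub[/mv_leaf[]]; lia.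
- by apply: label_poly_eq0 => t /mv_leaf[]; lia.
Qed.

End Valley.

(** Number of pairs formed by an opening symbol and a later closing one. For fixed content it
    measures the area below the path ([sum_opens]), and on longest coset representatives it
    complements the length ([len_mul_w0J]). *)
Fixpoint noninv (s : seq bool) : nat :=
  if s is x :: s' then (x * count negb s' + noninv s')%N else 0%N.

Lemma noninv_cat l r :
  noninv (l ++ r) = (noninv l + noninv r + count id l * count negb r)%N.
Proof.
elim: l => [|x l IH] /=; first by rewrite mul0n addn0.
by rewrite IH count_cat; case: x => /=; lia.
Qed.

Lemma noninv_open_close l r : noninv (l ++ true :: false :: r) =
  (noninv (l ++ r) + count id l + count negb r).+1.
Proof. by rewrite !noninv_cat /=; lia. Qed.

Lemma noninv_close_open l r : noninv (l ++ false :: true :: r) =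
  (noninv (l ++ r) + count id l + count negb r)%N.
Proof. by rewrite !noninv_cat /=; lia. Qed.

(** An opening symbol is counted once for itself and once for each later symbol: the later closing
    symbols give [noninv], the rest a triangular number that depends only on the content. *)
Lemma sum_opens s : (\sum_(c < (size s).+1) opens s c =
  noninv s + 'C((count id s).+1, 2))%N.
Proof.
elim: s => [|x s IH]; first by rewrite big_ord_recl big_ord0 opens0.
rewrite big_ord_recl opens0 add0n.
under eq_bigr do rewrite opens_cons.
rewrite big_split /= IH sum_nat_const card_ord -(count_predC id s).
have -> : count (predC id) s = count negb s by apply: eq_count.
have binE : ('C((count id s).+2, 2) = 'C((count id s).+1, 2) + (count id s).+1)%N.
  by rewrite binS bin1.
by case: x => /=; rewrite ?add1n ?add0n ?binE; lia.
Qed.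

Lemma bounded_labelings_opens_le m s t : size m = size s ->
  count id m = count id s -> bounded_labelings m s t ->
  forall c, (opens s c <= opens m c)%N.
Proof.
move=> sz cnt [_ _ cap] c; rewrite leqNgt; apply/negP => /(opens_crossing sz cnt).
case=> j [sj sj' js ltj]; have := cap _ _ j.+1 (matching_valley sj sj' js).
by rewrite ltnSn => /(_ isT); lia.
Qed.

(* A label [t a] with [a] matched to [b] is charged to both columns [a] and
   [b]; at the last column where [m] and [s] differ nothing is charged. *)
Lemma bounded_labelings_sum m s t : size m = size s ->
  count id m = count id s -> m != s -> bounded_labelings m s t ->
  (2 * (\sum_(a < size s) t a) + noninv s < noninv m)%N.
Proof.
move=> sz cnt ms At; have les := bounded_labelings_opens_le sz cnt At.
have [supp mon cap] := At.
(* The label of the pair closed at [c], or 0: at most one term is nonzero. *)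
pose g c := (\sum_(a < size s) `[< matching s a c >] * t a)%N.
have sum_g : (\sum_(c < size s) g c = \sum_(a < size s) t a)%N.
  rewrite exchange_big; apply: eq_bigr => a _ /=; rewrite -big_distrl /=.
  have [->|/supp[b mab]] := eqVneq (t a) 0%N; first by rewrite muln0.
  have bs : (b < size s)%N by case: mab.
  rewrite (bigD1 (Ordinal bs)) //= big1 => [|c cb].
    by rewrite addn0 asboolT ?mul1n.
  rewrite asboolF // => mac; case/eqP: cb; apply: val_inj.
  exact: matching_inj mac mab.
(* A position opens or closes, so at most one of [t c] and [g c] is nonzero. If it closes, [c] is an
   enclosed column; if it opens, the bound at [c+1] passes to [c], since [s] rises there and [m]
   rises by at most 1. *)
have charge c : (t c + g c + opens s c <= opens m c)%N.
  case sc: (nth false s c).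
    have -> : g c = 0%N.
      rewrite /g big1 // => a _; rewrite asboolF // => /matching_close.
      by rewrite sc.
    have [-> |/supp[b mab]] := eqVneq (t c) 0%N; first exact: les.
    have [cb _ _ _] := mab; have := cap c b c.+1 mab.
    by rewrite ltnSn cb !opensS sc => /(_ isT); case: (nth false m c); lia.
  have -> : t c = 0%N.
    by apply/eqP; apply: contraFT sc => /supp[b /matching_open].
  have [[a mac]|noa] := pselect (exists a, matching s a c); last first.
    rewrite /g big1 ?les // => a _.
    by rewrite asboolF // => mac; apply: noa; exists (a : nat).
  have [ac cs _ _] := mac; have as_ : (a < size s)%N by apply: ltn_trans cs.
  have -> : g c = t a.
    rewrite /g (bigD1 (Ordinal as_)) //= big1 => [|a' a'a].
      by rewrite asboolT // mul1n addn0.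
    rewrite asboolF // => ma'c; case/eqP: a'a; apply: val_inj.
    exact: matching_inj_close ma'c mac.
  by apply: cap mac _; rewrite ac leqnn.
have exd : exists c, (opens s c < opens m c)%N.
  apply: contra_notP (elimN eqP ms) => /forallNP eqd; apply: eq_opens => // c.
  by apply/eqP; rewrite eqn_leq les andbT leqNgt; apply/negP/eqd.
have dlt c : (opens s c < opens m c)%N -> (c <= size s)%N.
  by rewrite leqNgt => lt; apply/negP => sc; move: lt; rewrite !opens_size ?sz ?cnt; lia.
have [k lt kmax] := ex_maxnP exd dlt.
have ks : (k < size s)%N.
  by rewrite ltn_neqAle dlt // andbT; apply/negP => /eqP ke;
     move: lt; rewrite !opens_size ?sz ?cnt ?ke //; lia.
have eqk : opens m k.+1 = opens s k.+1.
  by apply/eqP; rewrite eqn_leq les andbT leqNgt; apply/negP => /kmax; rewrite ltnn.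
have sk : nth false s k.
  by move: eqk lt; rewrite !opensS; case: (nth false s k) => //; lia.
(* As [s] opens at [k], only [t k] could be charged, and equality of the paths at [k+1] makes it 0.
   The gap left at [k] is the -1 in the degree bound. *)
have strict : (t k + g k + opens s k < opens m k)%N.
  have -> : g k = 0%N.
    rewrite /g big1 // => a _; rewrite asboolF // => /matching_close.
    by rewrite sk.
  suff -> : t k = 0%N by [].
  apply/eqP; apply: contraT => tk; have [b mab] := supp k tk.
  have [kb _ _ _] := mab; have := cap k b k.+1 mab.
  by rewrite ltnSn kb eqk => /(_ isT); lia.
have lts : (\sum_(c < size s) (t c + g c + opens s c) < \sum_(c < size s) opens m c)%N.
  rewrite (bigD1 (Ordinal ks)) //= [ltnRHS](bigD1 (Ordinal ks)) //=.
  by rewrite -addSn leq_add // leq_sum.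
have := sum_opens s; have := sum_opens m; rewrite sz cnt !big_ord_recr /=.
rewrite !opens_size ?sz // cnt; move: lts; rewrite !big_split /= sum_g.
move: (\sum_(i < size s) t i)%N (\sum_(i < size s) opens s i)%N.
by move: (\sum_(i < size s) opens m i)%N ('C(_, 2)) => A B C D; lia.
Qed.

Lemma size_label_poly m s : size m = size s -> count id m = count id s ->
  m != s -> ((size (label_poly m s)).*2 <= (noninv m - noninv s).+1)%N.
Proof.
move=> sz cnt ms; rewrite /label_poly fsbig_finite; last exact: bounded_labelings_finite.
suff le : forall B, (forall t, bounded_labelings m s t ->
    (\sum_(a < size s) t a < B)%N) ->
  (size (\sum_(t <- finmap.enum_fset (fset_set (bounded_labelings m s)))
     ('X^(\sum_(a < size s) t a)%N : {poly int}))%R <= B)%N.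
  have /le : forall t, bounded_labelings m s t ->
    (\sum_(a < size s) t a < (noninv m - noninv s).+1./2)%N.
    by move=> t /(bounded_labelings_sum sz cnt ms); lia.
  by rewrite -leq_double => h; apply: leq_trans h _; lia.
move=> B hB; rewrite big_seq.
elim/big_ind: _ => [|p r hp hr|t].
- by rewrite size_poly0.
- by apply: leq_trans (size_polyD _ _) _; rewrite geq_max hp.
- rewrite in_fset_set; last exact: bounded_labelings_finite.
  by rewrite inE size_polyXn => /hB.
Qed.

(** * Cap and cup maps *)

Section CapCup.
Implicit Types (f g : seq bool -> laurent) (w l r s : seq bool).

(* Vectors are given by their coordinates in the basis of the coset sums, that of
   the coset with word [w] being scaled by [qh ^+ noninv w]. *)
Definition cap j f w : laurent :=
  f (take j w ++ true :: false :: drop j w) -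
  qh^-1 * f (take j w ++ false :: true :: drop j w).

(** The coefficients here and in [cap] are those for which [cup] after [cap] is [TLop] in the scaled
    basis. They give the Temperley-Lieb relations with loop value [qh + qh^-1] and zigzags equal to
    -1. *)
Definition cup j f w : laurent :=
  if nth false w j && ~~ nth false w j.+1 then qh * f (take j w ++ drop j.+2 w)
  else if ~~ nth false w j && nth false w j.+1
       then - f (take j w ++ drop j.+2 w) else 0.

Lemma capE l r f : cap (size l) f (l ++ r) =
  f (l ++ true :: false :: r) - qh^-1 * f (l ++ false :: true :: r).
Proof. by rewrite /cap take_size_cat // drop_size_cat. Qed.

Lemma cupE l (x y : bool) r f : cup (size l) f (l ++ x :: y :: r) =
  if x && ~~ y then qh * f (l ++ r) else if ~~ x && y then - f (l ++ r) else 0.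
Proof.
rewrite /cup !nth_cat ltnn ltnNge leqnSn /= subnn subSnn /= take_size_cat //.
have lt : ((size l).+2 < size l)%N = false by lia.
by rewrite drop_cat lt -addn2 addKn /= drop0.
Qed.

Lemma split_at j w : (j <= size w)%N -> exists l r, w = l ++ r /\ size l = j.
Proof.
by move=> jw; exists (take j w), (drop j w); rewrite cat_take_drop size_takel.
Qed.

Lemma split_at2 j w : (j.+2 <= size w)%N ->
  exists l x y r, w = l ++ x :: y :: r /\ size l = j.
Proof.
move=> jw; have [l [r [wE lj]]] : exists l r, w = l ++ r /\ size l = j.
  by apply: split_at; lia.
by case: r wE => [|x [|y r]] wE; [move: jw; rewrite wE size_cat /=; lia..|];
  exists l, x, y, r.
Qed.

Lemma cap_cup_eq j f w : (j <= size w)%N ->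
  cap j (cup j f) w = (qh + qh^-1) * f w.
Proof.
by move=> /split_at[l [r [-> <-]]]; rewrite capE !cupE /= mulrN opprK mulrDl.
Qed.

Lemma qhVK (x : laurent) : qh^-1 * (qh * x) = x.
Proof. by rewrite mulrA mulVr ?qh_unit ?mul1r. Qed.

Lemma cap_cup_right j f w : (j < size w)%N -> cap j (cup j.+1 f) w = - f w.
Proof.
move=> jw; have [l [r [wE lj]]] := split_at (ltnW jw); rewrite -lj in jw *.
case: r wE => [|y r] wE; first by move: jw; rewrite wE cats0 ltnn.
rewrite wE capE -(cat_rcons true) -(cat_rcons false l) -{1}(size_rcons l true).
rewrite cupE -(size_rcons l false) cupE !cat_rcons.
by case: y {wE} => /=; rewrite ?qhVK ?mulr0 ?subr0 ?sub0r.
Qed.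

Lemma cap_cup_left j f w : (j < size w)%N -> cap j.+1 (cup j f) w = - f w.
Proof.
move=> jw; have [l [r [wE lj]]] := split_at (ltnW jw); rewrite -lj in jw *.
case: r wE => [|y r] wE; first by move: jw; rewrite wE cats0 ltnn.
rewrite wE -cat_rcons -(size_rcons l y) capE !cat_rcons !cupE.
by case: y {wE} => /=; rewrite ?qhVK ?mulr0 ?subr0 ?sub0r.
Qed.

Lemma cap_cup_far_right i j f w : (i + j.+2 <= size w)%N ->
  cap (i + j.+2) (cup j f) w = cup j (cap (i + j) f) w.
Proof.
move=> ijw; have [l [x [y [r [wE lj]]]]] : exists l x y r, w = l ++ x :: y :: r /\ size l = j.
  by apply: split_at2; lia.
have /split_at[m [r' [rE mi]]] : (i <= size r)%N.
  by move: ijw; rewrite wE size_cat /= lj; lia.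
rewrite wE rE -lj -mi.
have -> : (size m + (size l).+2)%N = size (l ++ x :: y :: m).
  by rewrite size_cat /=; lia.
rewrite -!cat_cons catA capE -!catA !cat_cons !cupE.
rewrite addnC -size_cat !catA capE -!catA.
by case: x y {wE} => -[] /=; ring.
Qed.

Lemma cap_cup_far_left i j f w : (i + j.+2 <= size w)%N ->
  cap i (cup (i + j.+2) f) w = cup (i + j) (cap i f) w.
Proof.
move=> ijw; have [l [v [wE li]]] : exists l r, w = l ++ r /\ size l = i.
  by apply: split_at; lia.
have /split_at2[m [x [y [r [vE mj]]]]] : (j.+2 <= size v)%N.
  by move: ijw; rewrite wE size_cat li; lia.
rewrite wE vE -li -mj capE.
have aE (a b : bool) : l ++ a :: b :: m ++ x :: y :: r =
    (l ++ a :: b :: m) ++ x :: y :: r by rewrite -catA.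
rewrite (aE true) (aE false).
have sE (a b : bool) : (size l + (size m).+2)%N = size (l ++ a :: b :: m).
  by rewrite size_cat.
rewrite (sE true false) cupE -(sE true false) (sE false true) cupE.
rewrite -size_cat catA cupE -!catA !capE -!cat_cons.
by case: x y {vE aE} => -[] /=; ring.
Qed.
End CapCup.

(** * Candidate vectors and conjugate pairs of vectors *)

Definition same_content (m s : seq bool) : bool :=
  (size m == size s) && (count id m == count id s).

Lemma same_content_noninv l r lm rm : size lm = size l ->
  same_content (lm ++ rm) (l ++ r) -> (count id l <= count id lm)%N ->
  (count negb rm = count negb r + (count id lm - count id l))%N.
Proof.
rewrite /same_content !size_cat !count_cat => sl /andP[/eqP sz /eqP cnt] le.
have cN (v : seq bool) : (count id v + count negb v = size v)%N.
  by rewrite -(count_predC id v); congr (_ + _)%N; apply: eq_count.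
by have := cN rm; have := cN r; lia.
Qed.

(** The powers of [qh] convert the coefficient shared by a coset into a coordinate in the scaled
    basis (see [coefT_phi_KL_vec]) and make the coordinate at [s] equal to 1. *)
Definition KL_vec (s m : seq bool) : laurent :=
  if same_content m s
  then qh^-1 ^+ noninv m * qh ^+ noninv s * eval_at q (label_poly m s) else 0.

(** In [label_poly_valley] the term of [mp] cancels against the second term of [cap], whose [noninv]
    is smaller by one. In the other term, passing to the shorter words changes the two exponents of
    [qh] by amounts differing by [2 * D], which absorbs [q ^+ D]. *)
Lemma cap_KL_vec l r m : size m = size (l ++ r) ->
  cap (size l) (KL_vec (l ++ true :: false :: r)) m = KL_vec (l ++ r) m.
Proof.
move=> sz; have [lm [rm [mE sl]]] : exists lm rm, m = lm ++ rm /\ size lm = size l.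
  by apply: split_at; rewrite sz size_cat leq_addr.
rewrite mE -[in LHS]sl capE /KL_vec.
have scE (x y : bool) : ~~ x = y ->
    same_content (lm ++ x :: y :: rm) (l ++ true :: false :: r) =
    same_content (lm ++ rm) (l ++ r).
  by rewrite /same_content !size_cat !count_cat => <- /=; case: x => /=; lia.
rewrite !scE //; case: ifP => sc; last by rewrite mulr0 subr0.
have olE : opens l (size l) = count id l by rewrite opens_size.
have olmE : opens lm (size l) = count id lm by rewrite opens_size ?sl.
have [lt|le] := ltnP (count id lm) (count id l).
  have [|||-> -> ->] := @label_poly_valley0 lm rm l r sl.
  - by rewrite olE olmE.
  - by move: sz; rewrite mE !size_cat; lia.
  - by case/andP: sc => _ /eqP.
  by rewrite !rmorph0 !mulr0 subr0.
rewrite (label_poly_valley _ _ sl); last by rewrite olE olmE.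
rewrite !noninv_open_close noninv_close_open (same_content_noninv sl sc le).
rewrite olE olmE; set D := (count id lm - count id l)%N.
rewrite rmorphD rmorphM rmorphXn /= eval_atX.
have -> : (noninv (lm ++ rm) + count id lm + (count negb r + D)).+1 =
  (noninv (lm ++ rm) + (count id l + count negb r + 2 * D).+1)%N.
  by rewrite /D; lia.
have -> : (noninv (lm ++ rm) + count id lm + (count negb r + D))%N =
  (noninv (lm ++ rm) + (count id l + count negb r + 2 * D))%N.
  by rewrite /D; lia.
have -> : q ^+ D = qh ^+ (2 * D) by rewrite exprM.
rewrite -[RHS]mulr1 -(qhVX (count id l + count negb r + 2 * D).+1).
rewrite ?addnA -?addnS ?exprD ?exprS; ring.
Qed.

(** The two polynomials agree by [label_poly_notvalley], and the factor [qh^-1] in [cap] makes up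
    for the difference of one in [noninv]. *)
Lemma cap_KL_vec0 s j m : ((size m).+2 = size s) -> (j <= size m)%N ->
  ~~ (nth false s j && ~~ nth false s j.+1) -> cap j (KL_vec s) m = 0.
Proof.
move=> sz /split_at[lm [rm [-> <-]]] nv; rewrite capE /KL_vec.
have -> : same_content (lm ++ true :: false :: rm) s =
    same_content (lm ++ false :: true :: rm) s.
  by rewrite /same_content !size_cat !count_cat /=; lia.
case: ifP => _; last by rewrite mulr0 subr0.
rewrite label_poly_notvalley // noninv_open_close noninv_close_open exprS.
by rewrite !mulrA subrr.
Qed.

(** The words without adjacent [()]: their coordinates are those that no cap reduces to one of
    smaller [noninv]. *)
Definition max_word p r := nseq p false ++ nseq r true.

(** A maximal word has the lowest path of its content, so the coordinate is 1 if [s] is this word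
    and 0 otherwise. *)
Lemma KL_vec_max s p r : bar (KL_vec s (max_word p r)) = KL_vec s (max_word p r).
Proof.
rewrite /KL_vec; case: ifP => [/andP[/eqP sz /eqP cnt]|_]; last by rewrite rmorph0.
have [<-|ne] := eqVneq (max_word p r) s.
  by rewrite label_poly_diag rmorph1 mulr1 qhVX rmorph1.
suff [c lt] : exists c, (opens (max_word p r) c < opens s c)%N.
  by rewrite (label_poly_supp sz cnt lt) !rmorph0 mulr0 rmorph0.
apply: contra_notP (elimN eqP ne) => /forallNP le; apply: eq_opens => // c.
apply/eqP; rewrite eqn_leq; apply/andP; split; last first.
  by rewrite leqNgt; apply/negP/le.
have -> : opens (max_word p r) c = (minn (c - p) r)%N.
  elim: c => [|c IH]; first by rewrite opens0 min0n.
  rewrite opensS IH nth_cat size_nseq !nth_nseq.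
  by case: (ltnP c p) => cp; [|case: (ltnP (c - p) r)]; lia.
have : (count id s <= opens s c + (size s - c))%N.
  rewrite -{1}(cat_take_drop c s) count_cat leq_add2l -size_drop.
  exact: count_size.
rewrite -sz -cnt !size_cat !count_cat !size_nseq !count_nseq mul0n mul1n; lia.
Qed.

(* [compat n f g] characterises [g] as the bar conjugate of [f]: a vector is
   determined by its caps and by its coordinates on the maximal words. *)
Fixpoint compat n (f g : seq bool -> laurent) : Prop :=
  (forall p r, (p + r)%N = n -> g (max_word p r) = bar (f (max_word p r))) /\
  if n is n'.+2 then
    forall j, (j <= n')%N -> compat n' (cap j f) (cap j g)
  else True.

Lemma nat_ind2 (P : nat -> Prop) :
  (forall n, (forall m, n = m.+2 -> P m) -> P n) -> forall n, P n.
Proof.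
move=> IH n; suff : P n /\ P n.+1 by case.
elim: n => [|n [Pn PSn]]; first by split; apply: IH.
by split=> //; apply: IH => m [<-].
Qed.

Lemma compatP n f g :
  (forall p r, (p + r)%N = n -> g (max_word p r) = bar (f (max_word p r))) ->
  (forall m, n = m.+2 -> forall j, (j <= m)%N -> compat m (cap j f) (cap j g)) ->
  compat n f g.
Proof. by case: n => [|[|n]] h1 h2; split=> //; apply: h2. Qed.

Lemma compat_max n f g p r : compat n f g -> (p + r)%N = n ->
  g (max_word p r) = bar (f (max_word p r)).
Proof. by case: n => [|[|n]] [h _]; apply: h. Qed.

Lemma compat_cap n f g j : compat n.+2 f g -> (j <= n)%N ->
  compat n (cap j f) (cap j g).
Proof. by case=> _; apply. Qed.

Lemma size_max_word p r : size (max_word p r) = (p + r)%N.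
Proof. by rewrite size_cat !size_nseq. Qed.

Lemma eq_cap n j f f' : (forall w, size w = n.+2 -> f w = f' w) ->
  (j <= n)%N -> forall w, size w = n -> cap j f w = cap j f' w.
Proof.
move=> e jn w wn; rewrite -wn in jn; have [l [r [wE <-]]] := split_at jn.
by rewrite wE !capE !e // -wn wE !size_cat /= !addnS.
Qed.

Lemma eq_compat n f f' g g' : (forall w, size w = n -> f w = f' w) ->
  (forall w, size w = n -> g w = g' w) -> compat n f g -> compat n f' g'.
Proof.
elim/nat_ind2: n f f' g g' => n IH f f' g g' ef eg fg; apply: compatP.
  by move=> p r prn; rewrite -eg -?ef ?size_max_word //; apply: compat_max fg prn.
move=> m nm j jm; subst n; apply: IH (compat_cap fg jm) => // w wm.
  exact: eq_cap wm.
exact: eq_cap wm.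
Qed.

Lemma compat0 n : compat n (fun=> 0) (fun=> 0).
Proof.
elim/nat_ind2: n => n IH; apply: compatP => [p r _|m nm j _]; first by rewrite rmorph0.
by apply: eq_compat (IH m nm) => w _; rewrite /cap mulr0 subr0.
Qed.

Lemma compatD n f g f' g' : compat n f g -> compat n f' g' ->
  compat n (fun w => f w + f' w) (fun w => g w + g' w).
Proof.
elim/nat_ind2: n f g f' g' => n IH f g f' g' fg fg'; apply: compatP.
  by move=> p r prn; rewrite rmorphD (compat_max fg) ?(compat_max fg').
move=> m nm j jm; subst n.
apply: eq_compat (IH m erefl _ _ _ _ (compat_cap fg jm) (compat_cap fg' jm)) => w _;
  by rewrite /cap; ring.
Qed.

Lemma compatZ n c f g : compat n f g ->
  compat n (fun w => c * f w) (fun w => bar c * g w).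
Proof.
elim/nat_ind2: n f g => n IH f g fg; apply: compatP.
  by move=> p r prn; rewrite rmorphM (compat_max fg).
move=> m nm j jm; subst n.
by apply: eq_compat (IH m erefl _ _ (compat_cap fg jm)) => w _; rewrite /cap; ring.
Qed.

Lemma bar_qhV : bar qh^-1 = qh.
Proof.
have : bar qh * bar qh^-1 = 1 by rewrite -rmorphM mulrV ?qh_unit // rmorph1.
by rewrite bar_qh => /(congr1 ( *%R qh)); rewrite mulrA mulrV ?qh_unit // mul1r mulr1.
Qed.

Lemma cup_max j f p r : (j.+2 <= p + r)%N ->
  cup j f (max_word p r) = if p == j.+1 then
    if r is r'.+1 then - f (max_word j r') else 0 else 0.
Proof.
move=> jpr; case: eqP => [pE|ne].
  subst p; case: r jpr => [|r] jpr; first by move: jpr; rewrite addn0 ltnn.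
  have -> : max_word j.+1 r.+1 = nseq j false ++ false :: true :: nseq r true.
    by rewrite /max_word -addn1 nseqD -catA.
  by rewrite -{1}(size_nseq j false) cupE.
rewrite /cup /max_word !nth_cat !size_nseq !nth_nseq.
by case: (ltnP j p) => jp; case: (ltnP j.+1 p) => jp'; try lia;
  case: (ltnP (j - p) r); case: (ltnP (j.+1 - p) r); try lia.
Qed.

(** The Temperley-Lieb relations evaluate the caps of a cup: a scalar fixed by [bar] at the same
    column, -1 at a neighbouring one, and otherwise a cup of a cap, to which the induction
    hypothesis applies. *)
Lemma compat_cup n j f g : (j <= n)%N -> compat n f g ->
  compat n.+2 (cup j f) (cup j g).
Proof.
elim/nat_ind2: n j f g => n IH j f g jn fg; apply: compatP.
  move=> p r prn; rewrite !cup_max ?prn //; case: eqP => [pE|_]; last by rewrite rmorph0.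
  case: r prn => [|r] prn; first by rewrite rmorph0.
  by rewrite rmorphN (compat_max fg) //; lia.
move=> _ [<-] i im.
have opp : compat n (fun w => - f w) (fun w => - g w).
  apply: eq_compat (compatZ (-1) fg) => w _; rewrite ?mulN1r //.
  by rewrite rmorphN rmorph1 mulN1r.
have far k : (k.+2 <= n)%N -> exists2 n', n = n'.+2 & (k <= n')%N.
  by case: (n) => [|[|n']] // kn; exists n'.
have [ij|ji|ij] := ltngtP i j.
- have [jE|nj] := eqVneq j i.+1.
    apply: eq_compat opp => w wn; rewrite jE cap_cup_right // wn; lia.
  have jE : j = (i + (j - i.+2).+2)%N by lia.
  have [|n' nE kn'] := far (i + (j - i.+2))%N; first by lia.
  subst n; apply: eq_compat (IH n' erefl _ _ _ kn' (compat_cap fg _)) => [w wn|w wn|].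
  + by rewrite jE cap_cup_far_left ?wn -?jE //; congr cup; lia.
  + by rewrite jE cap_cup_far_left ?wn -?jE //; congr cup; lia.
  + by lia.
- have [iE|ni] := eqVneq i j.+1.
    apply: eq_compat opp => w wn; rewrite iE cap_cup_left // wn; lia.
  have iE : i = (i - j.+2 + j.+2)%N by lia.
  have [|n' nE kn'] := far (i - j.+2 + j)%N; first by lia.
  subst n; have jn' : (j <= n')%N by lia.
  apply: eq_compat (IH n' erefl _ _ _ jn' (compat_cap fg kn')) => w wn.
  + by rewrite iE cap_cup_far_right ?wn -?iE.
  + by rewrite iE cap_cup_far_right ?wn -?iE.
- subst j; apply: eq_compat (compatZ (qh + qh^-1) fg) => w wn.
    by rewrite cap_cup_eq ?wn.
  by rewrite cap_cup_eq ?wn // rmorphD /= bar_qh bar_qhV addrC.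
Qed.

Lemma word_cases w : (exists p r, w = max_word p r) \/
  exists l r, w = l ++ true :: false :: r.
Proof.
elim: w => [|x w [[p [r ->]]|[l [r ->]]]]; first by left; exists 0%N, 0%N.
  case: x; last by left; exists p.+1, r.
  case: p => [|p]; first by left; exists 0%N, r.+1.
  by right; exists [::], (max_word p r).
by right; exists (x :: l), r.
Qed.

(** Induction on [noninv]: at a word containing [()], the cap there expresses the coordinate through
    that of the word with [)(] instead, whose [noninv] is smaller by one. *)
Lemma cap_inj n g g' : (forall p r, (p + r)%N = n -> g (max_word p r) = g' (max_word p r)) ->
  (forall m, n = m.+2 -> forall j, (j <= m)%N -> forall w, size w = m ->
     cap j g w = cap j g' w) ->
  forall w, size w = n -> g w = g' w.
Proof.
move=> gmax gcap w; have [k] := ubnP (noninv w).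
elim: k w => // k IH w wk wn; have [[p [r wE]]|[l [r wE]]] := word_cases w.
  by rewrite wE gmax // -wn wE size_max_word.
subst n w; have e : size (l ++ true :: false :: r) = (size (l ++ r)).+2.
  by rewrite !size_cat /= !addnS.
have := gcap _ e (size l); rewrite size_cat leq_addr => /(_ isT (l ++ r)).
rewrite size_cat => /(_ erefl); rewrite !capE (IH (l ++ false :: true :: r)).
- by move/addIr.
- by move: wk; rewrite noninv_open_close noninv_close_open.
- by rewrite !size_cat.
Qed.

Lemma compat_inj n f g g' : compat n f g -> compat n f g' ->
  forall w, size w = n -> g w = g' w.
Proof.
elim/nat_ind2: n f g g' => n IH f g g' fg fg'; apply: cap_inj.
  by move=> p r prn; rewrite (compat_max fg) // (compat_max fg').
move=> m nm j jm w wm; subst n.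
exact: IH (compat_cap fg jm) (compat_cap fg' jm) w wm.
Qed.

Lemma compat_cupcap n j f g : (j.+2 <= n)%N -> compat n f g ->
  compat n (cup j (cap j f)) (cup j (cap j g)).
Proof.
by case: n => [|[|n]] // jn fg; apply: compat_cup => //; apply: compat_cap.
Qed.

Lemma compat_KL_vec s : compat (size s) (KL_vec s) (KL_vec s).
Proof.
move: {2}(size s) (erefl (size s)) => n; elim/nat_ind2: n s => n IH s sn.
rewrite sn; apply: compatP => [p r _|m nm j jm]; first by rewrite KL_vec_max.
rewrite {}nm in sn IH; have [val|nv] := boolP (nth false s j && ~~ nth false s j.+1); last first.
  apply: eq_compat (compat0 m) => w wm; rewrite cap_KL_vec0 ?sn ?wm //.
have [|l [x [y [r [sE lj]]]]] := @split_at2 j s; first by rewrite sn.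
move: val sn; rewrite sE -lj !nth_cat ltnn ltnNge leqnSn subnn subSnn /=.
case: x y sE => [] [] // sE _; rewrite size_cat /= !addnS => -[] lrm.
have := IH m erefl (l ++ r); rewrite size_cat => /(_ lrm); rewrite lrm.
by apply: eq_compat => w wm; rewrite cap_KL_vec // wm size_cat.
Qed.

(** * Coset words and the Bruhat order *)

Section Words.
Variables (n z : nat).
Implicit Types (x y : 'S_n) (k c : nat).
Local Notation s := (simple n).

(* Left multiplication by [s k] exchanges the symbols [k - 1] and [k]. *)
Definition coset_word x : seq bool := [seq (x i < z)%N | i <- enum 'I_n].

Lemma size_coset_word x : size (coset_word x) = n.
Proof. by rewrite size_map size_enum_ord. Qed.

Lemma nth_coset_word x (i : 'I_n) : nth false (coset_word x) i = (x i < z)%N.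
Proof. by rewrite (nth_map i) ?size_enum_ord // nth_ord_enum. Qed.

Lemma coset_wordP x y :
  reflect (forall i, (x i < z)%N = (y i < z)%N) (coset_word x == coset_word y).
Proof.
apply: (iffP eqP) => [e i|e]; first by rewrite -!nth_coset_word e.
by apply: eq_map => i; rewrite e.
Qed.

Lemma count_coset_word x : count id (coset_word x) = count id (coset_word 1%g).
Proof.
have wE y : coset_word y = [seq (i < z)%N | i : 'I_n <- [seq y i | i <- enum 'I_n]].
  by rewrite -map_comp.
rewrite !wE 2!count_map; apply/seq.permP: (preim _ _); apply: uniq_perm.
- by rewrite map_inj_uniq ?enum_uniq //; exact: perm_inj.
- by rewrite map_inj_uniq ?enum_uniq //; exact: perm_inj.
move=> i; rewrite -{1}(permKV x i) -[in RHS](permKV (1%g : 'S_n) i).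
by rewrite !map_f ?mem_enum.
Qed.

Lemma same_content_coset_word x y : same_content (coset_word x) (coset_word y).
Proof.
by rewrite /same_content !size_coset_word eqxx !(count_coset_word x, count_coset_word y) eqxx.
Qed.

Lemma coset_word_simple_mul x k : (0 < k < n)%N ->
  exists l a b r, [/\ coset_word x = l ++ a :: b :: r,
    coset_word (s k * x)%g = l ++ b :: a :: r, size l = k.-1
  & forall i j : 'I_n, i = k.-1 :> nat -> j = k :> nat ->
    a = (x i < z)%N /\ b = (x j < z)%N].
Proof.
move=> kn; have [l [a [b [r [wE lk]]]]] := @split_at2 k.-1 (coset_word x)
  ltac:(rewrite size_coset_word; lia).
have [i [j [ik jk sE]]] := simpleP kn.
have kk : (k < k.-1)%N = false by lia.
have k1 : (k - k.-1 = 1)%N by lia.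
have xi : a = (x i < z)%N.
  by rewrite -nth_coset_word wE nth_cat lk ik ltnn subnn.
have xj : b = (x j < z)%N.
  have -> : b = nth false (coset_word x) k.
    by rewrite wE nth_cat lk kk k1.
  by rewrite -jk nth_coset_word.
exists l, a, b, r; split=> //; last first.
  move=> i' j' ik' jk'; rewrite xi xj.
  by have -> : i' = i by [apply: val_inj; rewrite /= ik' ik];
     have -> : j' = j by [apply: val_inj; rewrite /= jk' jk].
apply: (@eq_from_nth _ false) => [|m].
  by rewrite size_coset_word -(size_coset_word x) wE !size_cat.
rewrite size_coset_word => mn; pose p := Ordinal mn.
have := nth_coset_word x p; have := nth_coset_word (s k * x)%g p.
rewrite /= permM sE wE !nth_cat lk => ->.
have mi : (p == i) = (m == k.-1) by rewrite -val_eqE /= ik.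
have mj : (p == j) = (m == k) by rewrite -val_eqE /= jk.
case: tpermP => [pi|pj|/eqP + /eqP +].
- rewrite -xj; move: mi; rewrite pi eqxx => /esym/eqP->.
  by rewrite ltnn subnn.
- rewrite -xi; move: mj; rewrite pj eqxx => /esym/eqP->.
  by rewrite kk k1.
rewrite mi mj => mk1 mk2 <-; case: ltnP => // km.
by have -> : (m - k.-1 = (m - k.-1).-2.+2)%N by lia.
Qed.

(** Products act from left to right, so right multiplication permutes values, and for [k != z] the
    two exchanged values lie on the same side of [z]. *)
Lemma coset_word_mul_simple x k : (0 < k < n)%N -> k != z ->
  coset_word (x * s k)%g = coset_word x.
Proof.
move=> kn kz; apply/eqP/coset_wordP => i; rewrite permM.
have [i' [j' [ik jk ->]]] := simpleP kn.
by case: tpermP => [->|->|//]; rewrite ik jk; lia.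
Qed.

Lemma left_asc x k (i j : 'I_n) : (0 < k < n)%N -> i = k.-1 :> nat -> j = k :> nat ->
  (len x < len (s k * x))%N = (x i < x j)%N.
Proof. exact: ltn_len_simpleM. Qed.

Lemma right_asc x k (i j : 'I_n) : (0 < k < n)%N -> i = k.-1 :> nat -> j = k :> nat ->
  (len x < len (x * s k))%N = (x^-1%g i < x^-1%g j)%N.
Proof.
by move=> kn ik jk; rewrite len_mul_simple -lenV (ltn_len_simpleM _ kn ik jk).
Qed.

(* [x] is the longest element of its coset [x W_J]. *)
Definition coset_max x : Prop :=
  forall k, (0 < k < n)%N -> k != z -> ~~ (len x < len (x * s k))%N.

Lemma coset_max_dec x (a b : 'I_n) : coset_max x -> (a < b)%N ->
  (a < z)%N = (b < z)%N -> (x^-1%g b < x^-1%g a)%N.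
Proof.
move=> xmax; move: b; suff H m : forall b : 'I_n, b = m :> nat -> (a < b)%N ->
  (a < z)%N = (b < z)%N -> (x^-1%g b < x^-1%g a)%N by move=> b; apply: H.
elim: m => [|m IH] b bm; first by rewrite bm.
move=> ab abz; have mn : (m < n)%N by have := ltn_ord b; lia.
have kn : (0 < m.+1 < n)%N by have := ltn_ord b; lia.
have := xmax _ kn; rewrite (right_asc x kn (i := Ordinal mn) (j := b)) //.
have -> : m.+1 != z by lia.
move=> /(_ isT); rewrite -leqNgt => le.
have lt : (x^-1%g b < x^-1%g (Ordinal mn))%N.
  exact: perm_adj_ltN le.
have [aE|ne] := eqVneq a (Ordinal mn); first by rewrite aE.
apply: ltn_trans lt (IH (Ordinal mn) erefl _ _); move: ne; rewrite -val_eqE /=; lia.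
Qed.

Lemma coset_max_inj x y : coset_max x -> coset_max y ->
  coset_word x = coset_word y -> x = y.
Proof.
move=> xm ym /eqP/coset_wordP xy; apply: invg_inj; apply/permP => v.
have [k] := ubnP (v : nat); elim: k v => // k IH v vk.
(* The value [v'] of [x'] at the place where [y'] takes [v] lies in the block of [v]. A smaller [v']
   contradicts the induction hypothesis, a larger one [coset_max_dec]. *)
have half (x' y' : 'S_n) : coset_max x' -> (forall i, (x' i < z)%N = (y' i < z)%N) ->
   (forall v' : 'I_n, (v' < v)%N -> x'^-1%g v' = y'^-1%g v') ->
   (x'^-1%g v < y'^-1%g v)%N -> False.
  move=> x'm e IHv lt; pose v' := x' (y'^-1%g v).
  have v'z : (v' < z)%N = (v < z)%N by rewrite /v' e permKV.
  have v'E : x'^-1%g v' = y'^-1%g v by rewrite /v' permK.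
  have [v'v|vv'|/val_inj vE] := ltngtP v' v.
  - by have := IHv v' v'v; rewrite v'E => /perm_inj vE; rewrite vE ltnn in v'v.
  - by have := coset_max_dec x'm vv' (esym v'z); rewrite v'E ltnNge ltnW.
  - by rewrite -v'E vE ltnn in lt.
have IHv (v' : 'I_n) : (v' < v)%N -> x^-1%g v' = y^-1%g v' by move=> lt; apply: IH; lia.
have [lt|lt|/val_inj//] := ltngtP (x^-1%g v) (y^-1%g v).
  by case: (half x y).
by case: (half y x) => // v' /IHv.
Qed.

Lemma coset_max_ind (Q : 'S_n -> Prop) : (forall x, coset_max x -> Q x) ->
  (forall x k, (0 < k < n)%N -> k != z -> (len x < len (x * s k))%N ->
     Q (x * s k)%g -> Q x) -> forall x, Q x.
Proof.
move=> Qmax Qstep x.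
have lenM y : (len y <= #|{: 'I_n * 'I_n}|)%N by rewrite len_inversions max_card.
have [m] := ubnP (#|{: 'I_n * 'I_n}| - len x)%N; elim: m x => // m IH x xm.
have [/Qmax //|/existsNP[k /not_implyP[kn /not_implyP[kz /negP/negPn lt]]]] :=
  pselect (coset_max x).
by apply: (Qstep x k kn kz lt); apply: IH; have := lenM (x * s k)%g; lia.
Qed.

(** Induction on [j - i] through [tperm i j = s * tperm i1 j * s], where [s] exchanges [i] and [i1].
    The middle factor lengthens; if the [s] next to [x] shortens, then [x i1 < x i < x j] and the
    outer [s] lengthens. *)
Lemma len_tperm_mul x (i j : 'I_n) : (i < j)%N -> (x i < x j)%N ->
  (len x < len (tperm i j * x))%N.
Proof.
have [m] := ubnP (j - i)%N; elim: m x i j => // m IH x i j ijm ij xij.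
have kn : (0 < i.+1 < n)%N by have := ltn_ord j; lia.
have in' : (i.+1 < n)%N by case/andP: kn.
pose i1 := Ordinal in'.
have sE : s i.+1 = tperm i i1 by rewrite -(@simpleE _ i i1).
have lenS y : len (s i.+1 * y) = (if (y i < y i1)%N then (len y).+1 else (len y).-1)
     /\ ((y i < y i1)%N || (0 < len y)%N) by apply: len_simpleM.
have [ji1|nj] := eqVneq j i1.
  by rewrite ji1 -sE; have [->] := lenS x; rewrite -ji1 xij.
have i1j : (i1 < j)%N by move: nj; rewrite -val_eqE /=; lia.
pose y := (s i.+1 * x)%g.
have ne : i != j by rewrite -val_eqE /=; lia.
have ne1 : i != i1 by rewrite -val_eqE /=; lia.
have tE : (tperm i j * x = s i.+1 * (tperm i1 j * y))%g.
  have -> : tperm i j = (tperm i1 j ^ tperm i i1)%g.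
    by rewrite tpermJ tpermR tpermD // eq_sym.
  by rewrite conjgE tpermV /y sE !mulgA.
have yi1 : y i1 = x i by rewrite /y sE permM tpermR.
have yj : y j = x j by rewrite /y sE permM tpermD // eq_sym.
have yi : y i = x i1 by rewrite /y sE permM tpermL.
have lty : (len y < len (tperm i1 j * y))%N.
  by apply: IH => //; [rewrite /=; lia|rewrite yi1 yj].
have vi : (tperm i1 j * y)%g i = x i1 by rewrite permM tpermD // eq_sym.
have vi1 : (tperm i1 j * y)%g i1 = x j by rewrite permM tpermL yj.
rewrite tE; have [-> _] := lenS (tperm i1 j * y)%g; rewrite vi vi1.
have [yE ypos] := lenS x; rewrite -/y in yE.
have [lt|le] := ltnP (x i) (x i1).
  by rewrite lt in yE; case: ifP => _; lia.
have := perm_adj_ltN (w := x) (i := i) (j := i1) erefl le => lt.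
have nlt : (x i < x i1)%N = false by lia.
have lt' : (x i1 < x j)%N by exact: ltn_trans lt xij.
by rewrite nlt in yE ypos; rewrite lt'; lia.
Qed.

(* A Bruhat step exchanges values [i < j] whose positions are increasing. *)
Lemma bruhat_step_opens y x c : bruhat_step y x ->
  (opens (coset_word x) c <= opens (coset_word y) c)%N.
Proof.
rewrite /bruhat_step => /andP[lt /existsP[i /existsP[j /eqP xE]]].
wlog ij : i j xE / (i < j)%N.
  move=> H; have [ij|ji|/val_inj ij] := ltngtP i j; first exact: H xE ij.
    by apply: (H j i) => //; rewrite tpermC.
  by rewrite xE ij tperm1 mulg1 ltnn in lt.
have pij : (y^-1%g i < y^-1%g j)%N.
  rewrite ltnNge leq_eqVlt; apply/negP => /orP[/eqP/val_inj/perm_inj ji|ji].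
    by rewrite ji ltnn in ij.
  have := len_tperm_mul (x := x^-1%g) ij; rewrite xE invMg tpermV !permM tpermL tpermR.
  move=> /(_ ji); rewrite mulgA tperm2 mul1g -[X in (X < _)%N]lenV invMg invgK tpermV.
  by rewrite lenV -xE ltnNge ltnW.
have [ijz|ijz] := eqVneq (i < z)%N (j < z)%N.
  suff -> : coset_word x = coset_word y by [].
  by apply/eqP/coset_wordP => p; rewrite xE permM; case: tpermP => [->|->|//].
have [iz jz] : (i < z)%N /\ (j < z)%N = false by move: ijz; lia.
(* The exchange moves an opening symbol from the position of [i] to that of [j], so exactly the
   columns between them lose one. *)
suff <- : (opens (coset_word x) c + ((y^-1%g i < c) && (c <= y^-1%g j)) =
  opens (coset_word y) c)%N by rewrite leq_addr.
elim: c => [|c IH]; first by rewrite !opens0.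
rewrite !opensS -{}IH -!addnA; congr (_ + _)%N.
have [cn|nc] := ltnP c n; last first.
  by rewrite !nth_default ?size_coset_word //; have := ltn_ord (y^-1%g j); lia.
have := nth_coset_word x (Ordinal cn); have := nth_coset_word y (Ordinal cn).
rewrite /= => -> ->; rewrite xE permM.
have pE v : (y (Ordinal cn) == v) = (c == y^-1%g v :> nat).
  by rewrite -{1}(permKV y v) (inj_eq perm_inj) -val_eqE.
case: tpermP => [yi|yj|/eqP + /eqP].
- by move: (pE i); rewrite yi eqxx iz jz => /esym/eqP ci; lia.
- by move: (pE j); rewrite yj eqxx iz jz => /esym/eqP cj; lia.
- by rewrite !pE; lia.
Qed.

Lemma bruhat_opens y x c : bruhat_le y x ->
  (opens (coset_word x) c <= opens (coset_word y) c)%N.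
Proof.
move=> /connectP[p + ->]; elim: p y => //= v p IH y /andP[/(bruhat_step_opens c) yv pv].
exact: leq_trans (IH v pv) yv.
Qed.

Lemma bruhat_step_simple_mul y k : (0 < k < n)%N -> (len y < len (s k * y))%N ->
  bruhat_step y (s k * y)%g.
Proof.
move=> kn lt; rewrite /bruhat_step lt; have [i [j [_ _ sE]]] := simpleP kn.
apply/existsP; exists (y i); apply/existsP; exists (y j).
by rewrite -tpermJ -sE conjgE !mulgA mulgV mul1g.
Qed.

Lemma bruhat_step_mul_simple y k : (0 < k < n)%N -> (len y < len (y * s k))%N ->
  bruhat_step y (y * s k)%g.
Proof.
move=> kn lt; rewrite /bruhat_step lt; have [i [j [_ _ sE]]] := simpleP kn.
by apply/existsP; exists i; apply/existsP; exists j; rewrite sE.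
Qed.

(** The climb from [y] to [x] first goes up inside the coset, then turns [()] into [)(] at a column
    where the path of [y] is strictly above that of [x]. The first kind of step lengthens and keeps
    [noninv], the second lengthens and lowers [noninv] by one. *)
Lemma opens_bruhat y x : coset_max x ->
  (forall c, opens (coset_word x) c <= opens (coset_word y) c)%N ->
  bruhat_le y x /\
  (len y + noninv (coset_word y) <= len x + noninv (coset_word x))%N.
Proof.
move=> xm; have [m] := ubnP (noninv (coset_word y)); elim: m y => // m IH y.
elim/coset_max_ind: y => [y ym|y k kn kz lt IHy]; last first.
  rewrite coset_word_mul_simple // in IHy => ym yx; have [le leq] := IHy ym yx.
  split; last by lia.
  exact: connect_trans (connect1 (bruhat_step_mul_simple kn lt)) le.
move=> ltm le; have [e|ne] := eqVneq (coset_word x) (coset_word y).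
  by rewrite (coset_max_inj xm ym e); split=> //; apply: connect0.
have [c ltc] : exists c, (opens (coset_word x) c < opens (coset_word y) c)%N.
  apply: contra_notP (elimN eqP ne) => /forallNP nlt; apply: eq_opens.
    by rewrite !size_coset_word.
  by move=> c; apply/eqP; rewrite eqn_leq le leqNgt; apply/negP/nlt.
have [||j [yj yj' jn ltj]] := opens_crossing _ _ ltc.
- by rewrite !size_coset_word.
- by rewrite !(count_coset_word x, count_coset_word y).
rewrite size_coset_word in jn; have kn : (0 < j.+1 < n)%N by [].
have [l [a [b [r [wy wsy lj abE]]]]] := coset_word_simple_mul y kn.
move: yj yj'; rewrite wy !nth_cat lj /= ltnn subnn ltnNge leqnSn subSnn /= => at_ bf.
have jn' : (j < n)%N by lia.
have [aE bE] := abE (Ordinal jn') (Ordinal jn) erefl erefl.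
have lty : (len y < len (s j.+1 * y))%N.
  rewrite (left_asc y kn (i := Ordinal jn') (j := Ordinal jn)) //.
  by move: at_ bf; rewrite aE bE; lia.
move: wy wsy; rewrite at_ (negbTE bf) => wy wsy.
have [||le' leq'] := IH (s j.+1 * y)%g.
- by move: ltm; rewrite wy wsy noninv_open_close noninv_close_open; lia.
- move=> c'; rewrite wsy opens_insert lj /=; have := le c'; rewrite wy opens_insert lj /=.
  case: ifP => // _; case: eqP => [->|_]; last by lia.
  move: ltj; rewrite wy opens_insert lj /= ltnn eqxx; lia.
split; first exact: connect_trans (connect1 (bruhat_step_simple_mul kn lty)) le'.
by move: leq'; rewrite wsy noninv_open_close noninv_close_open; lia.
Qed.

End Words.

(** * The bar involution *)

Lemma q_qh : q = qh * qh.
Proof. by rewrite /q expr2. Qed.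

Lemma eval_qE p : eval_at q p = eval_at qh (p \Po 'X^2).
Proof.
elim/poly_ind: p => [|p c IH]; first by rewrite comp_poly0 !rmorph0.
have X2 : eval_at qh 'X^2 = q by rewrite rmorphXn /= eval_atX.
rewrite comp_polyD comp_polyM comp_polyX comp_polyC.
rewrite (rmorphD (eval_at q)) (rmorphM (eval_at q)) (rmorphD (eval_at qh)).
rewrite (rmorphM (eval_at qh)) /= IH X2 eval_atX; congr (_ + _).
by rewrite -[c]intz !rmorph_int.
Qed.

Lemma eval_q_inj : injective (eval_at q).
Proof.
move=> p r; rewrite !eval_qE => /eval_qh_inj /polyP e; apply/polyP => i.
by have := e (2 * i)%N; rewrite !coef_comp_poly_Xn // dvdn_mulr // mulKn.
Qed.

Lemma bar_q : bar q = q^-1.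
Proof. by rewrite /q rmorphXn /= bar_qh exprVn. Qed.

Lemma bar_eval_q p : bar (eval_at q p) = eval_at q^-1 p.
Proof.
elim/poly_ind: p => [|p c IH]; first by rewrite !rmorph0.
rewrite !(rmorphD, rmorphM) /= !eval_atX IH bar_q; congr (_ + _).
by rewrite -[c]intz !rmorph_int.
Qed.

(* All exponents of [q ^+ e * p (q^-1)] exceed [deg p] when [2 deg p < e]. *)
Lemma eval_q_bar_eq0 (p : {poly int}) e : ((size p).*2 <= e.+1)%N -> (0 < e)%N ->
  eval_at q p = q ^+ e * bar (eval_at q p) -> p = 0.
Proof.
move=> pe e0; rewrite bar_eval_q => eq.
have {}eq : eval_at q p = eval_at q (\sum_(i < size p) p`_i *: 'X^(e - i)).
  rewrite eq -{1}[p]coefK poly_def !rmorph_sum mulr_sumr; apply: eq_bigr => i _.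
  rewrite -!mul_polyC !rmorphM !rmorphXn /= !eval_atX.
  have evC (a : laurent) (c : int) : eval_at a c%:P = c%:~R.
    by rewrite -[c]intz !rmorph_int.
  rewrite !evC mulrCA; congr (_ * _).
  have ie : (i <= e)%N by have := ltn_ord i; lia.
  by rewrite -{1}(subnK ie) exprD -mulrA -exprMn mulrV ?q_unit // expr1n mulr1.
move/eval_q_inj/polyP: eq => eq; apply/polyP => k; rewrite coef0.
have [kp|] := ltnP k (size p); last by move/(nth_default 0).
rewrite eq coef_sum big1 // => i _; rewrite coefZ coefXn.
by rewrite (_ : (k == e - i)%N = false) ?mulr0 //; have := ltn_ord i; lia.
Qed.

Section Hecke.
Variable n : nat.
Implicit Types (x y : 'S_n) (h a b : hecke q n) (k : nat).
Local Notation s := (simple n).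
Local Notation T x := (T q x).

Lemma coefT_sumE (I : Type) (r : seq I) (P : pred I) (F : I -> hecke q n) x :
  coefT (\sum_(i <- r | P i) F i) x = \sum_(i <- r | P i) coefT (F i) x.
Proof.
elim/big_rec2: _ => [|i c h _ <-]; first by rewrite /coefT ffunE.
exact: coefTD.
Qed.

Lemma coefTB a b x : coefT (a - b) x = coefT a x - coefT b x.
Proof. by rewrite /coefT !ffunE. Qed.

Lemma coefT_simple_T k y x : (0 < k < n)%N ->
  coefT (T (s k) * T y) x =
  if (len x < len (s k * x))%N then (s k * x == y)%g%:R * q
  else (s k * x == y)%g%:R + (x == y)%:R * (q - 1).
Proof.
move=> kn; rewrite mul_simple_T //.
have sK v : (s k * (s k * v) = v)%g by rewrite mulgA simpleK mul1g.
have asc v : (len (s k * v) < len (s k * (s k * v)))%N = ~~ (len v < len (s k * v))%N.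
  rewrite sK; apply/idP/idP => [lt|/(len_simple_lt kn)//].
  by rewrite -leqNgt ltnW.
have ne v : (s k * v == v)%g = false.
  by apply/eqP => e; have := asc v; rewrite !e ltnn.
have [<-|yn] := eqVneq (s k * x)%g y.
  rewrite asc sK (eq_sym x) ne mul0r addr0 mul1r.
  case: (len x < _)%N => /=; last by rewrite coefT_T eqxx.
  by rewrite coefTD !coefTZ !coefT_T eqxx (eq_sym x) ne mulr0 add0r mulr1.
have sxy : (x == s k * y)%g = false.
  by apply: contra_neqF yn => /eqP->; rewrite sK.
rewrite mul0r add0r; have [<-|xy] := eqVneq x y.
  case: ifP => _; first by rewrite coefT_T eq_sym ne.
  by rewrite coefTD !coefTZ !coefT_T eqxx (eq_sym x) ne mulr0 addr0 mulr1 mul1r.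
rewrite (fun_if (fun h => coefT h x)) coefTD !coefTZ !coefT_T sxy (negbTE xy).
by rewrite !mulr0 addr0 mul0r !if_same.
Qed.

Lemma coefT_delta h x : \sum_y coefT h y * (x == y)%:R = coefT h x.
Proof.
rewrite -[in RHS](coefT_sum h) coefT_sumE; apply: eq_bigr => y _.
by rewrite coefTZ coefT_T.
Qed.

Lemma coefT_simple_mul k h x : (0 < k < n)%N ->
  coefT (T (s k) * h) x = if (len x < len (s k * x))%N then q * coefT h (s k * x)%g
    else coefT h (s k * x)%g + (q - 1) * coefT h x.
Proof.
move=> kn; rewrite -{1}(coefT_sum h) mulr_sumr coefT_sumE.
under eq_bigr do rewrite -scalerAr coefTZ coefT_simple_T //.
rewrite -(coefT_delta h x) -(coefT_delta h (s k * x)%g).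
case: ifP => _; rewrite !mulr_sumr -?big_split; apply: eq_bigr => y _ /=.
  by rewrite mulrA mulrC.
by rewrite mulrDr mulrA [RHS]addrC addrC [(q - 1) * _]mulrC.
Qed.

(* [q^(1/2) + q^(-1/2) - C'_s] for [s = s k]. *)
Definition TLop k h : hecke q n := qh^-1 *: (q *: h - T (s k) * h).

Lemma coefT_TLop k h x : (0 < k < n)%N ->
  coefT (TLop k h) x =
  if (len x < len (s k * x))%N then qh * (coefT h x - coefT h (s k * x)%g)
  else qh^-1 * (coefT h x - coefT h (s k * x)%g).
Proof.
move=> kn; rewrite coefTZ coefTB coefTZ coefT_simple_mul // q_qh.
case: ifP => _; last by congr (_ * _); ring.
by rewrite -mulrBr -mulrA qhVK.
Qed.

Lemma TLop_eq0 k h x : (0 < k < n)%N -> TLop k h = 0 ->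
  coefT h (s k * x)%g = coefT h x.
Proof.
move=> kn /(congr1 (fun h : hecke q n => coefT h x)); rewrite coefT_TLop //.
have -> : coefT (0 : hecke q n) x = 0 by rewrite /coefT ffunE.
case: ifP => _ /eqP; rewrite mulrI_eq0 ?subr_eq0; try by move/eqP.
  exact/mulrI/qh_unit.
by apply/mulrI; rewrite unitrV qh_unit.
Qed.

Lemma TLopB k a b : TLop k (a - b) = TLop k a - TLop k b.
Proof.
rewrite /TLop -[RHS](scalerBr qh^-1); congr (_ *: _).
rewrite mulrBr (scalerBr q) !opprB addrACA [RHS]addrACA.
by congr (_ + _); exact: addrC.
Qed.

Lemma TLopZ k c a : TLop k (c *: a) = c *: TLop k a.
Proof.
rewrite /TLop [RHS]scalerA [c * _]mulrC -[RHS]scalerA; congr (_ *: _).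
by rewrite -(scalerAr c (T (s k))) (scalerBr c) !scalerA [q * c]mulrC.
Qed.

Lemma TLop_sum k (I : Type) (r : seq I) (F : I -> hecke q n) :
  TLop k (\sum_(i <- r) F i) = \sum_(i <- r) TLop k (F i).
Proof. by rewrite /TLop mulr_sumr scaler_sumr -sumrB scaler_sumr. Qed.

Lemma hecke_barD a b : hecke_bar (a + b) = hecke_bar a + hecke_bar b.
Proof.
by rewrite /hecke_bar -big_split; apply: eq_bigr => x _; rewrite coefTD rmorphD scalerDl.
Qed.

Lemma hecke_barZ c a : hecke_bar (c *: a) = bar c *: hecke_bar a.
Proof.
rewrite /hecke_bar scaler_sumr; apply: eq_bigr => x _.
by rewrite coefTZ rmorphM scalerA.
Qed.

Lemma hecke_bar0 : hecke_bar (0 : hecke q n) = 0.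
Proof.
by rewrite -[X in hecke_bar X](scale0r (0 : hecke q n)) hecke_barZ rmorph0 scale0r.
Qed.

Lemma hecke_barN a : hecke_bar (- a) = - hecke_bar a.
Proof.
by rewrite -[X in hecke_bar X]scaleN1r hecke_barZ rmorphN rmorph1 scaleN1r.
Qed.

Lemma hecke_bar_sum (I : Type) (r : seq I) (F : I -> hecke q n) :
  hecke_bar (\sum_(i <- r) F i) = \sum_(i <- r) hecke_bar (F i).
Proof. exact: (big_morph _ hecke_barD hecke_bar0). Qed.

Lemma hecke_barT x : hecke_bar (T x) = (T x^-1%g)^-1.
Proof.
rewrite /hecke_bar (bigD1 x) //= big1 => [|y yx].
  by rewrite coefT_T eqxx rmorph1 scale1r addr0.
by rewrite coefT_T (negbTE yx) rmorph0 scale0r.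
Qed.

Lemma Tunit x : (T x : hecke q n) \is a GRing.unit.
Proof. exact: T_unit (mulVr q_unit). Qed.

Lemma T_mul_simple x k : (0 < k < n)%N -> (len x < len (x * s k))%N ->
  T x * T (s k) = T (x * s k)%g.
Proof.
move=> kn lt; have <- : actr k (T 1%g) = T (s k).
  by rewrite actrT mul1g len1 len_simple.
by rewrite [LHS]hecke_mul_actr // [X in actr k X]hecke_mulr1 actrT lt.
Qed.

Lemma T_simple_inv k : (0 < k < n)%N ->
  q *: (T (s k))^-1 = T (s k) - (q - 1) *: 1.
Proof.
move=> kn; apply: (mulrI (Tunit (s k))).
rewrite -(scalerAr q) mulrV ?Tunit // mulrBr -(scalerAr (q - 1)) mulr1.
by rewrite mul_simple_T // simpleK len1 len_simple //= addrAC subrr add0r.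
Qed.

Lemma hecke_bar_T_asc x k : (0 < k < n)%N -> (len x < len (s k * x))%N ->
  hecke_bar (T (s k * x)%g) = (T (s k))^-1 * hecke_bar (T x).
Proof.
move=> kn lt; rewrite !hecke_barT invMg simpleV.
rewrite -T_mul_simple // ?invrM ?Tunit //.
by rewrite len_mul_simple invgK lenV.
Qed.

(** The quadratic relation says that [q - T_s] absorbs [T_s], hence also its inverse, up to sign. *)
Lemma TLop_simple_inv k h : (0 < k < n)%N ->
  TLop k ((T (s k))^-1 * h) = - TLop k h.
Proof.
move=> kn; rewrite /TLop mulVKr ?Tunit // (scalerAl q) T_simple_inv // mulrBl.
rewrite -(scalerAl (q - 1)) mul1r -[RHS](scalerN qh^-1); congr (_ *: _).
by rewrite (scalerBl q) scale1r !opprB [h - _]addrC addrA addrK.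
Qed.

Lemma bar_TLop_asc k x : (0 < k < n)%N -> (len x < len (s k * x))%N ->
  hecke_bar (TLop k (T x)) = TLop k (hecke_bar (T x)).
Proof.
move=> kn lt; rewrite {1}/TLop mul_simple_T // lt (hecke_barZ qh^-1) hecke_barD.
rewrite hecke_barN.
rewrite (hecke_barZ q).
rewrite (hecke_bar_T_asc kn lt).
rewrite bar_qhV.
rewrite bar_q.
rewrite /TLop.
move: (hecke_bar (T x)) => B.
have e (X : hecke q n) : qh *: X = qh^-1 *: (q *: X).
  by rewrite (scalerA qh^-1); congr (_ *: _); rewrite q_qh qhVK.
rewrite e; congr (_ *: _).
rewrite (scalerBr q) (scalerA q q^-1) (mulrV q_unit) scale1r.
rewrite (scalerAl q (T (s k))^-1) (T_simple_inv kn).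
rewrite mulrBl -(scalerAl (q - 1)) mul1r (scalerBl q) scale1r !opprB addrA.
by rewrite [B + (_ - _)]addrC subrK.
Qed.

Lemma TLop_T_desc k x : (0 < k < n)%N -> ~~ (len x < len (s k * x))%N ->
  TLop k (T x) = - TLop k (T (s k * x)%g).
Proof.
move=> kn le; have sK : (s k * (s k * x) = x)%g by rewrite mulgA simpleK mul1g.
have lt := len_simple_lt kn le.
rewrite /TLop -[RHS](scalerN qh^-1); congr (_ *: _).
rewrite (mul_simple_T q x kn) (mul_simple_T q (s k * x)%g kn) sK lt (negbTE le).
rewrite (scalerBl q) scale1r !opprB opprD opprB addrA.
by rewrite [q *: T x + _]addrC subrK.
Qed.

(** This is bar invariance of [C'_s], checked on the basis instead of through multiplicativity of
    the bar involution: ascents by computation, descents because [TLop] sends [T x] and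
    [- T (s k * x)] to the same element. *)
Lemma bar_TLop k h : (0 < k < n)%N -> hecke_bar (TLop k h) = TLop k (hecke_bar h).
Proof.
move=> kn; rewrite -(coefT_sum h) TLop_sum !hecke_bar_sum TLop_sum.
apply: eq_bigr => x _.
rewrite (TLopZ k (coefT h x)) !(hecke_barZ (coefT h x)) (TLopZ k (bar (coefT h x))).
congr (_ *: _); have [lt|le] := boolP (len x < len (s k * x))%N.
  exact: bar_TLop_asc.
have sK : (s k * (s k * x) = x)%g by rewrite mulgA simpleK mul1g.
have lt : (len (s k * x) < len (s k * (s k * x)))%N by rewrite sK len_simple_lt.
rewrite (TLop_T_desc kn le) hecke_barN (bar_TLop_asc kn lt).
by rewrite -(TLop_simple_inv _ kn) -(hecke_bar_T_asc kn lt) sK.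
Qed.

Lemma exists_left_descent x : x != 1%g ->
  exists2 k, (0 < k < n)%N & (len (s k * x) < len x)%N.
Proof.
move=> x1; have := rwordP x; case: (rword x) => [[_ _]|k u /reduced_word_behead[]].
  by rewrite /wprod big_nil => xE; rewrite -xE eqxx in x1.
by move=> kn _ lt; exists k.
Qed.

Lemma hecke_bar_T_ind (Q : 'S_n -> hecke q n -> Prop) : Q 1%g 1 ->
  (forall x k h, (0 < k < n)%N -> (len x < len (s k * x))%N ->
     h = hecke_bar (T x) -> Q x h ->
     Q (s k * x)%g ((T (s k))^-1 * h)) ->
  forall x, Q x (hecke_bar (T x)).
Proof.
move=> Q1 Qs x; have [m] := ubnP (len x); elim: m x => // m IH x xm.
have [->|/exists_left_descent[k kn lt]] := eqVneq x 1%g.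
  by rewrite hecke_barT invg1 T1 invr1.
have sK : (s k * (s k * x) = x)%g by rewrite mulgA simpleK mul1g.
have lt' : (len (s k * x) < len (s k * (s k * x)))%N by rewrite sK.
rewrite -[X in Q X]sK -[X in T X]sK (hecke_bar_T_asc kn lt').
by apply: Qs => //; apply: IH; lia.
Qed.

Lemma coefT_simple_inv_mul k h x : (0 < k < n)%N ->
  coefT ((T (s k))^-1 * h) x = if (len x < len (s k * x))%N
    then coefT h (s k * x)%g - q^-1 * (q - 1) * coefT h x
    else q^-1 * coefT h (s k * x)%g.
Proof.
move=> kn; apply: (mulrI q_unit).
rewrite -(coefTZ q) (scalerAl q) (T_simple_inv kn) mulrBl -(scalerAl (q - 1)) mul1r.
rewrite coefTB (coefTZ (q - 1)) (coefT_simple_mul _ _ kn).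
case: ifP => _; last by rewrite addrK mulrA (mulrV q_unit) mul1r.
by rewrite mulrBr !mulrA (mulrV q_unit) mul1r.
Qed.

(** Triangularity for the length, coarser than for the Bruhat order, is what isolates the diagonal
    term at an element of maximal length in a support. *)
Lemma hecke_bar_T_triangular x :
  coefT (hecke_bar (T x)) x = q^-1 ^+ len x /\
  forall y, coefT (hecke_bar (T x)) y != 0 -> y = x \/ (len y < len x)%N.
Proof.
move: x; apply: (hecke_bar_T_ind (Q := fun x h => coefT h x = q^-1 ^+ len x /\
  forall y, coefT h y != 0 -> y = x \/ (len y < len x)%N)).
  rewrite -T1; split=> [|y]; first by rewrite coefT_T eqxx len1 expr0.
  by rewrite coefT_T; case: (y =P 1%g) => [->|_]; [left|rewrite eqxx].
move=> x k h kn lt _ [hx hy].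
have sK v : (s k * (s k * v) = v)%g by rewrite mulgA simpleK mul1g.
have lsx : len (s k * x)%g = (len x).+1.
  by have := len_le_simpleM (s k * x)%g kn; rewrite sK; lia.
split=> [|y].
  rewrite (coefT_simple_inv_mul _ _ kn) sK (_ : (_ < _)%N = false); last by lia.
  by rewrite hx lsx exprS.
rewrite (coefT_simple_inv_mul _ _ kn) => nz.
have le := len_le_simpleM y kn.
have [sy|/hy[->|]] : coefT h (s k * y)%g != 0 \/ coefT h y != 0; last 2 first.
- by right; rewrite lsx.
- by right; rewrite lsx; lia.
- have [e1|n1] := eqVneq (coefT h (s k * y)%g) 0; last by left.
  have [e2|n2] := eqVneq (coefT h y) 0; last by right.
  by move: nz; rewrite e1 e2 !mulr0 subrr if_same eqxx.
have [xE|syx] := hy _ sy; last by right; lia.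
by left; rewrite -xE sK.
Qed.

Lemma coefT_hecke_bar h y :
  coefT (hecke_bar h) y = \sum_x bar (coefT h x) * coefT (hecke_bar (T x)) y.
Proof.
rewrite {1}/hecke_bar coefT_sumE; apply: eq_bigr => x _.
by rewrite hecke_barT (coefTZ (bar (coefT h x))).
Qed.

Lemma bruhat_le_len x y : bruhat_le x y -> x = y \/ (len x < len y)%N.
Proof.
move=> /connectP[p + ->]; elim: p x => [|v p IH] x /=; first by left.
case/andP=> /andP[xv _] /IH[<-|vl]; right=> //.
exact: ltn_trans vl.
Qed.

Lemma heckeP a b : (forall x, coefT a x = coefT b x) -> a = b.
Proof. by move=> e; apply/ffunP => x; apply: e. Qed.

Lemma coefT_sum_scaleT (P : pred 'S_n) (c : 'S_n -> laurent) x :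
  coefT (\sum_(y | P y) c y *: T y) x = if P x then c x else 0.
Proof.
rewrite coefT_sumE; case: ifP => Px.
  rewrite (bigD1 x) //= big1 => [|y /andP[_ yx]].
    by rewrite (coefTZ (c x)) coefT_T eqxx mulr1 addr0.
  by rewrite (coefTZ (c y)) coefT_T eq_sym (negbTE yx) mulr0.
apply: big1 => y Py; rewrite (coefTZ (c y)) coefT_T.
by case: eqP => [xy|_]; rewrite ?mulr0 //; rewrite xy Py in Px.
Qed.

Lemma bar_inv_top_coef a x : hecke_bar a = a ->
  (forall y, coefT a y != 0 -> (len y <= len x)%N) ->
  coefT a x = bar (coefT a x) * q^-1 ^+ len x.
Proof.
move=> ba top; rewrite -{1}ba coefT_hecke_bar (bigD1 x) //= big1 => [|y yx].
  by have [-> _] := hecke_bar_T_triangular x; rewrite addr0.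
have [->|ny] := eqVneq (coefT a y) 0; first by rewrite rmorph0 mul0r.
have [_ tri] := hecke_bar_T_triangular y.
have [->|nb] := eqVneq (coefT (hecke_bar (T y)) x) 0; first by rewrite mulr0.
have [xy|lt] := tri _ nb; first by rewrite xy eqxx in yx.
by have := top y ny; rewrite leqNgt lt.
Qed.

(** At a longest element [x] of its support, the bar-invariant difference gives a polynomial with
    [p(q) = q^(len w - len x) p(q^-1)], which the degree bound forces to be 0. *)
Lemma KL_element_uniq w a b : is_KL_element w a -> is_KL_element w b -> a = b.
Proof.
move=> [P [aE Pw Psz ba]] [P' [bE Pw' Psz' bb]].
have aC x : coefT a x = qh ^- len w * (if bruhat_le x w then eval_at q (P x) else 0).
  by rewrite aE (coefTZ (qh ^- len w)) coefT_sum_scaleT.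
have bC x : coefT b x = qh ^- len w * (if bruhat_le x w then eval_at q (P' x) else 0).
  by rewrite bE (coefTZ (qh ^- len w)) coefT_sum_scaleT.
pose d := a - b; have bd : hecke_bar d = d.
  by rewrite /d hecke_barD hecke_barN ba bb.
apply/eqP; rewrite -subr_eq0 -/d; apply: contraT => d0.
have [x0 nx0] : exists x, coefT d x != 0.
  apply: contra_notP (elimN eqP d0) => /forallNP e; apply: heckeP => x.
  have -> : coefT (0 : hecke q n) x = 0 by rewrite /coefT ffunE.
  by apply/eqP/negPn/negP/e.
case: (@arg_maxnP _ x0 (fun x => coefT d x != 0) (@len n) nx0) => x nx xmax.
have e := bar_inv_top_coef bd xmax.
have dE : coefT d x = qh ^- len w * ((if bruhat_le x w then eval_at q (P x) else 0) -
    (if bruhat_le x w then eval_at q (P' x) else 0)).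
  by rewrite /d coefTB aC bC -mulrBr.
rewrite {}dE in nx e.
have [xw|nxw] := boolP (bruhat_le x w); last first.
  by rewrite (negbTE nxw) subrr mulr0 eqxx in nx.
rewrite xw -rmorphB /= in nx e.
have [xE|nxw] := eqVneq x w; first by rewrite xE Pw Pw' subrr rmorph0 mulr0 eqxx in nx.
have [xE|lt] := bruhat_le_len xw; first by rewrite xE eqxx in nxw.
have p0 : P x - P' x = 0.
  apply: (@eval_q_bar_eq0 _ (len w - len x)); last 1 first.
  - have qn0 : qh ^- len w \is a GRing.unit by rewrite unitrV unitrX ?qh_unit.
    apply: (mulrI qn0); rewrite [LHS]e rmorphM /=.
    have -> : bar (qh ^- len w) = qh ^+ len w.
      by rewrite -exprVn rmorphXn /= bar_qhV.
    have -> : q ^+ (len w - len x) = qh ^+ len w * qh ^+ len w * q^-1 ^+ len x.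
      rewrite -exprMn -q_qh -[in RHS](subnK (ltnW lt)) exprD -mulrA -exprMn.
      by rewrite (mulrV q_unit) expr1n mulr1.
    by rewrite !mulrA -(exprVn qh (len w)) qhVX mul1r mulrAC.
  - have := size_polyD (P x) (- P' x); rewrite size_polyN => szle.
    apply: leq_trans (_ : (maxn (size (P x)) (size (P' x))).*2 <= _)%N.
      by rewrite leq_double.
    by rewrite /maxn; case: ifP => _; [apply: Psz' xw nxw|apply: Psz xw nxw].
  - by lia.
by rewrite p0 rmorph0 mulr0 eqxx in nx.
Qed.

End Hecke.

(** * The module induced from the parabolic subgroup *)

Section InducedModule.
Variables (n z : nat).
Implicit Types (x y : 'S_n) (k j : nat) (f g : seq bool -> laurent).
Local Notation s := (simple n).
Local Notation T x := (T q x).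
Local Notation wd := (@coset_word n z).

Definition base_word : seq bool := coset_word z (1%g : 'S_n).

Lemma nth_base_word c : nth false base_word c = (c < minn z n)%N.
Proof.
have [cn|nc] := ltnP c n.
  by have := nth_coset_word z 1%g (Ordinal cn); rewrite perm1 /= => ->; lia.
by rewrite nth_default ?size_coset_word //; lia.
Qed.

Lemma opens_base_word c : opens base_word c = minn c (minn z n).
Proof.
elim: c => [|c IH]; first by rewrite opens0 min0n.
by rewrite opensS IH nth_base_word; lia.
Qed.

Lemma opens_le_base m c : same_content m base_word ->
  (opens m c <= opens base_word c)%N.
Proof.
case/andP=> /eqP sz /eqP cnt; rewrite opens_base_word leq_min opens_le /=.
have <- : count id base_word = minn z n.
  by rewrite -(opens_size (c := n)) ?size_coset_word // opens_base_word; lia.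
by rewrite -cnt -{2}(cat_take_drop c m) count_cat leq_addr.
Qed.

(** The base path is the highest of its content. Hence the delta function at the base word is a
    candidate, and [compat] relates it to itself. *)
Lemma KL_vec_base m : KL_vec base_word m = (m == base_word)%:R.
Proof.
rewrite /KL_vec; have [->|ne] := eqVneq m base_word.
  by rewrite /same_content !eqxx /= label_poly_diag rmorph1 mulr1 qhVX.
case: ifP => // sc; have /andP[/eqP sz /eqP cnt] := sc.
suff [c lt] : exists c, (opens m c < opens base_word c)%N.
  by rewrite (label_poly_supp sz cnt lt) rmorph0 mulr0.
apply: contra_notP (elimN eqP ne) => /forallNP le; apply: eq_opens => // c.
by apply/eqP; rewrite eqn_leq opens_le_base //= leqNgt; apply/negP/le.
Qed.

Lemma compat_base :
  compat n (fun w => (w == base_word)%:R) (fun w => (w == base_word)%:R).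
Proof.
have := compat_KL_vec base_word; rewrite size_coset_word.
by apply: eq_compat => w _; rewrite KL_vec_base.
Qed.

Lemma base_word_inv x : (wd x == base_word) = (wd x^-1%g == base_word).
Proof.
suff H y : wd y == base_word -> wd y^-1%g == base_word.
  by apply/idP/idP => [/H//|/H]; rewrite invgK.
move=> /coset_wordP e; apply/coset_wordP => i.
by have := e (y^-1%g i); rewrite permKV !perm1 => <-.
Qed.

Lemma base_word_simple_mul x k : (0 < k < n)%N -> k != z ->
  (wd (s k * x)%g == base_word) = (wd x == base_word).
Proof.
move=> kn kz; rewrite base_word_inv invMg simpleV coset_word_mul_simple //.
by rewrite -base_word_inv.
Qed.

(* The embedding of vectors indexed by words, sending the basis vector of a
   word to a multiple of the sum of the [T x] over the coset it encodes. *)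
Definition phi (kappa : laurent) f : hecke q n :=
  \sum_x (kappa * f (wd x) * qh ^+ noninv (wd x)) *: T x.

Lemma coefT_phi kappa f x :
  coefT (phi kappa f) x = kappa * f (wd x) * qh ^+ noninv (wd x).
Proof. exact: (coefT_sum_scaleT xpredT). Qed.

Lemma eq_phi kappa f g : (forall w, size w = n -> f w = g w) ->
  phi kappa f = phi kappa g.
Proof. by move=> e; apply: heckeP => x; rewrite !coefT_phi e // size_coset_word. Qed.

Lemma phiD kappa f g : phi kappa (fun w => f w + g w) = phi kappa f + phi kappa g.
Proof. by apply: heckeP => x; rewrite coefTD !coefT_phi mulrDr mulrDl. Qed.

Lemma phiZ kappa c f : phi kappa (fun w => c * f w) = c *: phi kappa f.
Proof. by apply: heckeP => x; rewrite (coefTZ c) !coefT_phi !mulrA [c * _]mulrC. Qed.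

(** Equal symbols give 0 on both sides; otherwise the factor [qh ^+ noninv] in [phi] accounts for
    the asymmetry between ascents and descents in [coefT_TLop]. *)
Lemma TLop_phi kappa k f : (0 < k < n)%N ->
  TLop k (phi kappa f) = phi kappa (cup k.-1 (cap k.-1 f)).
Proof.
move=> kn; apply: heckeP => x; rewrite (coefT_TLop _ _ kn) !coefT_phi.
have [i [j [ik jk _]]] := simpleP kn.
have [l [a [b [r [wx wsx lk /(_ i j ik jk)[aE bE]]]]]] := coset_word_simple_mul z x kn.
rewrite (left_asc x kn ik jk) wx wsx -lk cupE capE.
have V : qh^-1 * qh = 1 by rewrite mulVr ?qh_unit.
case: a b aE bE {wx wsx} => -[] aE bE; rewrite /= ?subrr ?mulr0 ?mul0r ?if_same //.
- rewrite (_ : (x i < x j)%N); last by lia.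
  rewrite noninv_open_close noninv_close_open exprS.
  rewrite -[kappa * f (l ++ _ :: _ :: r) * qh ^+ _]mul1r -[in LHS]V; ring.
- rewrite (_ : (x i < x j)%N = false); last by lia.
  rewrite noninv_open_close noninv_close_open exprS.
  rewrite mulrBr [X in _ - X](_ : _ = kappa * f (l ++ true :: false :: r) *
    qh ^+ (noninv (l ++ r) + count id l + count negb r)).
    by ring.
  by rewrite -[RHS]mul1r -V; ring.
Qed.

Variable wmax : 'S_n.
Hypothesis wmaxP : coset_max z wmax.
Hypothesis wmax_base : wd wmax = base_word.

Lemma len_le_wmax x : wd x == base_word -> (len x <= len wmax)%N.
Proof.
elim/(@coset_max_ind n z): x => [x xm /eqP xw|x k kn kz lt IH xw].
  by rewrite (coset_max_inj xm wmaxP) // wmax_base.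
by apply: leq_trans (IH _); [exact: ltnW|rewrite coset_word_mul_simple].
Qed.

(** Makes [E] the sum of the [T x] over W_J times [qh ^- len wmax], that is, [C'] of the longest
    element of W_J. *)
Definition base_scale : laurent := qh^-1 ^+ (len wmax + noninv base_word).
Local Notation E := (phi base_scale (fun w => (w == base_word)%:R)).

Lemma coefT_base x : coefT E x = (wd x == base_word)%:R * qh^-1 ^+ len wmax.
Proof.
rewrite coefT_phi /base_scale; case: eqP => [->|_]; last by rewrite mulr0 !mul0r.
by rewrite mulr1 mul1r exprD -mulrA qhVX mulr1.
Qed.

Lemma hecke_bar_T_base x y : wd x == base_word ->
  coefT (hecke_bar (T x)) y != 0 -> wd y == base_word.
Proof.
move: x y; suff H : forall x, wd x == base_word -> forall y,
  coefT (hecke_bar (T x)) y != 0 -> wd y == base_word by move=> x y /H; apply.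
apply: (hecke_bar_T_ind (Q := fun x h => wd x == base_word -> forall y,
  coefT h y != 0 -> wd y == base_word)).
  move=> _ y; rewrite -T1 coefT_T; case: (y =P 1%g) => [->|_]; rewrite eqxx //.
move=> x k h kn lt _ IH sx.
have kz : k != z.
  apply/eqP => kz; move: lt; rewrite ltnNge; apply/negP; rewrite negbK.
  have [i [j [ik jk _]]] := simpleP kn.
  have sK : (s k * (s k * x) = x)%g by rewrite mulgA simpleK mul1g.
  rewrite -{2}sK ltnW // (left_asc _ kn ik jk).
  have /coset_wordP e := sx; have := e i; have := e j; rewrite !perm1; lia.
have {}IH := IH (etrans (esym (base_word_simple_mul x kn kz)) sx).
move=> y; rewrite (coefT_simple_inv_mul _ _ kn) => nz.
have [y0|/IH//] := eqVneq (coefT h y) 0.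
have [sy0|/IH] := eqVneq (coefT h (s k * y)%g) 0; last by rewrite base_word_simple_mul.
by move: nz; rewrite y0 sy0 !mulr0 subrr if_same eqxx.
Qed.

Lemma TLop_base k : (0 < k < n)%N -> k != z -> TLop k E = 0.
Proof.
move=> kn kz; apply: heckeP => x; rewrite (coefT_TLop _ _ kn) !coefT_base.
by rewrite base_word_simple_mul // subrr !mulr0 if_same /coefT ffunE.
Qed.

(* [bar E - E] is supported on [W_J], constant there, and vanishes at the
   longest element of [W_J]. *)
Lemma hecke_bar_base : hecke_bar E = E.
Proof.
pose h := hecke_bar E - E.
have hs x k : (0 < k < n)%N -> k != z -> coefT h (s k * x)%g = coefT h x.
  move=> kn kz; apply: TLop_eq0 => //.
  by rewrite /h TLopB -bar_TLop // TLop_base // hecke_bar0 subrr.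
have hsupp x : wd x != base_word -> coefT h x = 0.
  move=> nx; rewrite /h coefTB coefT_base (negbTE nx) mul0r subr0 coefT_hecke_bar.
  apply: big1 => y _; rewrite coefT_base; have [yb|_] := boolP (wd y == base_word);
    last by rewrite mul0r rmorph0 mul0r.
  have [->|/(hecke_bar_T_base yb)] := eqVneq (coefT (hecke_bar (T y)) x) 0.
    by rewrite mulr0.
  by rewrite (negbTE nx).
(* The inverse appears because [hs] concerns left multiplication while [coset_max_ind] multiplies on
   the right. It has the same, maximal, length, so only the diagonal coefficient contributes. *)
have h0 : coefT h wmax^-1%g = 0.
  have wb : wd wmax^-1%g == base_word by rewrite -base_word_inv wmax_base.
  rewrite /h coefTB coefT_base wb mul1r coefT_hecke_bar (bigD1 wmax^-1%g) //= big1.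
    have [-> _] := hecke_bar_T_triangular wmax^-1%g.
    rewrite coefT_base wb mul1r addr0 rmorphXn /= bar_qhV lenV.
    by rewrite q_qh invrM ?qh_unit // exprMn mulrA -exprMn mulrV ?qh_unit //
       expr1n mul1r subrr.
  move=> x xw; rewrite coefT_base; have [xb|_] := boolP (wd x == base_word);
    last by rewrite mul0r rmorph0 mul0r.
  have [_ tri] := hecke_bar_T_triangular x.
  have [->|/tri[wx|lt]] := eqVneq (coefT (hecke_bar (T x)) wmax^-1%g) 0.
  - by rewrite mulr0.
  - by rewrite wx eqxx in xw.
  - by have := len_le_wmax xb; rewrite -(lenV wmax) leqNgt lt.
apply/eqP; rewrite -subr_eq0; apply/eqP/heckeP => x.
have -> : coefT (0 : hecke q n) x = 0 by rewrite /coefT ffunE.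
have [xb|/hsupp//] := boolP (wd x == base_word).
rewrite -/h -[x]invgK; move: xb; rewrite base_word_inv; move: x^-1%g => {}x.
elim/(@coset_max_ind n z): x => [x xm /eqP xb|x k kn kz lt IH xb].
  by rewrite (coset_max_inj xm wmaxP) // wmax_base.
rewrite -(hs _ k) // -(simpleV n k) -invMg; apply: IH.
by rewrite coset_word_mul_simple.
Qed.

(** The bar conjugate of [phi f] stays in the image of [phi] and is the one predicted by
    [compat]. *)
Definition bar_stable f : Prop :=
  exists g, compat n f g /\ hecke_bar (phi base_scale f) = phi base_scale g.

Lemma eq_bar_stable f f' : (forall w, size w = n -> f w = f' w) ->
  bar_stable f -> bar_stable f'.
Proof.
move=> e [g [fg bf]]; exists g; split; first exact: eq_compat fg.
by rewrite -(eq_phi _ e).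
Qed.

Lemma bar_stableD f f' : bar_stable f -> bar_stable f' ->
  bar_stable (fun w => f w + f' w).
Proof.
move=> [g [fg bf]] [g' [fg' bf']]; exists (fun w => g w + g' w).
by split; [exact: compatD|rewrite !phiD hecke_barD bf bf'].
Qed.

Lemma bar_stableZ c f : bar_stable f -> bar_stable (fun w => c * f w).
Proof.
move=> [g [fg bf]]; exists (fun w => bar c * g w).
by split; [exact: compatZ|rewrite !phiZ (hecke_barZ c) bf].
Qed.

Lemma bar_stable_cupcap j f : (j.+1 < n)%N -> bar_stable f ->
  bar_stable (cup j (cap j f)).
Proof.
move=> jn [g [fg bf]]; exists (cup j (cap j g)); split; first exact: compat_cupcap.
have kn : (0 < j.+1 < n)%N by [].
by rewrite -(TLop_phi base_scale f kn) (bar_TLop _ kn) bf TLop_phi.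
Qed.

Lemma word_cases_rev w : (exists p r, w = nseq p true ++ nseq r false) \/
  exists l r, w = l ++ false :: true :: r.
Proof.
elim: w => [|x w [[p [r ->]]|[l [r ->]]]]; first by left; exists 0%N, 0%N.
  case: x; first by left; exists p.+1, r.
  case: p => [|p]; first by left; exists 0%N, r.+1.
  by right; exists [::], (nseq p true ++ nseq r false).
by right; exists (x :: l), r.
Qed.

Lemma noninv_le w : (noninv w <= size w * size w)%N.
Proof.
elim: w => //= x w IH; have := count_size negb w; case: x; rewrite ?mul1n ?mul0n; nia.
Qed.

(** Starting from the base word, the delta function of [l )( r] is [qh] times that of [l () r] minus
    the image of the latter under [cup] after [cap]. *)
Lemma bar_stable_delta m : same_content m base_word ->
  bar_stable (fun w => (w == m)%:R).
Proof.
have [k] := ubnP (n * n - noninv m)%N; elim: k m => // k IH m mk sc.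
have [[p [r mE]]|[l [r mE]]] := word_cases_rev m.
  have -> : m = base_word.
    case/andP: (sc) => /eqP sz /eqP cnt; apply: eq_opens => // c.
    have pE : minn z n = p.
      have := cnt; rewrite -(opens_size (s := base_word) (c := n)) ?size_coset_word //.
      by rewrite opens_base_word mE count_cat !count_nseq mul1n mul0n; lia.
    have oE c' : opens m c' = minn c' p.
      elim: c' => [|c' IHc]; first by rewrite opens0 min0n.
      rewrite opensS IHc mE nth_cat size_nseq !nth_nseq.
      by case: (ltnP c' p) => ?; [|case: ifP => _]; lia.
    by rewrite oE opens_base_word pE.
  by exists (fun w => (w == base_word)%:R); split; [exact: compat_base|exact: hecke_bar_base].
pose m' := l ++ true :: false :: r.
have sz : size m = n by case/andP: sc => /eqP->; rewrite size_coset_word.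
have sz' : size m' = n by rewrite -sz mE !size_cat.
have jn : ((size l).+1 < n)%N by rewrite -sz' size_cat /=; lia.
have sc' : same_content m' base_word.
  by move: sc; rewrite mE /same_content !size_cat !count_cat.
have st' : bar_stable (fun w => (w == m')%:R).
  apply: IH sc'; move: mk; have := noninv_le m'; rewrite sz' /m' mE.
  by rewrite noninv_open_close noninv_close_open; lia.
apply: eq_bar_stable (bar_stableD (bar_stableZ qh st')
  (bar_stableZ (-1) (bar_stable_cupcap jn st'))) => w wn.
have [l' [a [b [r' [wE lE]]]]] : exists (l' : seq bool) (a b : bool) (r' : seq bool),
    w = l' ++ a :: b :: r' /\ size l' = size l.
  by apply: split_at2; rewrite wn.
rewrite wE -[in cup _]lE -[in cap _]lE cupE capE mE /m' !eqseq_cat // !eqseq_cons.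
by case: a b {wE} => -[]; rewrite /= ?andbF /=; ring.
Qed.

Lemma bar_stable_sum f (ms : seq (seq bool)) :
  (forall m, m \in ms -> same_content m base_word) ->
  bar_stable (fun w => \sum_(m <- ms) f m * (w == m)%:R).
Proof.
elim: ms => [|m ms IH] msP.
  exists (fun=> 0); split; first by apply: eq_compat (compat0 n) => w; rewrite // big_nil.
  have -> : phi base_scale (fun w => \sum_(m <- [::]) f m * (w == m)%:R) = 0.
    by apply: heckeP => x; rewrite coefT_phi big_nil mulr0 mul0r /coefT ffunE.
  rewrite hecke_bar0; apply: heckeP => x.
  by rewrite coefT_phi mulr0 mul0r /coefT ffunE.
have stm := bar_stableZ (f m) (bar_stable_delta (msP m (mem_head _ _))).
have stms := IH (fun m' h => msP m' (mem_behead (s := m :: ms) h)).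
by apply: eq_bar_stable (bar_stableD stm stms) => w _; rewrite big_cons.
Qed.

(** Linearity over the delta functions yields a vector for the bar conjugate; [compat_KL_vec] and
    [compat_inj] identify it with the candidate. *)
Lemma hecke_bar_KL_vec m : same_content m base_word ->
  hecke_bar (phi base_scale (KL_vec m)) = phi base_scale (KL_vec m).
Proof.
move=> sc; have sz : size m = n by case/andP: sc => /eqP->; rewrite size_coset_word.
pose ms := [seq w <- [seq tval t | t : n.-tuple bool] | same_content w base_word].
have msP w : size w = n -> (w \in ms) = same_content w base_word.
  move=> wn; have tin : w \in [seq tval t | t : n.-tuple bool].
    by apply/mapP; exists (tcast wn (in_tuple w)); rewrite ?mem_enum ?val_tcast.
  by rewrite mem_filter tin andbT.
have ums : uniq ms by rewrite filter_uniq // map_inj_uniq ?enum_uniq //; exact: val_inj.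
have [g [fg bf]] : bar_stable (KL_vec m).
  apply: eq_bar_stable (bar_stable_sum (KL_vec m) (ms := ms) _) => [w wn|w]; last first.
    by rewrite mem_filter => /andP[].
  have [wms|nw] := boolP (w \in ms).
    rewrite (bigD1_seq w) //= eqxx mulr1 big1 ?addr0 // => v vw.
    by rewrite eq_sym (negbTE vw) mulr0.
  rewrite big_seq big1 => [|v vms]; last first.
    by case: eqP => [wv|_]; rewrite ?mulr0 //; rewrite wv vms in nw.
  rewrite /KL_vec ifN //; apply: contra nw; rewrite msP // /same_content.
  by case/andP: sc => /eqP-> /eqP->.
rewrite bf; apply: eq_phi => w wn; have cm := compat_KL_vec m; rewrite sz in cm.
exact: compat_inj fg cm w wn.
Qed.

End InducedModule.

(** * Reduced words of minimal representatives *)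

Section MinimalRepresentatives.
Variables (n z : nat).
Implicit Types (x y : 'S_n) (k c : nat) (u : seq nat).
Local Notation s := (simple n).
Local Notation wd := (@coset_word n z).
Local Notation base := (base_word n z).

Definition coset_min x : Prop :=
  forall k, (0 < k < n)%N -> k != z -> (len x < len (x * s k))%N.

Lemma coset_min_inc x (a b : 'I_n) : coset_min x -> (a < b)%N ->
  (a < z)%N = (b < z)%N -> (x^-1%g a < x^-1%g b)%N.
Proof.
move=> xmin; move: b; suff H m : forall b : 'I_n, b = m :> nat -> (a < b)%N ->
  (a < z)%N = (b < z)%N -> (x^-1%g a < x^-1%g b)%N by move=> b; apply: H.
elim: m => [|m IH] b bm; first by rewrite bm.
move=> ab abz; have mn : (m < n)%N by have := ltn_ord b; lia.
have kn : (0 < m.+1 < n)%N by have := ltn_ord b; lia.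
have mz : m.+1 != z by lia.
have := xmin _ kn mz; rewrite (right_asc x kn (i := Ordinal mn) (j := b)) // => lt.
have [aE|ne] := eqVneq a (Ordinal mn); first by rewrite aE.
apply: ltn_trans lt; apply: IH => //; move: ne; rewrite -val_eqE /=; lia.
Qed.

Lemma coset_min_behead x k u : is_reduced_word x (k :: u) -> coset_min x ->
  coset_min (s k * x)%g.
Proof.
move=> xr xmin j jn jz; have [kn _ lt] := reduced_word_behead xr.
rewrite ltnNge; apply/negP => le.
have := xmin j jn jz; rewrite ltnNge; apply/negP; rewrite negbK.
apply: leq_trans (leq_trans (len_le_simpleM (x * s j)%g kn) _) lt.
by rewrite mulgA ltnS.
Qed.

(* [w] is obtained from the base word by letting the letters of [u], from right
   to left, turn "()" into ")(" at their columns. *)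
Fixpoint lifts u (w : seq bool) : Prop :=
  if u is k :: u' then
    exists l r, [/\ w = l ++ false :: true :: r, k = (size l).+1
      & lifts u' (l ++ true :: false :: r)]
  else w = base.

(* If the two exchanged symbols were equal, [s k * y] would be [y * s m] with
   [s m] in [W_J]. *)
Lemma coset_min_step y k : (0 < k < n)%N -> (len y < len (s k * y))%N ->
  coset_min y -> coset_min (s k * y)%g ->
  exists l r, [/\ wd y = l ++ true :: false :: r,
    wd (s k * y)%g = l ++ false :: true :: r & k = (size l).+1].
Proof.
move=> kn lt ymin xmin; have [i [j [ik jk sE]]] := simpleP kn.
have [l [a [b [r [wy wsy lk abE]]]]] := coset_word_simple_mul z y kn.
have [aE bE] := abE i j ik jk; have kl : k = (size l).+1 by rewrite lk; lia.
have ltij := lt; rewrite (left_asc y kn ik jk) in ltij.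
have neq : a != b.
  apply/eqP => ab; have zij : (y i < z)%N = (y j < z)%N by rewrite -aE -bE.
  have yj : y j = (y i).+1 :> nat.
    have [lt2|gt2|//] := ltngtP (y i).+1 (y j); last by lia.
    have mn : ((y i).+1 < n)%N by apply: ltn_trans lt2 (ltn_ord _).
    have := coset_min_inc (b := Ordinal mn) ymin (ltnSn (y i)).
    have := coset_min_inc (a := Ordinal mn) (b := y j) ymin lt2.
    rewrite /= !permK => h1 h2; have {}h1 := h1 ltac:(lia); have {}h2 := h2 ltac:(lia).
    by lia.
  have mn : (0 < y j < n)%N by rewrite yj /= -yj ltn_ord.
  have mz : (y j : nat) != z by lia.
  have xE : (s k * y = y * s (y j))%g.
    by rewrite (simpleE yj) sE -tpermJ conjgE !mulgA mulgV mul1g.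
  have := xmin _ mn mz; rewrite xE -mulgA simpleK mulg1 -xE.
  by rewrite ltnNge ltnW.
exists l, r; move: neq wy wsy; rewrite {}aE {}bE.
case: (ltnP (y i) z) => yiz; case: (ltnP (y j) z) => yjz //= _.
by lia.
Qed.

Lemma lifts_coset_word u x : is_reduced_word x u -> coset_min x -> lifts u (wd x).
Proof.
elim: u x => [|k u IH] x xr xmin /=.
  by case: xr => _ _ <-; rewrite /wprod big_nil.
have [kn yr lt] := reduced_word_behead xr; have ymin := coset_min_behead xr xmin.
have sK : (s k * (s k * x) = x)%g by rewrite mulgA simpleK mul1g.
have [|||l [r [wy wx kE]]] := coset_min_step (y := (s k * x)%g) kn; rewrite ?sK //.
by rewrite sK in wx; exists l, r; split=> //; rewrite -wy; apply: IH.
Qed.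

(** A letter [k] lowers the path by one at column [k] and nowhere else; column sizes of the heap
    thus become distances between paths. *)
Lemma opens_lifts u w c : lifts u w -> (opens w c + count_mem c u = opens base c)%N.
Proof.
elim: u w => [|k u IH] w /=; first by move=> ->; rewrite addn0.
case=> l [r [-> -> /IH]]; rewrite /= !opens_insert.
by case: (leqP c (size l)) => cl; case: (c =P (size l).+1) => ce; lia.
Qed.

Lemma size_lifts w u' : lifts u' w -> (noninv w + size u' = noninv base)%N.
Proof.
elim: u' w => [|k u' IH] w /=; first by move=> ->; rewrite addn0.
case=> l [r [-> _ /IH]]; rewrite noninv_open_close noninv_close_open; lia.
Qed.

Lemma opens_mono (w : seq bool) c : (opens w c <= opens w c.+1 <= (opens w c).+1)%N.
Proof. by rewrite opensS; case: nth; lia. Qed.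

Lemma lifts_drop u w i : lifts u w -> exists w', lifts (drop i u) w'.
Proof.
elim: u w i => [|k u IH] w i; first by move=> h; exists w.
case: i => [|i] h; first by exists w.
by case: h => l [r [_ _ /IH]]; apply.
Qed.

(* The heights [opens base - count] of the suffixes of [u]: adding the letter
   [k = u_i] turns the "()" at column [k] into ")(". *)
Lemma lifts_peak u w i (k := nth 0%N u i) : lifts u w -> (i < size u)%N ->
  [/\ (0 < k)%N,
   (opens base k.-1 + count_mem k (drop i u) = opens base k + count_mem k.-1 (drop i u))%N
  & (opens base k.+1 + count_mem k (drop i u) = (opens base k + count_mem k.+1 (drop i u)).+1)%N].
Proof.
move=> uw iu; have [w' lw'] := lifts_drop i uw.
have oE c := opens_lifts c lw'.
move: lw'; rewrite (drop_nth 0%N iu) -/k /= => -[l [r [wE kE _]]].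
have nk1 : nth false w' k.-1 = false by rewrite wE kE nth_cat /= ltnn subnn.
have nk : nth false w' k = true.
  by rewrite wE kE nth_cat ltnNge leqnSn subSnn.
have := opensS w' k.-1; have := opensS w' k; rewrite nk1 nk.
have -> : k.-1.+1 = k by rewrite kE.
have := oE k.-1; have := oE k; have := oE k.+1; rewrite (drop_nth 0%N iu) -/k /=.
by split; lia.
Qed.

Lemma lifts_valley u w i (k := nth 0%N u i) : lifts u w -> (i < size u)%N ->
  (opens base k + count_mem k.-1 (drop i.+1 u) =
     (opens base k.-1 + count_mem k (drop i.+1 u)).+1)%N /\
  (opens base k.+1 + count_mem k (drop i.+1 u) =
     opens base k + count_mem k.+1 (drop i.+1 u))%N.
Proof.
move=> uw iu; have [k0 p1 p2] := lifts_peak uw iu.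
move: p1 p2; rewrite -/k (drop_nth 0%N iu) -/k /= eqxx.
have -> : (k == k.-1) = false by lia.
have -> : (k == k.+1) = false by lia.
by lia.
Qed.

End MinimalRepresentatives.

(** * The longest element of the parabolic subgroup *)

Section LongestElement.
Variables (n z : nat).
Hypothesis zn : (0 < z < n)%N.

(** The action on natural numbers instead of ordinals, which allows the prescribed word to be
    evaluated by induction on its blocks. *)
Definition act_letter (i k : nat) : nat :=
  if i == k.-1 then k else if i == k then k.-1 else i.
Definition act_word (u : seq nat) (i : nat) : nat := foldl act_letter i u.

Lemma act_word_cat u1 u2 i : act_word (u1 ++ u2) i = act_word u2 (act_word u1 i).
Proof. exact: foldl_cat. Qed.

Lemma wprod_act u (i : 'I_n) : is_word n u -> wprod n u i = act_word u i :> nat.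
Proof.
elim: u i => [|k u IH] i; first by rewrite /wprod big_nil perm1.
move=> /= /andP[kn uw]; rewrite wprod_cons permM IH //; congr act_word.
have [a [b [ak bk ->]]] := simpleP kn; rewrite /act_letter.
have iE (c : 'I_n) : (i == c) = (i == c :> nat) by rewrite -val_eqE.
case: tpermP => [->|->|/eqP + /eqP +].
- by rewrite ak eqxx bk.
- by rewrite bk eqxx ifN ?ak //; lia.
- by rewrite !iE ak bk => /negPf-> /negPf->.
Qed.

Lemma iota1S m : iota 1 m.+1 = rcons (iota 1 m) m.+1.
Proof. by rewrite -cats1 -[in LHS](addn1 m) iotaD add1n. Qed.

Lemma act_iota1 m i : act_word (iota 1 m) i =
  if i == 0%N then m else if (i <= m)%N then i.-1 else i.
Proof.
elim: m => [|m IH]; first by case: i => // i; rewrite /= ltn0.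
rewrite iota1S -cats1 act_word_cat IH /= /act_letter /=.
by case: (i =P 0%N) => ?; case: (leqP i m) => ?; do ?[case: ifP => ?]; lia.
Qed.

Lemma act_rev_iota m d i : (0 < m)%N -> act_word (rev (iota m d)) i =
  if (i < m.-1)%N then i else if (i < (m + d).-1)%N then i.+1
  else if i == (m + d).-1 then m.-1 else i.
Proof.
elim: d m => [|d IH] m m0.
  by rewrite /= addn0; case: (ltnP i m.-1) => //; case: eqP.
rewrite /= rev_cons -cats1 act_word_cat IH //.
have -> : (m.+1 + d).-1 = (m + d)%N by [].
have -> : (m + d.+1).-1 = (m + d)%N by rewrite addnS.
rewrite /= /act_letter; case: (ltnP i m) => ?; case: (ltnP i (m + d)) => ?;
  by case: (i =P m + d)%N => ?; do ?[case: ifP => ?]; lia.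
Qed.

Lemma act_left_block m i :
  act_word (flatten [seq iota 1 m | m <- rev (iota 1 m)]) i =
  if (i <= m)%N then (m - i)%N else i.
Proof.
elim: m i => [|m IH] i; first by case: i.
rewrite {1}iota1S rev_rcons.
rewrite (_ : flatten _ = iota 1 m.+1 ++ flatten [seq iota 1 k | k <- rev (iota 1 m)]) //.
rewrite act_word_cat IH act_iota1.
case: (i =P 0%N) => [->|]; first by rewrite ltnn /= subn0.
by case: (leqP i m.+1); case: (leqP i.-1 m); case: (leqP i m); lia.
Qed.

Lemma act_right_block m d i : (0 < m)%N -> (m + d)%N = n ->
  act_word (flatten [seq rev (iota m (n - m)) | m <- iota m d]) i =
  if (m.-1 <= i < n)%N then (n.-1 + m.-1 - i)%N else i.
Proof.
elim: d m i => [|d IH] m i m0 mdn /=.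
  by case: ifP => //; lia.
rewrite act_word_cat IH //; last by lia.
have := act_rev_iota (n - m) i m0; rewrite (_ : (m + (n - m)).-1 = n.-1); last by lia.
move: (act_word _ i) => x xE.
have xP : ((i < m.-1) && (x == i) || (m.-1 <= i < n.-1) && (x == i.+1) ||
    (i == n.-1) && (x == m.-1) || (n.-1 < i) && (x == i))%N.
  by move: xE; case: (ltnP i m.-1) => i1; last case: (ltnP i n.-1) => i2;
    last case: (i =P n.-1) => i3; move=> ->; lia.
have [h1|h1] := boolP (m.+1.-1 <= x < n)%N; have [h2|h2] := boolP (m.-1 <= i < n)%N; lia.
Qed.

Lemma w0J_is_word : is_word n (w0J_word n z).
Proof.
rewrite /is_word all_cat; apply/andP; split; apply/allP => k /flattenP[v].
  by move=> /mapP[m]; rewrite mem_rev mem_iota => mz -> ; rewrite mem_iota; lia.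
by move=> /mapP[m]; rewrite mem_iota => mz ->; rewrite mem_rev mem_iota; lia.
Qed.

Lemma w0J_neq_z k : k \in w0J_word n z -> k != z.
Proof.
rewrite mem_cat => /orP[] /flattenP[v].
  by move=> /mapP[m]; rewrite mem_rev mem_iota => mz ->; rewrite mem_iota; lia.
by move=> /mapP[m]; rewrite mem_iota => mz ->; rewrite mem_rev mem_iota; lia.
Qed.

Definition w0J : 'S_n := wprod n (w0J_word n z).

Lemma w0JE (i : 'I_n) : w0J i =
  (if i < z then z.-1 - i else n.-1 + z - i)%N :> nat.
Proof.
rewrite wprod_act ?w0J_is_word // act_word_cat act_left_block.
rewrite act_right_block //; last by lia.
have := ltn_ord i; case: (ltnP i z) => iz; case: ifP; case: ifP; lia.
Qed.

Lemma w0JK : (w0J * w0J = 1)%g.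
Proof.
apply/permP => i; rewrite permM perm1; apply: val_inj => /=; rewrite !w0JE.
by have := ltn_ord i; case: (ltnP i z) => iz; case: ifP; lia.
Qed.

Lemma coset_word_mul_w0J x : coset_word z (x * w0J)%g = coset_word z x.
Proof.
apply/eqP/coset_wordP => i; rewrite permM w0JE.
by have := ltn_ord (x i); case: (ltnP (x i) z) => iz; lia.
Qed.

Lemma coset_max_mul_w0J x : coset_min z x -> coset_max z (x * w0J)%g.
Proof.
move=> xmin k kn kz; have [i [j [ik jk _]]] := simpleP kn.
have wV : w0J^-1%g = w0J by apply/eqP; rewrite eq_invg_mul w0JK.
rewrite (right_asc _ kn ik jk) invMg !permM wV -leqNgt ltnW //.
by apply: (coset_min_inc xmin); rewrite !w0JE; have := ltn_ord j;
  case: (ltnP i z) => iz; case: (ltnP j z) => jz; lia.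
Qed.

Lemma coset_min1 : coset_min z (1%g : 'S_n).
Proof. by move=> k kn _; rewrite mul1g len1 len_simple. Qed.

Lemma coset_max_w0J : coset_max z w0J.
Proof. by have := coset_max_mul_w0J coset_min1; rewrite mul1g. Qed.

Lemma coset_word_w0J : coset_word z w0J = base_word n z.
Proof. by rewrite -[w0J]mul1g coset_word_mul_w0J. Qed.

End LongestElement.

(** * Heaps and masks *)

Section Commutation.
Variable n : nat.
Implicit Types (k l : nat).
Local Notation s := (simple n).

Definition adjacent k l : bool := (k.+1 == l) || (l.+1 == k).

Lemma simple_comm k l : (0 < k < n)%N -> (0 < l < n)%N -> ~~ adjacent k l ->
  (s k * s l = s l * s k)%g.
Proof.
move=> kn ln; rewrite /adjacent; have [->//|kl] := eqVneq k l => nadj.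
have [i [j [ik jk sk]]] := simpleP kn; have [i' [j' [il jl sl]]] := simpleP ln.
rewrite conjgC; congr (_ * _)%g; rewrite sk sl tpermJ !tpermD //;
  by rewrite -val_eqE /=; lia.
Qed.

Lemma simple_noncomm k : (0 < k)%N -> (k.+1 < n)%N ->
  (s k * s k.+1 != s k.+1 * s k)%g.
Proof.
move=> k0 kn; have k1n : (k.-1 < n)%N by lia.
have kn' : (k < n)%N by lia.
pose a := Ordinal k1n; pose b := Ordinal kn'; pose c := Ordinal kn.
have -> : s k = tperm a b by rewrite -(@simpleE _ a b) //=; lia.
have -> : s k.+1 = tperm b c by rewrite -(@simpleE _ b c).
apply/eqP => /permP/(_ a); rewrite !permM tpermL tpermL (@tpermD _ b c a) ?tpermL.
- by move/(congr1 val) => /=; lia.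
- by rewrite -val_eqE /=; lia.
- by rewrite -val_eqE /=; lia.
Qed.

Lemma simple_noncommE k l : (0 < k < n)%N -> (0 < l < n)%N ->
  (s k * s l != s l * s k)%g = adjacent k l.
Proof.
move=> kn ln; case: (boolP (adjacent k l)) => [|nadj]; last first.
  by rewrite simple_comm ?eqxx.
by case/orP => /eqP e; [|rewrite eq_sym]; rewrite -e simple_noncomm //; lia.
Qed.

(* [kp i] says that the factor [i] is kept; a kept factor commutes with every
   later factor that is not kept. *)
Lemma wprod_factor (kp : nat -> bool) (f : nat -> nat) (r : seq nat) :
  pairwise (fun i j => kp i && ~~ kp j ==> (s (f i) * s (f j) == s (f j) * s (f i))%g) r ->
  wprod n [seq f i | i <- r] =
  (wprod n [seq f i | i <- r & ~~ kp i] * wprod n [seq f i | i <- r & kp i])%g.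
Proof.
elim: r => [|i r IH] /=; first by rewrite /wprod !big_nil mulg1.
case/andP=> alli /IH{}IH; case: (boolP (kp i)) => /= ki; rewrite !wprod_cons IH mulgA //.
rewrite mulgA; congr (_ * _)%g.
elim: r alli {IH} => [|j r IH] /=; first by rewrite /wprod !big_nil mulg1 mul1g.
case/andP=> ij /IH{}IH; move: ij; rewrite ki; case: (kp j) => //= /eqP ij.
by rewrite !wprod_cons mulgA ij -!mulgA IH.
Qed.

End Commutation.

Lemma count_take_sum k m (r : seq nat) :
  (\sum_(i < size r) ((nth 0 r i == k) && (i < m)) = count_mem k (take m r))%N.
Proof.
elim: r m => [|x r IH] m; first by rewrite big_ord0.
rewrite big_ord_recl /=; case: m => [|m].
  by rewrite andbF big1 // => i _; rewrite andbF.
by rewrite andbT; congr (_ + _)%N; exact: IH.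
Qed.

Lemma count_drop_lt l i j (r : seq nat) : (i <= j)%N ->
  (count_mem l (drop j r) < count_mem l (drop i r))%N ->
  exists i', [/\ (i <= i')%N, (i' < j)%N, (i' < size r)%N & nth 0%N r i' = l].
Proof.
move=> ij; have dE : drop j r = drop (j - i) (drop i r) by rewrite drop_drop subnK.
rewrite dE -{2}(cat_take_drop (j - i) (drop i r)) count_cat -{1}[count _ _]add0n.
rewrite ltn_add2r -has_count has_pred1 => /(nthP 0%N)[p pl pE].
have pj : (p < j - i)%N by move: pl; rewrite size_take_min; lia.
rewrite nth_take // nth_drop in pE; exists (i + p)%N; split=> //.
- exact: leq_addr.
- by lia.
- by move: pl; rewrite size_take_min size_drop leq_min => /andP[_]; rewrite ltn_subRL.
Qed.

(** A column of the heap without its top [m] entries; the next lemma counts its lowest [m]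
    entries. *)
Lemma count_first k m (r : seq nat) :
  count (fun i => (nth 0%N r i == k) && (m <= count_mem k (take i r)))%N
    (iota 0 (size r)) = (count_mem k r - m)%N.
Proof.
elim/last_ind: r => [|r x IH]; first by rewrite sub0n.
rewrite size_rcons -addn1 iotaD count_cat /= add0n addn0 -cats1 count_cat /= addn0.
rewrite nth_cat ltnn subnn /= take_size_cat //.
rewrite [count _ (iota 0 (size r))](_ : _ = (count_mem k r - m)%N).
  by move: (count_mem k r) => c; case: (x == k); case: (leqP m c) => ? /=; lia.
rewrite -IH; apply: eq_in_count => i; rewrite mem_iota add0n => /= ir.
by rewrite nth_cat ir take_cat ir.
Qed.

Lemma count_last k m (r : seq nat) :
  count (fun i => (nth 0%N r i == k) && (count_mem k (drop i r) <= m))%N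
    (iota 0 (size r)) = minn m (count_mem k r).
Proof.
elim: r => [|x r IH]; first by rewrite minn0.
rewrite /= -[1%N]addn0 iotaDl count_map /=.
rewrite [count _ (iota 0 _)](_ : _ = minn m (count_mem k r)); last exact: IH.
by move: (count_mem k r) => c; case: (x == k) => /=; lia.
Qed.

Section Heap.
Variables (n z : nat) (v : 'S_n) (u : seq nat).
Hypothesis zn : (0 < z < n)%N.
Hypothesis vred : is_reduced_word v u.
Hypothesis vmin : coset_min z v.
Local Notation s := (simple n).
Local Notation U := (full_word n z u).
Local Notation pos := 'I_(size (full_word n z u)).
Local Notation wd := (@coset_word n z).
Local Notation base := (base_word n z).
Local Notation lam := (coset_word z v).
Implicit Types (i j : pos) (k c : nat).

Let ulifts : lifts n z u lam := lifts_coset_word vred vmin.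

Let opens_lam c : (opens lam c + count_mem c u = opens base c)%N :=
  opens_lifts c ulifts.

Let uword : is_word n u.
Proof. by case: vred. Qed.

Let baseE c : opens base c = minn c z.
Proof. by rewrite opens_base_word; congr minn; lia. Qed.

Lemma letter_range i : (0 < letter i < n)%N.
Proof.
have : is_word n U by rewrite /is_word all_cat; apply/andP; split => //; exact: w0J_is_word.
by move/allP; apply; apply: mem_nth.
Qed.

Lemma heap_stepE i j : heap_step i j = (j < i)%N && adjacent (letter i) (letter j).
Proof. by rewrite /heap_step simple_noncommE ?letter_range. Qed.

Lemma nth_full_word (m : nat) : (m < size u)%N -> nth 0%N U m = nth 0%N u m.
Proof. by move=> mu; rewrite nth_cat mu. Qed.

Lemma size_le_full : (size u <= size U)%N.
Proof. by rewrite size_cat leq_addr. Qed.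

(* Between two equal letters there is an adjacent one: the first letter needs
   "()" at its column, the second one leaves ")(". *)
Lemma adjacent_between (i j : nat) : (i < size u)%N -> (i < j < size U)%N ->
  nth 0%N U j = nth 0%N u i -> exists i' : nat, [/\ (i < i')%N, (i' < j)%N, (i' < size u)%N
    & adjacent (nth 0%N u i') (nth 0%N u i)].
Proof.
move=> iu /andP[ij jU]; set k := nth 0%N u i => jk.
have [v1 v2] := lifts_valley ulifts iu; have [k0 _ _] := lifts_peak ulifts iu.
rewrite -/k in v1 v2 k0.
have [ju|uj] := ltnP j (size u).
  have [_ p1 _] := lifts_peak ulifts ju; rewrite -(nth_full_word ju) jk in p1.
  have le : (count_mem k (drop j u) <= count_mem k (drop i.+1 u))%N.
    rewrite (_ : drop j u = drop (j - i.+1) (drop i.+1 u)).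
      by rewrite -{2}(cat_take_drop (j - i.+1) (drop i.+1 u)) count_cat leq_addl.
    by rewrite drop_drop subnK.
  have [||i' [ii' i'j i'u i'E]] := @count_drop_lt k.-1 i.+1 j u; [by []|by lia|].
  by exists i'; split=> //; rewrite i'E /adjacent; lia.
have kz : k != z.
  rewrite -jk nth_cat ltnNge uj /=; apply: (w0J_neq_z zn); apply: mem_nth.
  by rewrite ltn_subLR // -size_cat.
have nod c : count_mem c (drop (size u) u) = 0%N by rewrite drop_size.
rewrite !baseE in v1 v2; have [kz'|zk] := ltnP k z.
  have [||i' [ii' i'j i'u i'E]] := @count_drop_lt k.+1 i.+1 (size u) u; [by []|by rewrite nod; lia|].
  by exists i'; split=> //; [exact: leq_trans uj|rewrite i'E /adjacent; lia].
have [||i' [ii' i'j i'u i'E]] := @count_drop_lt k.-1 i.+1 (size u) u; [by []|by rewrite nod; lia|].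
by exists i'; split=> //; [exact: leq_trans uj|rewrite i'E /adjacent; lia].
Qed.

Lemma heap_lt_same i j : (i < size u)%N -> (i < j)%N -> letter i = letter j ->
  heap_lt j i.
Proof.
move=> iu ij ijE; have jU := ltn_ord j.
have iE : letter i = nth 0%N u i by rewrite /letter nth_full_word.
have [||i' [ii' i'j i'u adj]] := @adjacent_between i j iu; first by rewrite ij.
  by rewrite -/(letter j) -ijE.
have i'U : (i' < size U)%N := leq_trans i'u size_le_full.
pose o : pos := Ordinal i'U.
have oE : letter o = nth 0%N u i' by rewrite /letter nth_full_word.
apply/existsP; exists o; rewrite heap_stepE /= i'j -ijE iE oE.
move: adj; rewrite /adjacent orbC => adj; rewrite adj /=.
by apply: connect1; rewrite heap_stepE /= ii' iE oE /adjacent orbC.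
Qed.

Lemma heap_lt_ltn i j : heap_lt j i -> (i < j)%N.
Proof.
case/existsP => o /andP[]; rewrite heap_stepE => /andP[oj _] /connectP[p + ->].
elim: p o oj => //= o' p IH o oj /andP[]; rewrite heap_stepE => /andP[o'o _].
by apply: IH; apply: ltn_trans oj.
Qed.

Let take_full (m : nat) : (m <= size u)%N -> take m U = take m u.
Proof. by move=> mu; rewrite takel_cat. Qed.

(** The position [i] may lie beyond [u]; the whole column of [u] is then above it, which is how
    [top_entry_rank] excludes such entries. *)
Lemma card_above_ge k i : letter i = k ->
  (count_mem k (take i u) <= #|[pred j | (letter j == k) && heap_lt i j]|)%N.
Proof.
move=> ik; have -> : take i u = take (minn i (size u)) U.
  rewrite take_full ?geq_minr // /minn; case: ltnP => // iu.
  by rewrite take_size take_oversize.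
rewrite -count_take_sum -sum1_card [X in (_ <= X)%N]big_mkcond /=; apply: leq_sum => j _.
rewrite inE leq_min -/(letter j); case: eqP => //= jk.
case: (ltnP j i) => //= ji; case: (ltnP j (size u)) => //= ju.
by rewrite heap_lt_same // jk ik.
Qed.

Lemma card_above_le k i : (i < size u)%N ->
  (#|[pred j | (letter j == k) && heap_lt i j]| <= count_mem k (take i u))%N.
Proof.
move=> iu; rewrite -take_full ?(ltnW iu) // -count_take_sum -sum1_card [X in (X <= _)%N]big_mkcond /=.
apply: leq_sum => j _; rewrite inE -/(letter j); case: eqP => //= _.
by case: (boolP (heap_lt i j)) => // /heap_lt_ltn ->.
Qed.

Lemma top_v_entryE k i : top_v_entry k i = (k \in u) && (i == index k u :> nat).
Proof.
apply/idP/idP => [/and3P[iu /eqP ik /forallP top]|/andP[ku /eqP iE]].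
  have iE : nth 0%N u i = k by rewrite -ik /letter nth_full_word.
  have ku : k \in u by rewrite -iE mem_nth.
  have ixu : (index k u < size u)%N by rewrite index_mem.
  rewrite ku /=; have [ix|ix|//] := ltngtP i (index k u).
    by have := before_find 0%N ix; rewrite /= iE eqxx.
  pose o : pos := Ordinal (leq_trans ixu size_le_full).
  have oE : letter o = k by rewrite /letter nth_full_word //= nth_index.
  have /implyP := top o; rewrite /in_v /= ixu oE eqxx => /(_ isT) /orP[/eqP oi|/heap_lt_ltn].
    by move: ix; rewrite -oi /= ltnn.
  by rewrite /= ltnNge ltnW.
have iu : (i < size u)%N by rewrite iE index_mem.
have ik : letter i = k by rewrite /letter nth_full_word // iE nth_index.
apply/and3P; split=> //; first by rewrite ik.
apply/forallP => j; apply/implyP => /andP[ju /eqP jk].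
have jE : nth 0%N u j = k by rewrite -jk /letter nth_full_word.
rewrite /heap_le; have [//|ne /=] := eqVneq j i.
apply: heap_lt_same; rewrite ?ik ?jk //.
have ij : (i <= j)%N.
  by rewrite iE leqNgt; apply/negP => /(before_find 0%N); rewrite /= jE eqxx.
by move: ne; rewrite -val_eqE /=; lia.
Qed.

Let first_pos k : k \in u -> exists i : pos, top_v_entry k i /\ i = index k u :> nat.
Proof.
move=> ku; have ixu : (index k u < size u)%N by rewrite index_mem.
exists (Ordinal (leq_trans ixu size_le_full)); rewrite top_v_entryE ku /=.
by rewrite eqxx.
Qed.

Let first_heap k i j : top_v_entry k i -> top_v_entry k.+1 j ->
  heap_lt j i = (index k u < index k.+1 u)%N.
Proof.
move=> ti tj; move: (ti) (tj); rewrite !top_v_entryE => /andP[_ /eqP <-] /andP[_ /eqP <-].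
apply/idP/idP => [/heap_lt_ltn//|ij].
apply/existsP; exists i; rewrite connect0 andbT heap_stepE ij /=.
by case/and3P: ti => _ /eqP-> _; case/and3P: tj => _ /eqP-> _; rewrite /adjacent eqxx orbT.
Qed.

Lemma lparenE k : lparen n z u k =
  [&& k \in u, k.+1 \in u & (index k u < index k.+1 u)%N].
Proof.
apply/idP/idP => [/existsP[i /existsP[j /and3P[ti tj]]]|/and3P[ku ku' lt]].
  rewrite (first_heap ti tj) => ->; rewrite andbT.
  by move: ti tj; rewrite !top_v_entryE => /andP[-> _] /andP[-> _].
have [i [ti _]] := first_pos ku; have [j [tj _]] := first_pos ku'.
by apply/existsP; exists i; apply/existsP; exists j; rewrite ti tj (first_heap ti tj).
Qed.

Lemma rparenE k : rparen n z u k =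
  [&& k \in u, k.+1 \in u & ~~ (index k u < index k.+1 u)%N].
Proof.
apply/idP/idP => [/existsP[i /existsP[j /and3P[ti tj]]]|/and3P[ku ku' lt]].
  rewrite (first_heap ti tj) => ->; rewrite andbT.
  by move: ti tj; rewrite !top_v_entryE => /andP[-> _] /andP[-> _].
have [i [ti _]] := first_pos ku; have [j [tj _]] := first_pos ku'.
by apply/existsP; exists i; apply/existsP; exists j; rewrite ti tj (first_heap ti tj).
Qed.

Let count_from (m : nat) c : (m <= index c u)%N -> c \in u ->
  count_mem c u = count_mem c (drop m u).
Proof.
move=> mc cu; rewrite -{1}(cat_take_drop m u) count_cat.
have /count_memPn -> // : c \notin take m u by rewrite in_take // -leqNgt.
Qed.

(** Identifies the parenthesis string recorded on the heap with the word of [v]: the suffix of [u]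
    from the earlier of the two first occurrences contains all letters [k] and [k+1], so
    [lifts_peak] there gives the step of the full path. *)
Lemma lam_symbol k : k \in u -> k.+1 \in u ->
  nth false lam k = (index k u < index k.+1 u)%N.
Proof.
move=> ku ku'; have ok := opens_lam k; have ok' := opens_lam k.+1.
rewrite opensS in ok'.
have [lt|ge] := ltnP (index k u) (index k.+1 u).
  have iu : (index k u < size u)%N by rewrite index_mem.
  have [_ _] := lifts_peak ulifts iu; rewrite nth_index //.
  rewrite -(count_from (leqnn _) ku) -(count_from (ltnW lt) ku').
  by move: ok'; case: nth => //; lia.
have iu : (index k.+1 u < size u)%N by rewrite index_mem.
have [_ + _] := lifts_peak ulifts iu; rewrite nth_index //=.
rewrite -(count_from (leqnn _) ku') -(count_from ge ku).
by move: ok'; case: nth => //; lia.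
Qed.

Lemma mem_support c : (c \in u) = (opens lam c < opens base c)%N.
Proof. by rewrite -opens_lam -has_pred1 has_count; lia. Qed.

(** The base path rises up to column [z] and is then level, while every path has steps 0 or 1; the
    gap between the two first grows weakly, then shrinks weakly. *)
Lemma support_interval a c b : (a <= c <= b)%N -> a \in u -> b \in u -> c \in u.
Proof.
rewrite !mem_support !baseE => acb la lb.
have mono x y : (x <= y)%N -> (opens lam x <= opens lam y <= opens lam x + (y - x))%N.
  elim: y => [|y IH]; first by rewrite leqn0 => /eqP->; rewrite leqnn leq_addr.
  rewrite leq_eqVlt => /orP[/eqP->|xy]; first by rewrite leqnn leq_addr.
  by have := IH xy; have := opens_mono lam y; lia.
have := mono a c; have := mono c b; lia.
Qed.

Lemma count_in_lparen a c : (a <= c)%N -> (forall k, a <= k <= c.+1 -> k \in u)%N ->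
  (count_in (lparen n z u) a c + opens lam a = opens lam c.+1)%N /\
  (count_in (lparen n z u) a c + count_in (rparen n z u) a c = c.+1 - a)%N.
Proof.
move=> ac; have -> : c = (a + (c - a))%N by lia.
have cS (p : pred nat) d : count_in p a (a + d.+1) = (count_in p a (a + d) + p (a + d.+1))%N.
  rewrite /count_in (_ : (a + d.+1).+1 - a = (a + d).+1 - a + 1)%N; last by lia.
  by rewrite iotaD count_cat /= addn0; congr (_ + p _)%N; lia.
elim: (c - a)%N => [|d IH] supp.
  rewrite addn0 /count_in subSnn /= !addn0 opensS lam_symbol ?supp //; try by lia.
  by rewrite lparenE rparenE !supp //=; try lia; case: ltnP; lia.
have [h1 h2] := IH ltac:(move=> k kd; apply: supp; lia).
rewrite !cS addnS (opensS lam (a + d).+1) lam_symbol; try by apply: supp; lia.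
rewrite lparenE rparenE !supp /=; try by lia.
Qed.

(** The symbol at position [b] is recorded between columns [b] and [b+1], so both end columns [a]
    and [b+1] must meet [v]; all columns between them then do. *)
Lemma matchedE a b : matched n z u a b <-> [/\ matching lam a b, a \in u & b.+1 \in u].
Proof.
split.
  case/and5P => ab la lb /eqP eqc /allP exc.
  move: la lb; rewrite lparenE rparenE => /and3P[au _ _] /and3P[_ bu _].
  have supp k : (a <= k <= b.+1)%N -> k \in u.
    by move=> akb; apply: support_interval akb au bu.
  split=> //; split=> //.
  - by have := allP uword _ bu; rewrite size_coset_word; lia.
  - by have [] := @count_in_lparen a b (ltnW ab) supp; lia.
  - move=> c acb; have cE : c = c.-1.+1 by lia.
    have := exc c.-1; rewrite mem_iota => /(_ ltac:(lia)).
    have [||] := @count_in_lparen a c.-1; [by lia|by move=> k ?; apply: supp; lia|].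
    by rewrite -cE; lia.
case=> mab au bu; have [ab bn e h] := mab.
have supp k : (a <= k <= b.+1)%N -> k \in u.
  by move=> akb; apply: support_interval akb au bu.
apply/and5P; split=> //.
- by rewrite lparenE au supp -?lam_symbol ?supp ?(matching_open mab) //; lia.
- by rewrite rparenE bu supp -?lam_symbol ?supp ?(matching_close mab) //; lia.
- by apply/eqP; have [] := @count_in_lparen a b (ltnW ab) supp; lia.
- apply/allP => c; rewrite mem_iota => acb; have := h c.+1.
  have [||] := @count_in_lparen a c; [by lia|by move=> k ?; apply: supp; lia|].
  by lia.
Qed.

Lemma vertex_matching (p : vertex n z u) : matching lam (opening p) (closing p).
Proof. by have /matchedE[] := valP p. Qed.

Lemma vertex_exists a b : matching lam a b -> a \in u -> b.+1 \in u ->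
  exists p : vertex n z u, opening p = a /\ closing p = b.
Proof.
move=> mab au bu; have [ab bn _ _] := mab; rewrite size_coset_word in bn.
have mt : matched n z u a b by apply/matchedE.
by exists (exist _ (Ordinal (ltn_trans ab bn), Ordinal bn) mt).
Qed.

Lemma vertex_inj (p r : vertex n z u) : opening p = opening r -> p = r.
Proof.
move=> e; have mp := vertex_matching p; have mr := vertex_matching r.
rewrite -e in mr; have e' := matching_inj mp mr.
apply: val_inj; case: p e e' {mp mr} => [[a b] ?]; case: r => [[a' b'] ?].
rewrite /opening /closing /= => e e'.
by congr (_, _); apply: val_inj.
Qed.

End Heap.

Lemma count_sub_in (T : eqType) (a b : pred T) (r : seq T) :
  (forall x, x \in r -> a x -> b x) -> (count a r <= count b r)%N.
Proof.
elim: r => //= x r IH h; apply: leq_add.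
  by case ax: (a x) => //; rewrite (h x) ?mem_head.
by apply: IH => y yr; apply: h; rewrite inE yr orbT.
Qed.

Section Masks.
Variables (n z : nat) (v : 'S_n) (u : seq nat).
Hypothesis zn : (0 < z < n)%N.
Hypothesis vred : is_reduced_word v u.
Hypothesis vmin : coset_min z v.
Local Notation s := (simple n).
Local Notation U := (full_word n z u).
Local Notation pos := 'I_(size (full_word n z u)).
Local Notation wd := (@coset_word n z).
Local Notation base := (base_word n z).
Local Notation lam := (coset_word z v).
Implicit Types (i j : pos) (k c : nat) (t : {ffun vertex n z u -> nat}).

Let ulifts : lifts n z u lam := lifts_coset_word vred vmin.

Let opens_lam c : (opens lam c + count_mem c u = opens base c)%N :=
  opens_lifts c ulifts.

Variable t : {ffun vertex n z u -> nat}.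
Hypothesis tlab : labelings n z u t.

(** The mask on natural numbers; with the default [true], [keep_out] holds at every [m] beyond
    [u]. *)
Definition keep (m : nat) : bool :=
  if insub m is Some o then mask_at t o else true.

Lemma keep_pos i : keep i = mask_at t i.
Proof. by rewrite /keep valK. Qed.

Lemma maskedP i : reflect (exists p j, [/\ is_valley p,
    top_entry (valley_column p) (t p) j & heap_le j i]) (~~ mask_at t i).
Proof.
rewrite negbK; apply: (iffP existsP) => [[p /existsP[j /and3P[]]]|[p [j []]]].
  by move=> vp tj ji; exists p, j.
by move=> vp tj ji; exists p; apply/existsP; exists j; rewrite vp tj ji.
Qed.

Lemma heap_le_leq i j : heap_le j i -> (i <= j)%N.
Proof. by case/orP => [/eqP->//|/(heap_lt_ltn zn vred)/ltnW]. Qed.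

(* The topmost [t p] entries of a valley column belong to [u] because [t p] is
   at most the capacity. *)
Lemma top_entry_rank (p : vertex n z u) j (k := closing p) : is_valley p ->
  top_entry k (t p) j -> (count_mem k (take j u) < t p)%N /\ (j < size u)%N.
Proof.
move=> vp /andP[/eqP jk lt].
have lt' := leq_ltn_trans (card_above_ge zn vred vmin jk) lt.
split=> //; rewrite ltnNge; apply/negP => uj.
have [_ cap] := tlab; have := cap p vp.
by rewrite leqNgt /capacity; move: lt'; rewrite take_oversize // => ->.
Qed.

Lemma masked_in_v i : ~~ mask_at t i -> (i < size u)%N.
Proof.
case/maskedP => p [j [vp tj ji]]; have [_ ju] := top_entry_rank vp tj.
exact: leq_ltn_trans (heap_le_leq ji) ju.
Qed.

Lemma keep_out m : (size u <= m)%N -> keep m.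
Proof.
rewrite /keep => um; case: insubP => // i _ iE.
by apply: contraT => /masked_in_v; rewrite iE ltnNge um.
Qed.

Lemma masked_up i j : ~~ mask_at t j -> heap_step j i -> ~~ mask_at t i.
Proof.
move=> /maskedP[p [j0 [vp tj j0j]]] ji; apply/maskedP; exists p, j0; split=> //.
apply/orP; right; case/orP: j0j => [/eqP->|/existsP[o /andP[j0o oj]]].
  by apply/existsP; exists i; rewrite ji connect0.
by apply/existsP; exists o; rewrite j0o; apply: connect_trans oj (connect1 ji).
Qed.

Definition kept_word : seq nat := [seq nth 0%N u m | m <- iota 0 (size u) & keep m].
Definition masked_word : seq nat := [seq nth 0%N u m | m <- iota 0 (size u) & ~~ keep m].

Lemma mask_permE : mask_perm t = (wprod n kept_word * w0J n z)%g.
Proof.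
have -> : mask_perm t = (\prod_(0 <= m < size U | keep m) s (nth 0%N U m))%g.
  by rewrite big_mkord; apply: eq_bigl => i; rewrite keep_pos.
have -> : size U = (size u + size (w0J_word n z))%N by rewrite size_cat.
rewrite /index_iota subn0 iotaD big_cat add0n; congr (_ * _)%g.
  rewrite /kept_word /wprod big_map big_filter big_seq_cond [RHS]big_seq_cond.
  apply: eq_bigr => m; rewrite mem_iota => /andP[/= mu _].
  by rewrite nth_cat mu.
rewrite big_seq_cond (eq_bigl (fun m => m \in iota (size u) (size (w0J_word n z)))).
  rewrite -big_seq /w0J /wprod.
  rewrite -[X in _ = (\prod_(k <- X) _)%g](drop_size_cat (s1 := u) (w0J_word n z) erefl).
  rewrite -[X in _ = (\prod_(k <- X) _)%g](take_size (drop _ _)).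
  rewrite -(map_nth_iota 0%N) ?big_map; last by rewrite size_drop size_cat addKn.
  by rewrite size_drop size_cat addKn.
move=> m; rewrite mem_iota andbC; case: (leqP (size u) m) => um; last by rewrite andbF.
by rewrite keep_out.
Qed.

(** A kept letter commutes with every later masked one, for otherwise it would lie above it and be
    masked by [masked_up]; so all masked letters can be moved to the front. *)
Lemma wprod_masked : v = (wprod n masked_word * wprod n kept_word)%g.
Proof.
have [uw us <-] := vred; have uE : u = [seq nth 0%N u m | m <- iota 0 (size u)].
  by rewrite map_nth_iota0 // take_size.
rewrite {1}uE; apply: wprod_factor; apply/(pairwiseP 0%N) => a b.
rewrite !inE size_iota => au bu ab; rewrite !nth_iota // !add0n.
apply/implyP => /andP[ka kb]; apply: contraTT kb => ncomm; rewrite negbK.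
have aU : (a < size U)%N by apply: leq_trans au _; rewrite size_cat leq_addr.
have bU : (b < size U)%N by apply: leq_trans bu _; rewrite size_cat leq_addr.
have := keep_pos (Ordinal bU); rewrite /= => ->.
have ka' : mask_at t (Ordinal aU) by rewrite -keep_pos.
apply: contraTT ka' => mb; apply: masked_up mb _.
rewrite /heap_step /letter /= ab !nth_cat au bu /= eq_sym.
by [].
Qed.

Lemma size_masked : (size masked_word + size kept_word = size u)%N.
Proof. by rewrite !size_map !size_filter addnC count_predC size_iota. Qed.

Let words_ok : is_word n masked_word /\ is_word n kept_word.
Proof.
have [uw _ _] := vred.
by split; apply/allP => k /mapP[m]; rewrite mem_filter mem_iota => /and3P[_ _ mu] ->;
  apply: (allP uw); apply: mem_nth.
Qed.

Let len_mul_le x y : (len (x * y : 'S_n)%g <= len x + len y)%N.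
Proof.
have [xw xs xP] := rwordP x; have [yw ys yP] := rwordP y.
have := @len_wprod n (rword x ++ rword y); rewrite wprod_cat xP yP size_cat xs ys.
by apply; rewrite /is_word all_cat; apply/andP.
Qed.

(** The two factors of [v] use [len v] letters in all, so neither word can be shortened. *)
Lemma len_kept : len (wprod n kept_word) = size kept_word.
Proof.
have [mw kw] := words_ok; have [_ us _] := vred.
have := len_wprod kw; have := len_wprod mw; have := size_masked.
have := len_mul_le (wprod n masked_word) (wprod n kept_word).
by rewrite -wprod_masked; lia.
Qed.

Lemma kept_reduced : is_reduced_word (wprod n kept_word) kept_word.
Proof. by split; [case: words_ok|rewrite len_kept|]. Qed.

Lemma coset_min_kept : coset_min z (wprod n kept_word).
Proof.
move=> k kn kz; rewrite ltnNge; apply/negP => le.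
have := vmin kn kz; rewrite ltnNge; apply/negP; rewrite negbK {1}wprod_masked -mulgA.
have [mw _] := words_ok; have [_ us _] := vred.
apply: leq_trans (len_mul_le _ _) (leq_trans (leq_add (len_wprod mw) le) _).
by rewrite len_kept size_masked us.
Qed.

Lemma opens_mask_perm c :
  (opens (wd (mask_perm t)) c + count_mem c kept_word = opens base c)%N.
Proof.
rewrite mask_permE coset_word_mul_w0J //; apply: opens_lifts.
exact: lifts_coset_word kept_reduced coset_min_kept.
Qed.

Lemma coset_max_mask_perm : coset_max z (mask_perm t).
Proof. by rewrite mask_permE; apply: coset_max_mul_w0J coset_min_kept. Qed.

Lemma bruhat_mask_permE y : bruhat_le y (mask_perm t) <->
  forall c, (opens (wd (mask_perm t)) c <= opens (wd y) c)%N.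
Proof.
split=> [le c|le]; first exact: bruhat_opens.
by have [] := opens_bruhat coset_max_mask_perm le.
Qed.

Let count_kept c : count_mem c kept_word =
  count (fun m => (nth 0%N u m == c) && keep m) (iota 0 (size u)).
Proof. by rewrite count_map count_filter; apply: eq_count => m /=. Qed.

(** At least [t p] entries of the valley column are masked, so the path of x(t) is there at least
    [t p] above that of [v], and the path of [y] is above that of x(t). *)
Lemma bruhat_mask_perm_valley y (p : vertex n z u) : bruhat_le y (mask_perm t) ->
  is_valley p -> (t p + opens lam (closing p) <= opens (wd y) (closing p))%N.
Proof.
move=> /bruhat_mask_permE le vp; set k := closing p.
have := le k; have := opens_mask_perm k; have := opens_lam k.
have [_ /(_ p vp)] := tlab; rewrite /capacity -/k.
have -> : valley_column p = k by [].
suff : (count_mem k kept_word <= count_mem k u - t p)%N by lia.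
rewrite count_kept -count_first; apply: count_sub_in => m.
rewrite mem_iota add0n => /= mu /andP[mk km]; rewrite mk leqNgt /=.
apply/negP => lt; have mU : (m < size U)%N by rewrite size_cat ltn_addr.
have := keep_pos (Ordinal mU); rewrite /= km => /esym; apply/negP/maskedP.
exists p, (Ordinal mU); split=> //; last by rewrite /heap_le eqxx.
rewrite /top_entry /letter /= nth_cat mu mk /=.
exact: leq_ltn_trans (card_above_le zn vred k (i := Ordinal mU) mu) lt.
Qed.

(* The entries of rank (from below) at most [opens base - opens y] in their
   column are closed under going down in the heap. *)
Lemma valley_bruhat_mask_perm y :
  (forall c, opens lam c <= opens (wd y) c)%N ->
  (forall p : vertex n z u, is_valley p ->
     t p + opens lam (closing p) <= opens (wd y) (closing p))%N ->
  bruhat_le y (mask_perm t).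
Proof.
move=> lamy valy; apply/bruhat_mask_permE => c.
pose low (m : nat) := (opens (wd y) (nth 0 u m) + count_mem (nth 0 u m) (drop m u) <=
  opens base (nth 0 u m))%N.
(* [low i] says that at column [k] the path of [y] is not above that of the suffix of [u] from [i].
   The latter is level just left of [k] and rises just right of it, so the comparison extends to the
   neighbouring columns. *)
have low_down i j : (j < size u)%N -> heap_step j i -> low i -> low j.
  rewrite (heap_stepE zn vred) => ju /andP[ij adj]; have iu := ltn_trans ij ju.
  move: adj; rewrite /letter /= !nth_cat ju iu /low.
  have [k0 p1 p2] := lifts_peak ulifts iu; set k := nth 0%N u i; set l := nth 0%N u j.
  have le : (count_mem l (drop j u) <= count_mem l (drop i u))%N.
    rewrite -(subnK (ltnW ij)) -drop_drop -{2}(cat_take_drop (j - i) (drop i u)).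
    by rewrite count_cat leq_addl.
  rewrite -/k in k0 p1 p2; case/orP => /eqP lk.
    have lE : l = k.-1 by rewrite -lk.
    have := opens_mono (wd y) k.-1; rewrite prednK // lE in le *; lia.
  by have := opens_mono (wd y) k; rewrite -lk in le *; lia.
(* A masked entry is, or lies above, one of the top [t p] entries [j] of a valley column. If it were
   low, so would [j] be, against the valley bound, since fewer than [t p] letters of that column
   precede [j]. *)
have low_kept i : (i < size u)%N -> low i -> mask_at t i.
  move=> iu; apply: contraTT => /maskedP[p [j [vp tj ji]]].
  have [rk ju] := top_entry_rank vp tj; have lowj : low i -> low j.
    case/orP: ji => [/eqP->//|/existsP[o /andP[jo /connectP[r + iE]]]].
    rewrite {}iE; elim: r o j jo ju {tj rk} => [|o' r IH] o j jo ju /=.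
      by move=> _; apply: low_down.
    move=> /andP[oo' rp] lowl; have ou : (o < size u)%N.
      by move: jo; rewrite (heap_stepE zn vred) => /andP[oj _]; apply: ltn_trans ju.
    by apply: (low_down _ _ ju jo); apply: (IH o' o oo' ou rp).
  apply/negP => /lowj; rewrite /low.
  have jk : nth 0%N u j = closing p.
    by rewrite -(nth_full_word n z ju); case/andP: tj => /eqP.
  rewrite jk; have := valy p vp; have := opens_lam (closing p).
  have := count_cat (pred1 (closing p)) (take j u) (drop j u).
  by rewrite cat_take_drop; move: rk; lia.
have := opens_mask_perm c; have := opens_lam c; have := lamy c.
suff : (minn (opens base c - opens (wd y) c) (count_mem c u) <= count_mem c kept_word)%N.
  by lia.
rewrite count_kept -count_last; apply: count_sub_in => m.
rewrite mem_iota add0n => /= mu /andP[/eqP mc le]; rewrite mc eqxx /=.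
have mU : (m < size U)%N by rewrite size_cat ltn_addr.
have := keep_pos (Ordinal mU); rewrite /= => ->; apply: low_kept => //.
have {}le : (count_mem c (drop m u) <= opens base c - opens (wd y) c)%N := le.
have pos : (0 < count_mem c (drop m u))%N.
  by rewrite -has_count has_pred1 -mc (drop_nth 0%N mu) mem_head.
have -> : low m = (opens (wd y) c + count_mem c (drop m u) <= opens base c)%N.
  by rewrite /low mc.
by lia.
Qed.

End Masks.

(** * Labelings of the tree *)

(** Moving right while [s] opens, or left while it closes, leads to a valley inside the pair; on the
    way the excess of [m] over [s] never increases. *)
Lemma valley_below m s a b c : matching s a b -> (a < c <= b)%N ->
  exists e, [/\ (a <= e)%N, (e < b)%N, nth false s e, ~~ nth false s e.+1
    & (opens m e.+1 + opens s c <= opens m c + opens s e.+1)%N].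
Proof.
move=> mab; have sa := matching_open mab; have sb := matching_close mab.
case sc: (nth false s c) => /andP[ac cb].
  have [k] := ubnP (b - c)%N; elim: k c sc ac cb => // k IH c sc ac cb bk.
  have ncb : c <> b by move=> e; rewrite -e sc in sb.
  case sc': (nth false s c.+1); last first.
    exists c; rewrite sc' sc; split=> //; [by lia|by lia|].
    by rewrite !opensS sc; case: nth; lia.
  have [|||e [ae eb se se' le]] := IH c.+1 sc'; try lia.
  by exists e; split=> //; move: le; rewrite (opensS m c) (opensS s c) sc; case: nth; lia.
elim: c sc ac cb => // c IH sc ac cb.
have [sc'|sc'] := boolP (nth false s c).
  by exists c; rewrite sc; split=> //; lia.
have nac : a <> c by move=> e; rewrite -e sa in sc'.
have [||e [ae eb se se' le]] := IH (negbTE sc'); try lia.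
by exists e; split=> //; move: le; rewrite (opensS m c) (opensS s c) (negbTE sc'); lia.
Qed.

Lemma eval_label_poly m s : eval_at q (label_poly m s) =
  \sum_(t \in bounded_labelings m s) q ^+ (\sum_(a < size s) t a)%N.
Proof.
rewrite /label_poly !fsbig_finite; try exact: bounded_labelings_finite.
rewrite rmorph_sum; apply: eq_bigr => t _.
by rewrite rmorphXn /= eval_atX.
Qed.

Section LabelingBijection.
Variables (n z : nat) (v : 'S_n) (u : seq nat).
Hypothesis zn : (0 < z < n)%N.
Hypothesis vred : is_reduced_word v u.
Hypothesis vmin : coset_min z v.
Local Notation wd := (@coset_word n z).
Local Notation base := (base_word n z).
Local Notation lam := (coset_word z v).

Let ulifts : lifts n z u lam := lifts_coset_word vred vmin.

Let opens_lam c : (opens lam c + count_mem c u)%N = opens base c :=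
  opens_lifts c ulifts.

Let baseE c : opens base c = minn c z.
Proof. by rewrite opens_base_word; congr minn; lia. Qed.

Let memu c : (c \in u) = (opens lam c < opens base c)%N := mem_support zn vred vmin c.

(* A matched pair of the word of [v] that is not a vertex of the tree encloses
   a column without entries of [v]. *)
Lemma label_out m t a b : same_content m base -> bounded_labelings m lam t ->
  matching lam a b -> ~~ ((a \in u) && (b.+1 \in u)) -> t a = 0%N.
Proof.
move=> sc [_ _ cap] mab; have [ab bn _ _] := mab.
have sa := matching_open mab; have sb := matching_close mab.
rewrite negb_and !memu -!leqNgt => /orP[le|le].
  have := cap a b a.+1 mab; rewrite ltnSn ab => /(_ isT).
  have := opens_le_base a.+1 sc; move: le; have := opens_lam a.+1.
  by rewrite opensS sa !baseE; lia.
have := cap a b b mab; rewrite ab leqnn => /(_ isT).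
have := opens_le_base b sc; move: le; have := opens_lam b.
by rewrite (opensS lam b) (negbTE sb) !baseE; lia.
Qed.

Definition restrict_labels (t : nat -> nat) : {ffun vertex n z u -> nat} :=
  [ffun p => t (opening p)].

Lemma label_sum_restrict m t : same_content m base -> bounded_labelings m lam t ->
  label_sum (restrict_labels t) = (\sum_(a < size lam) t a)%N.
Proof.
move=> sc bt; rewrite size_coset_word /label_sum.
rewrite (partition_big (fun p : vertex n z u => (val p).1) xpredT) //=.
apply: eq_bigr => a _; have [ta|ta] := eqVneq (t a) 0%N.
  by rewrite ta big1 // => p /eqP pa; rewrite ffunE /opening pa.
have [supp _ _] := bt; have [b mab] := supp _ ta.
have /andP[au bu] : ((a : nat) \in u) && (b.+1 \in u).
  by apply: contraT => /(label_out sc bt mab) t0; rewrite t0 in ta.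
have [p0 [p0a _]] := vertex_exists zn vred vmin mab au bu.
have p0E : (val p0).1 == a by apply/eqP/val_inj.
rewrite (bigD1 p0) //= big1 => [|p /andP[/eqP pa pp0]].
  by rewrite addn0 ffunE p0a.
case/eqP: pp0; apply: (vertex_inj zn vred vmin).
by rewrite p0a /opening pa.
Qed.

(** On the tree only leaves are bounded: [valley_below] and monotonicity carry their bounds to all
    enclosed columns. The capacities hold because no path exceeds the base path, and pairs that are
    not vertices carry 0 by [label_out]. *)
Lemma restrict_labels_bij y : set_bij (bounded_labelings (wd y) lam)
  [set t | labelings n z u t /\ bruhat_le y (mask_perm t)]%classic restrict_labels.
Proof.
have sc : same_content (wd y) base := same_content_coset_word _ _ _.
have scl : same_content (wd y) lam := same_content_coset_word _ _ _.
have vm (p : vertex n z u) := vertex_matching zn vred vmin p.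
have vexists a b := vertex_exists zn vred vmin (a := a) (b := b).
split.
- move=> t bt; have [supp mon cap] := bt.
  have valy (p : vertex n z u) : is_valley p ->
      (restrict_labels t p + opens lam (closing p) <= opens (wd y) (closing p))%N.
    move=> vp; rewrite ffunE; apply: cap (vm p) _.
    by have [-> _ _ _] := vm p; rewrite leqnn.
  have lab : labelings n z u (restrict_labels t).
    split=> [p r /andP[pr1 pr2]|p vp].
      by rewrite !ffunE; apply: mon (vm r) (vm p) pr1 pr2.
    have := valy p vp; have := opens_le_base (closing p) sc.
    by have := opens_lam (closing p); rewrite /capacity /valley_column; lia.
  split=> //; apply: (valley_bruhat_mask_perm zn vred vmin lab) => // c.
  by case/andP: scl => /eqP sz /eqP cnt; apply: bounded_labelings_opens_le bt c.
- move=> t1 t2 /set_mem bt1 /set_mem bt2 /ffunP e; apply/funext => a.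
  have out (t t' : nat -> nat) : bounded_labelings (wd y) lam t ->
     bounded_labelings (wd y) lam t' -> (forall p : vertex n z u, t (opening p) = t' (opening p)) ->
     t a != 0%N -> t a = t' a.
    move=> bt bt' tt' ta; have [supp _ _] := bt; have [b mab] := supp _ ta.
    have /andP[au bu] : (a \in u) && (b.+1 \in u).
      by apply: contraT => /(label_out sc bt mab) t0; rewrite t0 in ta.
    by have [p [<- _]] := vexists a b mab au bu; apply: tt'.
  have e' (p : vertex n z u) : t1 (opening p) = t2 (opening p).
    by have := e p; rewrite !ffunE.
  have [t1a|/(out t1 t2)->//] := eqVneq (t1 a) 0%N.
  have [t2a|/(out t2 t1)->//] := eqVneq (t2 a) 0%N; by rewrite t1a t2a.
- move=> t [lab yt]; have [mon cap] := lab.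
  (* Preimage of [t]: its labels on the vertices, extended by 0. *)
  pose f (a : nat) := if [pick p : vertex n z u | opening p == a] is Some p then t p else 0%N.
  have fE p : f (opening p) = t p.
    rewrite /f; case: pickP => [r /eqP /(vertex_inj zn vred vmin)->//|/(_ p)].
    by rewrite eqxx.
  have f0 a : (forall p : vertex n z u, opening p <> a) -> f a = 0%N.
    by move=> h; rewrite /f; case: pickP => // p /eqP /h.
  have vP a b : matching lam a b -> (exists2 p : vertex n z u, opening p = a & closing p = b) \/
      f a = 0%N /\ ~~ ((a \in u) && (b.+1 \in u)).
    move=> mab; have [/andP[au bu]|nu] := boolP ((a \in u) && (b.+1 \in u)).
      by left; have [p [pa pb]] := vexists a b mab au bu; exists p.
    right; split=> //; apply: f0 => p pa; case/negP: nu.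
    have mp := vm p; rewrite pa in mp; have /(matchedE zn vred vmin)[] := valP p.
    by rewrite -/(opening p) -/(closing p) pa (matching_inj mab mp) => _ -> ->.
  exists f; last by apply/ffunP => p; rewrite ffunE fE.
  split.
  + move=> a fa; have [p /eqP pa|none] := pickP (fun p : vertex n z u => opening p == a).
      by exists (closing p); rewrite -pa.
    by rewrite f0 ?eqxx // in fa => p pa; have := none p; rewrite pa eqxx.
  + move=> a b a' b' mab mab' aa' bb'.
    have [[p pa pb]|[-> _]//] := vP a b mab.
    have [[p' pa' pb']|[_]] := vP a' b' mab'.
      by rewrite -pa -pa' !fE; apply: mon; rewrite /descendant pa pa' pb pb' aa'.
    have /(matchedE zn vred vmin)[_] := valP p.
    rewrite -/(opening p) -/(closing p) pa pb => au bu.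
    have [a'b' _ _ _] := mab'.
    by rewrite !(support_interval zn vred vmin _ au bu) //; lia.
  + move=> a b c mab acb; have [[p pa pb]|[fa0 nu]] := vP a b mab; last first.
      have le : (opens (wd (mask_perm t)) c <= opens (wd y) c)%N by apply: bruhat_opens.
      have := opens_mask_perm zn vred vmin lab c.
      rewrite fa0 add0n; move: le.
      have : (count_mem c (kept_word t) <= count_mem c u)%N.
        rewrite /kept_word count_map -[X in (_ <= count _ X)%N](take_size u).
        rewrite -(map_nth_iota0 0%N (leqnn (size u))) count_map count_filter.
        by apply: count_sub_in => i _ /andP[].
      by have := opens_lam c; lia.
    have [e [ae eb se se' le]] := valley_below (wd y) mab acb.
    have /(matchedE zn vred vmin)[_] := valP p.
    rewrite -/(opening p) -/(closing p) pa pb => au bu.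
    have es : (e.+1 < size lam)%N by have [_ bn _ _] := mab; lia.
    have me := matching_valley se se' es.
    have [||r [re rc]] := vexists e e.+1 me;
      try by apply: (support_interval zn vred vmin _ au bu); lia.
    have vr : is_valley r by rewrite /is_valley re rc.
    have := bruhat_mask_perm_valley zn vred vmin lab yt vr; rewrite rc.
    suff : (f a <= t r)%N by lia.
    have [ea|nea] := eqVneq e a; first by rewrite -fE re ea.
    have neb : e.+1 <> b.
      by move=> e1b; rewrite -e1b in mab; case/eqP: nea; exact: matching_inj_close me mab.
    rewrite -pa fE; apply: mon; rewrite /descendant pa pb re rc; lia.
Qed.

(** For [y = 1] the Bruhat condition holds for every labeling, the base path being the highest. *)
Lemma labelings_finite : finite_set (labelings n z u).
Proof.
apply: (@sub_finite_set _ _ (restrict_labels @` bounded_labelings (wd 1%g) lam)%classic).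
  move=> t lab; have [_ _ surj] := restrict_labels_bij 1%g; apply: surj; split=> //.
  apply/(bruhat_mask_permE zn vred vmin lab) => c; apply: opens_le_base.
  exact: same_content_coset_word.
exact/finite_image/bounded_labelings_finite.
Qed.

Lemma sum_labelings y :
  \sum_(t \in labelings n z u) (q ^+ label_sum t * (bruhat_le y (mask_perm t))%:R) =
  eval_at q (label_poly (wd y) lam).
Proof.
have sc : same_content (wd y) base := same_content_coset_word _ _ _.
rewrite eval_label_poly.
transitivity (\sum_(t \in [set t | labelings n z u t /\ bruhat_le y (mask_perm t)]%classic)
    q ^+ label_sum t).
  rewrite (_ : [set t | _ /\ _]%classic =
    (labelings n z u `&` [set t | bruhat_le y (mask_perm t)])%classic) //.
  rewrite [RHS]fsbig_mkcondr; apply: eq_fsbigr => t _.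
  have -> : (t \in [set t | bruhat_le y (mask_perm t)]%classic) = bruhat_le y (mask_perm t).
    by apply/idP/idP; rewrite inE.
  by case: ifP; rewrite ?mulr1 ?mulr0.
rewrite (reindex_fsbig restrict_labels _ _ _ (restrict_labels_bij y)).
apply: eq_fsbigr => t /set_mem bt; congr (_ ^+ _).
exact: label_sum_restrict bt.
Qed.

End LabelingBijection.

(** * The Kazhdan-Lusztig element of a coset and the theorem *)

Lemma parabolic_preserve n z (g : 'S_n) : (g \in parabolic n z)%g ->
  forall i, (g i < z)%N = (i < z)%N.
Proof.
case/gen_prodgP => m [c cP ->]; elim/big_ind: _ => [i|x y hx hy i|j _ i].
- by rewrite perm1.
- by rewrite permM hy hx.
- have := cP j; rewrite inE => /existsP[k /and3P[k0 kz /eqP->]].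
  have kn : (0 < k < n)%N by rewrite k0 ltn_ord.
  have /eqP/coset_wordP := coset_word_mul_simple 1%g kn kz.
  by move/(_ i); rewrite mul1g perm1.
Qed.

Section CosetKL.
Variables (n z : nat) (v : 'S_n) (u : seq nat).
Hypothesis zn : (0 < z < n)%N.
Hypothesis vred : is_reduced_word v u.
Hypothesis vmin : coset_min z v.
Local Notation wd := (@coset_word n z).
Local Notation lam := (coset_word z v).
Local Notation w := (v * w0J n z)%g.
Local Notation w0 := (w0J n z).

Let wmax : coset_max z w := coset_max_mul_w0J zn vmin.
Let lamE : wd w = lam := coset_word_mul_w0J zn v.

(** One inequality comes from concatenating words, with [size_lifts] for the size of [u]; the other
    is the length estimate of [opens_bruhat] from [w0] to [w]. *)
Lemma len_mul_w0J : (len w0 + noninv (base_word n z) = len w + noninv lam)%N.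
Proof.
have le : (len w <= size u + len w0)%N.
  have [uw us uP] := vred; have [rw rs rP] := rwordP w0.
  have := @len_wprod n (u ++ rword w0); rewrite wprod_cat uP rP size_cat rs.
  by apply; rewrite /is_word all_cat; apply/andP.
have [|_] := opens_bruhat (y := w0) wmax.
  by move=> c; rewrite coset_word_w0J //; apply: opens_le_base; exact: same_content_coset_word.
rewrite coset_word_w0J // lamE.
by have := size_lifts (lifts_coset_word vred vmin); lia.
Qed.

Lemma base_scale_noninv : base_scale z w0 * qh ^+ noninv lam = qh ^- len w.
Proof. by rewrite /base_scale len_mul_w0J exprD -mulrA qhVX mulr1 exprVn. Qed.

Lemma coefT_phi_KL_vec y : coefT (phi n z (base_scale z w0) (KL_vec lam)) y =
  qh ^- len w * eval_at q (label_poly (wd y) lam).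
Proof.
rewrite coefT_phi /KL_vec same_content_coset_word -base_scale_noninv.
have V := qhVX (noninv (wd y)).
by rewrite -[RHS]mulr1 -V; ring.
Qed.

Lemma KL_element_coset : is_KL_element w (phi n z (base_scale z w0) (KL_vec lam)).
Proof.
exists (fun x => label_poly (wd x) lam); split.
- apply: heckeP => y; rewrite coefT_phi_KL_vec (coefTZ (qh ^- len w)) coefT_sum_scaleT.
  case: ifPn => // nyw; suff -> : label_poly (wd y) lam = 0 by rewrite rmorph0.
  have /andP[/eqP sz /eqP cnt] : same_content (wd y) lam by exact: same_content_coset_word.
  suff [c lt] : exists c, (opens (wd y) c < opens lam c)%N by apply: label_poly_supp lt.
  apply: contra_notP (elimN idP nyw) => /forallNP le.
  have [|//] := opens_bruhat (y := y) wmax.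
  by move=> c; rewrite lamE leqNgt; apply/negP/le.
- by rewrite lamE label_poly_diag.
- move=> x xw nxw; have [e|lt] := bruhat_le_len xw; first by rewrite e eqxx in nxw.
  (* In the coset of [w] the polynomial is 1, and the bound amounts to [len x < len w]. *)
  have [xl|nxl] := eqVneq (wd x) lam.
    by rewrite xl label_poly_diag size_poly1; lia.
  have /andP[/eqP sz /eqP cnt] : same_content (wd x) lam by exact: same_content_coset_word.
  apply: leq_trans (size_label_poly sz cnt nxl) _.
  have [|_] := opens_bruhat (y := x) wmax; first by move=> c; apply: bruhat_opens.
  by rewrite lamE; lia.
- apply: hecke_bar_KL_vec; first exact: coset_max_w0J.
    exact: coset_word_w0J.
  exact: same_content_coset_word.
Qed.

Lemma KL_basis_coset : KL_basis w = phi n z (base_scale z w0) (KL_vec lam).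
Proof.
apply: (KL_element_uniq _ KL_element_coset).
exact: (xgetPex 0 (ex_intro _ _ KL_element_coset)).
Qed.

End CosetKL.

Lemma min_coset_rep_coset_min n z (w v : 'S_n) : min_coset_rep z w v ->
  coset_min z v /\ coset_word z v = coset_word z w.
Proof.
case=> /lcosetP[g gP vE] minv; split; last first.
  by apply/eqP/coset_wordP => i; rewrite vE permM (parabolic_preserve gP).
move=> k kn kz; apply: contraT => nlt; have /andP[k0 kltn] := kn.
have sP : simple n k \in parabolic n z.
  by apply: mem_gen; rewrite inE; apply/existsP; exists (Ordinal kltn); rewrite /= k0 kz eqxx.
have le : (len v <= len (v * simple n k))%N.
  by apply: minv; rewrite vE -mulgA mem_lcoset mulKg groupM.
have := @len_simple_lt n v^-1%g k kn; rewrite -len_mul_simple lenV => /(_ nlt).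
by rewrite ltnNge le.
Qed.

Theorem theorem4p2 (n z : nat) (w v : 'S_n) (u : seq nat) :
  cograssmannian w -> right_ascent w z ->
  min_coset_rep z w v -> is_reduced_word v u ->
  KL_basis w =
    qh ^- len w *:
      \sum_(t \in labelings n z u)
        (q ^+ label_sum t * qh ^+ len (mask_perm t)) *: B_basis (mask_perm t).
Proof.
move=> cog raz vrep vred; have /andP[zn _] := raz.
have [vmin vw] := min_coset_rep_coset_min vrep.
have wmax : coset_max z w.
  move=> k kn kz; apply/negP => lt; case/eqP: kz.
  by apply: cog raz; rewrite /right_ascent kn.
have -> : w = (v * w0J n z)%g.
  apply: coset_max_inj wmax (coset_max_mul_w0J zn vmin) _.
  by rewrite coset_word_mul_w0J.
(* Coefficients of [T y] are compared: the power [qh ^+ len (mask_perm t)] cancels the normalisation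
   of [B_basis], leaving the indicator of [y <= x(t)] as in [sum_labelings]. *)
rewrite (KL_basis_coset zn vred vmin); apply: heckeP => y.
rewrite (coefT_phi_KL_vec zn vred vmin) (coefTZ (qh ^- len _)); congr (_ * _).
rewrite -(sum_labelings zn vred vmin) !fsbig_finite;
  try exact: (labelings_finite zn vred vmin).
rewrite coefT_sumE; apply: eq_bigr => t _.
rewrite (coefTZ (q ^+ _ * _)) (coefTZ (qh ^- _)) -mulrA; congr (_ * _).
have -> : \sum_(x | bruhat_le x (mask_perm t)) T q x =
    \sum_(x | bruhat_le x (mask_perm t)) (1 : laurent) *: T q x.
  by apply: eq_bigr => x _; rewrite scale1r.
rewrite (coefT_sum_scaleT _ (fun=> 1)) mulrA -exprVn mulrC mulrA.
by rewrite [_ * qh^-1 ^+ _]mulrC; case: ifP => _; rewrite ?mul0r ?mulr0 // mul1r qhVX.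
Qed.
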